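(* Let $g\in\mathcal{H}(\mathbb{D})$, and let $\{\beta_n\}_{n=0}^\infty$ be a sequence of positive numbers with $\lim_{n\to\infty}\sqrt[n]{\beta_n}=1$. (i) Let $X,Y\subset\mathcal{H}(\mathbb{D})$ be Banach spaces such that $X^*\simeq Y$ via the $H(\beta)$-pairing. Then $T_g:X\to H^\infty$ is bounded if and only if $\sup_{z\in\mathbb{D}}\|G^{H(\beta)}_{g,z}\|_Y<\infty$, where $$\overline{G^{H(\beta)}_{g,z}(w)}=\int_0^z g'(\zeta)\,\overline{K^{H(\beta)}_\zeta(w)}\,d\zeta=\overline{T_g^*(K^{H(\beta)}_z)(w)},\qquad z\in\mathbb{D},\ w\in\overline{\mathbb{D}},$$ the second equality meaning that $T_g(f)(z)=\langle f,G^{H(\beta)}_{g,z}\rangle_{H(\beta)}$ for all $f\in X$ and $z\in\mathbb{D}$. (ii) If $X\subset\mathcal{H}(\mathbb{D})$ is a reflexive admissible Banach space and $H^\infty\subset X$, then $T_g:X\to H^\infty$ is bounded if and only if $T_g:X\to A$ is bounded.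
   Context: $\mathbb{D}$ is the open unit disc, $\mathcal{H}(\mathbb{D})$ the space of analytic functions in $\mathbb{D}$, $H^\infty$ the bounded analytic functions in $\mathbb{D}$ with the sup norm, $A$ the disc algebra (functions analytic in $\mathbb{D}$ and continuous on $\overline{\mathbb{D}}$, sup norm). For $g\in\mathcal{H}(\mathbb{D})$, $T_g(f)(z)=\int_0^z f(\zeta)g'(\zeta)\,d\zeta$. $H(\beta)$-pairing: for $f(z)=\sum\widehat f(n)z^n$, $h(z)=\sum\widehat h(n)z^n$, $\langle f,h\rangle_{H(\beta)}=\lim_{r\to1^-}\sum_{n=0}^\infty\widehat f(n)\overline{\widehat h(n)}\beta_n r^n$. $H(\beta)$ is the Hilbert space of analytic functions in $\mathbb{D}$ induced by this pairing; its reproducing kernels are $K^{H(\beta)}_z(\zeta)=\sum_{n=0}^\infty (\zeta\overline z)^n/\beta_n$. $X^*\simeq Y$ via the $H(\beta)$-pairing means: $\langle f,h\rangle_{H(\beta)}$ exists for all $f\in X$, $h\in Y$; the functional $L_h(f)=\langle f,h\rangle_{H(\beta)}$ satisfies $C^{-1}\|h\|_Y\le\|L_h\|\le C\|h\|_Y$ for some constant $C>0$; and each $L\in X^*$ equals $L_h$ for some $h\in Y$. A Banach space $X\subset\mathcal{H}(\mathbb{D})$ is admissible if: (P1) $A\subset X$; (P2) if $f\in X$, then $f_r\in X$ for $0<r<1$, where $f_r(z)=f(rz)$, and $\sup_{0<r<1}\|f_r\|_X\le C\|f\|_X$ with $C$ independent of $f$; (P3) for every $z\in\mathbb{D}$ the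 point evaluation $f\mapsto f(z)$ belongs to $X^*$. Convention: $\|h\|_Y=\infty$ if $h\notin Y$.
   Formalization: In (i) the norm equivalence in X*≃Y is required for every analytic h pairing with all of X (norm infinite off Y), so only h=0 annihilates X; with it only for h in Y, (i) fails for X=Y=constants, β_n=1, g(z)=z. *)

(* Defs.v *)
From Stdlib Require Import Reals.
From Coquelicot Require Import Coquelicot.

Open Scope R_scope.

Definition unit_disc (z : C) : Prop := Cmod z < 1.
Definition closed_disc (z : C) : Prop := Cmod z <= 1.

(* A function on the disc is encoded as a total function [C -> C] of which only
   the values on [unit_disc] are meaningful; all notions below ignore the others. *)
Definition eq_on_disc (f h : C -> C) : Prop := forall z, unit_disc z -> f z = h z.

Definition analytic (f : C -> C) : Prop :=
  forall z0, unit_disc z0 ->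
    exists (rho : R) (a : nat -> C), 0 < rho /\
      forall z, Cmod (z - z0) < rho ->
        @is_pseries C_AbsRing C_NormedModule a (z - z0)%C (f z).

(* [a] is the sequence of Taylor coefficients of [f] at 0. *)
Definition taylor (f : C -> C) (a : nat -> C) : Prop :=
  forall z, unit_disc z -> @is_pseries C_AbsRing C_NormedModule a z (f z).

Definition dilate (r : R) (f : C -> C) : C -> C := fun z => f (r * z)%C.

Definition sup_norm (f : C -> C) : Rbar :=
  Lub_Rbar (fun t => exists z, unit_disc z /\ t = Cmod (f z)).

Definition in_Hinf (f : C -> C) : Prop := analytic f /\ is_finite (sup_norm f).

(* By continuity, the sup over the closed disc of an element of the disc algebra
   is its [sup_norm]. *)
Definition in_disc_algebra (f : C -> C) : Prop :=
  analytic f /\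
  exists F : C -> C, eq_on_disc F f /\
    @continuous_on C_UniformSpace C_UniformSpace closed_disc F.

(* A Banach space contained in H(D): a complex Banach space with a linear map
   into the analytic functions which is injective for equality on the disc.
   The inclusion is not required to be continuous. *)
Record banach_of_analytic := BanachOfAnalytic {
  carrier :> CompleteNormedModule C_AbsRing;
  fn : carrier -> C -> C;
  fn_analytic : forall x, analytic (fn x);
  fn_plus : forall x y z, unit_disc z -> fn (plus x y) z = (fn x z + fn y z)%C;
  fn_scal : forall (c : C) x z, unit_disc z -> fn (scal c x) z = (c * fn x z)%C;
  fn_inj : forall x y, eq_on_disc (fn x) (fn y) -> x = y
}.
Arguments fn {_} _ _.

Definition in_space (X : banach_of_analytic) (f : C -> C) : Prop :=
  exists x : X, eq_on_disc (fn x) f.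

(* The infimum runs over at most one value, and is [p_infty] if [f] is not in [X]. *)
Definition ext_norm (X : banach_of_analytic) (f : C -> C) : Rbar :=
  Glb_Rbar (fun t => exists x : X, eq_on_disc (fn x) f /\ t = norm x).

Definition in_dual (X : banach_of_analytic) (L : X -> C) : Prop :=
  @is_linear C_AbsRing X C_NormedModule L.

Definition op_norm (X : banach_of_analytic) (L : X -> C) : Rbar :=
  Lub_Rbar (fun t => exists x : X, norm x <= 1 /\ t = Cmod (L x)).
Arguments op_norm {X} L.

(* Elements of the bidual are represented by functions [Phi] on all of [X -> C],
   of which only the values on the dual are constrained; the last conclusion
   says that [Phi] is the image of [x] under the canonical embedding. *)
Definition reflexive (X : banach_of_analytic) : Prop :=
  forall Phi : (X -> C) -> C,
    (forall L1 L2, in_dual X L1 -> in_dual X L2 ->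
       Phi (fun x => L1 x + L2 x)%C = (Phi L1 + Phi L2)%C) ->
    (forall c L, in_dual X L -> Phi (fun x => c * L x)%C = (c * Phi L)%C) ->
    (exists M : R, 0 <= M /\
       forall L, in_dual X L -> Rbar_le (Cmod (Phi L)) (Rbar_mult M (op_norm L))) ->
    exists x : X, forall L, in_dual X L -> Phi L = L x.

Definition admissible (X : banach_of_analytic) : Prop :=
  (forall f, in_disc_algebra f -> in_space X f) /\
  ((forall (x : X) r, 0 < r < 1 -> in_space X (dilate r (fn x))) /\
   exists M : R, forall (x : X) r, 0 < r < 1 ->
     Rbar_le (ext_norm X (dilate r (fn x))) (M * norm x)) /\
  (forall z, unit_disc z -> in_dual X (fun x => fn x z)).

Definition is_pairing (beta : nat -> R) (f h : C -> C) (l : C) : Prop :=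
  exists a b : nat -> C, taylor f a /\ taylor h b /\
  exists S : R -> C,
    (forall r, 0 < r < 1 ->
       @is_series C_AbsRing C_NormedModule
         (fun n => a n * Cconj (b n) * beta n * (r ^ n)%R)%C (S r)) /\
    filterlim S (at_left 1) (@locally C_UniformSpace l).

Definition ex_pairing beta f h : Prop := exists l, is_pairing beta f h l.

Definition pairing beta f h : C :=
  @iota C_CompleteNormedModule (is_pairing beta f h).

(* The norm equivalence is stated with the convention that [ext_norm Y h] is
   infinite if [h] is not in [Y]: it ranges over every analytic [h] for which the
   functional L_h is defined on [X], and so says that L_h is bounded exactly when
   [h] belongs to [Y].  Restricting it to [h] in [Y] would allow spaces such as
   X = Y = {constants}, where a functional does not determine its symbol. *)
Definition dual_via (beta : nat -> R) (X Y : banach_of_analytic) : Prop :=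
  (forall (x : X) (y : Y), ex_pairing beta (fn x) (fn y)) /\
  (exists K : R, 0 < K /\
     forall h : C -> C, analytic h ->
       (forall x : X, ex_pairing beta (fn x) h) ->
       Rbar_le (Rbar_mult (/ K)%R (ext_norm Y h))
               (op_norm (fun x : X => pairing beta (fn x) h)) /\
       Rbar_le (op_norm (fun x : X => pairing beta (fn x) h))
               (Rbar_mult K (ext_norm Y h))) /\
  (forall L : X -> C, in_dual X L ->
     exists y : Y, forall x : X, L x = pairing beta (fn x) (fn y)).

(* The integral of [F] along the segment from 0 to [z]. *)
Definition int0 (F : C -> C) (z : C) : C :=
  (z * @RInt C_R_CompleteNormedModule (fun t => F (t * z)) 0 1)%C.

Definition volterra (g f : C -> C) : C -> C :=
  int0 (fun zeta => f zeta * C_derive g zeta)%C.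

(* [repr_kernel beta z w] is K_z(w), the reproducing kernel of H(beta). *)
Definition repr_kernel (beta : nat -> R) (z w : C) : C :=
  @iota C_CompleteNormedModule
    (@is_series C_AbsRing C_NormedModule
       (fun n => Cpow (w * Cconj z) n / beta n)%C).

(* [sym_G beta g z w] is G_{g,z}(w). *)
Definition sym_G (beta : nat -> R) (g : C -> C) (z w : C) : C :=
  Cconj (int0 (fun zeta => C_derive g zeta * Cconj (repr_kernel beta zeta w))%C z).

Definition volterra_bounded_to (B : (C -> C) -> Prop) (X : banach_of_analytic)
    (g : C -> C) : Prop :=
  (forall x : X, B (volterra g (fn x))) /\
  exists M : R, forall x : X, Rbar_le (sup_norm (volterra g (fn x))) (M * norm x).

(* Main.v *)
(** Part (i).  By Cauchy's formula every analytic function on the disc is its Taylor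
    series, and integrating term by term gives [T_g f(z) = sum a_n m_n] with
    [m_n = \int_0^z g'(x) x^n dx]; since the n-th Taylor coefficient of [G_{g,z}] is
    [conj m_n / beta_n], this is the pairing of [f] with [G_{g,z}].  So the norm of
    [f |-> T_g f(z)] is comparable to the Y-norm of [G_{g,z}], and one takes suprema over z.

    Part (ii).  Let [zeta] be a boundary point and let [L f] be the difference of the limits
    of [T_g f] along two ultrafilters converging to [zeta] inside the disc, a bounded
    functional on X.  Integrating by parts, [T_g f_r - f(r zeta) g] has a limit at [zeta],
    so [L f_r = f(r zeta) L 1].  By reflexivity and (P2), if [L f_{r_k}] is constant along
    a sequence [r_k -> 1] then [L f] is that constant.  The bounded function
    [h(z) = (1 - conj zeta z)^i] takes the values 1 and -1 at points [r zeta] with r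
    arbitrarily close to 1, so [L h = L 1 = - L 1], hence [L 1 = 0] and then [L f = 0] for
    all f in X: [T_g f] has a limit at every boundary point. *)

From mathcomp Require filter.
Require Import Defs.
From Stdlib Require Import Reals Lra Lia Classical ClassicalEpsilon FunctionalExtensionality.
From Coquelicot Require Import Coquelicot.

(** * The complex plane as a normed module *)

(** The definition of [analytic] gives a power series near each point, whereas the pairing and the
    symbol use one Taylor series at 0 valid on the whole disc; Cauchy's formula closes this gap. It
    is proved by contracting a circle to a point, with a continuous derivative at hand because power
    series can be differentiated twice.

    In part (i) the limit over [r] in the pairing is harmless: [m_n] is [O(|z|^n)], so the series
    has radius of convergence greater than 1 in [r].

    In part (ii) the functional [L] must be defined on all of X before any limit is known to exist;
    ultrafilters supply limits of bounded functions, and these depend linearly on the function. From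
    [T_g 1 = g - g(0)] one learns only that [g] is bounded, not that it has a limit at [zeta], and
    [L 1] is exactly the possible gap. For [w = conj zeta z] the modulus of [(1 - w)^i] is
    [exp(- arg(1 - w))], which stays between [exp(- PI/2)] and [exp(PI/2)], while at
    [w = 1 - e^(-t)] the value is [e^(-it)]: the function turns forever along the radius and is 1 at
    [t = 2 k PI] and -1 at [t = (2k + 1) PI]. *)

Notation C_is_series := (@is_series C_AbsRing C_NormedModule).
Notation C_ex_series := (@ex_series C_AbsRing C_NormedModule).
Notation C_is_derive := (@is_derive C_AbsRing C_NormedModule).
Notation C_continuous := (@continuous C_UniformSpace C_UniformSpace).
Notation C_locally := (@locally C_UniformSpace).

(** The balls of the product uniform structure on the plane are squares; they define the same
    neighbourhoods as the discs of [Cmod], in which all estimates are written. *)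
Lemma C_locally_eps (z : C) (P : C -> Prop) :
  C_locally z P <-> exists d, 0 < d /\ forall w, Cmod (w - z) < d -> P w.
Proof.
split.
- intros H.
  destruct (@locally_norm_le_locally C_AbsRing C_NormedModule z P H) as [d Hd].
  exists d; split; [apply cond_pos|]. intros w Hw; apply Hd. exact Hw.
- intros [d [Hd H]].
  apply (@locally_le_locally_norm C_AbsRing C_NormedModule z P).
  exists (mkposreal d Hd). intros w Hw; apply H. exact Hw.
Qed.

Lemma C_filterlim_eps {T : Type} (F : (T -> Prop) -> Prop) {FF : Filter F}
    (f : T -> C) (l : C) :
  filterlim f F (C_locally l) <->
  forall eps, 0 < eps -> F (fun x => Cmod (f x - l) < eps).
Proof.
split.
- intros H eps Heps. apply (H (fun w => Cmod (w - l) < eps)).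
  apply C_locally_eps. exists eps; auto.
- intros H P HP. destruct (proj1 (C_locally_eps l P) HP) as [d [Hd HPd]].
  unfold filtermap. generalize (H d Hd). apply filter_imp; auto.
Qed.

Lemma C_continuous_eps (f : C -> C) (z : C) :
  C_continuous f z <->
  forall eps, 0 < eps -> exists d, 0 < d /\
    forall w, Cmod (w - z) < d -> Cmod (f w - f z) < eps.
Proof.
unfold continuous. rewrite (C_filterlim_eps (C_locally z)).
split; intros H eps Heps.
- apply (C_locally_eps z (fun w => Cmod (f w - f z) < eps)), H, Heps.
- apply C_locally_eps, H, Heps.
Qed.

Lemma C_is_series_eps (a : nat -> C) (l : C) :
  C_is_series a l <->
  forall eps, 0 < eps -> exists N, forall n, (N <= n)%nat ->
    Cmod (@sum_n C_AbelianMonoid a n - l) < eps.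
Proof.
unfold is_series. etransitivity.
apply (C_filterlim_eps eventually). reflexivity.
Qed.

Lemma C_is_derive_eps (f : C -> C) (z l : C) :
  C_is_derive f z l <->
  forall eps, 0 < eps -> exists d, 0 < d /\ forall w, Cmod (w - z) < d ->
    Cmod (f w - f z - l * (w - z)) <= eps * Cmod (w - z).
Proof.
split.
- intros [_ H] eps Heps.
  specialize (H z (fun P HP => HP) (mkposreal eps Heps)). simpl in H.
  apply locally_C in H. apply C_locally_eps in H. destruct H as [d [Hd H]].
  exists d; split; auto. intros w Hw. specialize (H w Hw).
  replace (l * (w - z))%C with ((w - z) * l)%C by ring. exact H.
- intros H. split. apply is_linear_scal_l.
  intros x Hx eps.
  apply (@is_filter_lim_locally_unique C_AbsRing (AbsRing_NormedModule C_AbsRing)) in Hx.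
  subst x.
  apply locally_C. apply C_locally_eps. destruct (H eps (cond_pos eps)) as [d [Hd H']].
  exists d; split; auto. intros w Hw. specialize (H' w Hw).
  replace (l * (w - z))%C with ((w - z) * l)%C in H' by ring. exact H'.
Qed.

(** * Complex power series *)

Notation C_sum_n := (@sum_n C_AbelianMonoid).

Lemma ratio_lt_1 (x s : R) : 0 <= x -> x < s -> 0 <= x / s < 1.
Proof.
intros Hx Hs. split.
- apply Rmult_le_pos; auto. left; apply Rinv_0_lt_compat; lra.
- apply Rmult_lt_reg_r with s; [lra|]. field_simplify; lra.
Qed.

Lemma RtoC_INR_S_neq_0 (n : nat) : RtoC (INR (S n)) <> 0%C.
Proof. intros H. apply RtoC_inj in H. revert H. apply not_0_INR. lia. Qed.

Lemma Cconj_RtoC (x : R) : Cconj (RtoC x) = RtoC x.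
Proof. unfold Cconj, RtoC; simpl. f_equal. ring. Qed.

Lemma C_is_series_unique (a : nat -> C) (l1 l2 : C) :
  C_is_series a l1 -> C_is_series a l2 -> l1 = l2.
Proof. intros H1 H2. exact (filterlim_locally_unique _ _ _ H1 H2). Qed.

Definition C_Series (a : nat -> C) : C :=
  @iota C_CompleteNormedModule (C_is_series a).

Lemma C_Series_unique (a : nat -> C) (l : C) : C_is_series a l -> C_Series a = l.
Proof.
intros H. apply (@iota_unique C_AbsRing C_CompleteNormedModule); auto.
intros y Hy. exact (C_is_series_unique a y l Hy H).
Qed.

Lemma C_Series_correct (a : nat -> C) : C_ex_series a -> C_is_series a (C_Series a).
Proof. intros [l Hl]. rewrite (C_Series_unique a l Hl). exact Hl. Qed.

Lemma C_ex_series_le (a : nat -> C) (b : nat -> R) :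
  (forall n, Cmod (a n) <= b n) -> ex_series b -> C_ex_series a.
Proof. apply (@ex_series_le C_AbsRing C_CompleteNormedModule). Qed.

Lemma C_is_series_ext (a b : nat -> C) (l : C) :
  (forall n, a n = b n) -> C_is_series a l -> C_is_series b l.
Proof. apply is_series_ext. Qed.

Lemma C_is_series_scal (c : C) (a : nat -> C) (l : C) :
  C_is_series a l -> C_is_series (fun n => (c * a n)%C) (c * l)%C.
Proof. apply (@is_series_scal C_AbsRing C_NormedModule). Qed.

Lemma C_is_series_minus (a b : nat -> C) (la lb : C) :
  C_is_series a la -> C_is_series b lb ->
  C_is_series (fun n => (a n - b n)%C) (la - lb)%C.
Proof. apply (@is_series_minus C_AbsRing C_NormedModule). Qed.

Lemma C_sum_n_le (a : nat -> C) (b : nat -> R) (n : nat) :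
  (forall n, Cmod (a n) <= b n) -> Cmod (C_sum_n a n) <= sum_n b n.
Proof.
intros H. induction n as [|n IH].
- rewrite 2!sum_O. apply H.
- rewrite 2!sum_Sn. apply Rle_trans with (1 := Cmod_triangle _ _).
  apply Rplus_le_compat; auto.
Qed.

Lemma C_series_le (a : nat -> C) (b : nat -> R) (la : C) (lb : R) :
  (forall n, Cmod (a n) <= b n) -> C_is_series a la -> is_series b lb ->
  Cmod la <= lb.
Proof.
intros H Ha Hb.
assert (Hc : is_lim_seq (fun n => Cmod (C_sum_n a n)) (Cmod la)).
{ refine (filterlim_comp _ _ _ _ _ _ _ _ Ha _).
  apply (@filterlim_norm C_AbsRing C_NormedModule). }
assert (Hs : is_lim_seq (sum_n b) lb) by exact Hb.
refine (is_lim_seq_le _ _ _ _ _ Hc Hs).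
intros n; apply C_sum_n_le, H.
Qed.

Lemma C_series_tail (a : nat -> C) (b : nat -> R) (la : C) (lb : R) (n : nat) :
  (forall n, Cmod (a n) <= b n) -> C_is_series a la -> is_series b lb ->
  Cmod (la - C_sum_n a n) <= lb - sum_n b n.
Proof.
intros H Ha Hb.
apply (C_series_le (fun k => a (S n + k)%nat) (fun k => b (S n + k)%nat)); auto.
- apply (@is_series_incr_n C_AbsRing C_NormedModule a (S n) (la - C_sum_n a n)%C); [lia|].
  simpl pred.
  match goal with |- is_series a ?x => replace x with la; auto end.
  change (la = (la - C_sum_n a n + C_sum_n a n)%C). ring.
- apply (@is_series_incr_n _ _ b (S n) (lb - sum_n b n)); [lia|]. simpl pred.
  match goal with |- is_series b ?x => replace x with lb; auto end.
  change (lb = (lb - sum_n b n + sum_n b n)). ring.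
Qed.

Lemma C_is_series_zero : C_is_series (fun _ => RtoC 0) (RtoC 0).
Proof.
apply C_is_series_eps. intros eps Heps. exists 0%nat. intros n _.
assert (C_sum_n (fun _ => RtoC 0) n = RtoC 0) as ->.
{ induction n as [|n IH]; [apply sum_O|]. rewrite sum_Sn, IH.
  exact (Cplus_0_l 0). }
replace (0 - 0)%C with (RtoC 0) by ring. now rewrite Cmod_0.
Qed.

Lemma C_is_series_incr (a : nat -> C) (l : C) :
  a 0%nat = 0%C -> C_is_series a l -> C_is_series (fun n => a (S n)) l.
Proof.
intros H0 H. apply (@is_series_incr_1 C_AbsRing C_NormedModule).
rewrite H0. match goal with |- is_series a ?x => replace x with l; auto end.
change (l = (l + 0)%C). ring.
Qed.

Lemma C_is_series_decr (a : nat -> C) (l : C) :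
  a 0%nat = 0%C -> C_is_series (fun n => a (S n)) l -> C_is_series a l.
Proof.
intros H0 H. apply (@is_series_decr_1 C_AbsRing C_NormedModule).
rewrite H0. match goal with |- is_series _ ?x => replace x with l; auto end.
change (l = (l + - 0)%C). ring.
Qed.

Lemma C_is_pseries (a : nat -> C) (z l : C) :
  @is_pseries C_AbsRing C_NormedModule a z l <->
  C_is_series (fun n => (a n * z ^ n)%C) l.
Proof.
unfold is_pseries. split; apply is_series_ext; intros n;
  apply Cmult_comm.
Qed.

Lemma C_ex_series_bounded (a : nat -> C) (l : C) :
  C_is_series a l -> exists B, 0 <= B /\ forall n, Cmod (a n) <= B.
Proof.
intros H. rewrite C_is_series_eps in H. destruct (H 1 Rlt_0_1) as [N HN].
assert (H1 : forall m, exists B, 0 <= B /\ forall n, (n <= m)%nat -> Cmod (a n) <= B).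
{ induction m as [|m [B [HB IH]]].
  - exists (Cmod (a 0%nat)). split; [apply Cmod_ge_0|]. intros n Hn.
    replace n with 0%nat by lia. lra.
  - exists (B + Cmod (a (S m))). generalize (Cmod_ge_0 (a (S m))); intros.
    split; [lra|]. intros n Hn. destruct (Nat.eq_dec n (S m)) as [->|Hne]; [lra|].
    specialize (IH n ltac:(lia)). lra. }
destruct (H1 (S N)) as [B [HB HB']]. exists (B + 2). split; [lra|].
intros n. destruct (Compare_dec.le_lt_dec n (S N)) as [Hn|Hn].
- specialize (HB' n Hn). lra.
- destruct n as [|n]; [lia|].
  replace (a (S n)) with ((C_sum_n a (S n) - l) - (C_sum_n a n - l))%C.
  2: { rewrite sum_Sn. change (plus (C_sum_n a n) (a (S n))) with (C_sum_n a n + a (S n))%C.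
       ring. }
  apply Rle_trans with (Cmod (C_sum_n a (S n) - l) + Cmod (C_sum_n a n - l)).
  rewrite <- (Cmod_opp (C_sum_n a n - l)). apply Cmod_triangle.
  generalize (HN (S n) ltac:(lia)) (HN n ltac:(lia)). lra.
Qed.

(** [n^2] is dominated by [(n + 1)(n + 2)], the coefficients of the second derivative of the
    geometric series, which has the same radius of convergence. *)
Lemma ex_series_sqr_geom (q : R) :
  0 <= q < 1 -> ex_series (fun n => INR n * INR n * q ^ n).
Proof.
intros Hq.
assert (Hr : Rbar_lt (Rabs q) (CV_radius (PS_derive (PS_derive (fun _ => 1))))).
{ rewrite 2!CV_radius_derive.
  apply Rbar_lt_le_trans with ((q + 1) / 2).
  - simpl. rewrite Rabs_pos_eq; lra.
  - apply (proj1 (CV_radius_bounded (fun _ => 1))).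
    exists 1. intros n. rewrite Rmult_1_l.
    assert (Hq2 : 0 <= (q + 1) / 2 <= 1) by lra.
    rewrite Rabs_pos_eq; [|apply pow_le, Hq2].
    apply Rle_trans with (1 ^ n); [apply pow_incr, Hq2|]. rewrite pow1. apply Rle_refl. }
apply CV_disk_inside in Hr.
apply (ex_series_le (V := R_CompleteNormedModule)) with (2 := Hr).
intros n. change (norm (INR n * INR n * q ^ n)) with (Rabs (INR n * INR n * q ^ n)).
generalize (pos_INR n) (pow_le q n (proj1 Hq)); intros Hn Hp.
unfold PS_derive. rewrite !S_INR.
rewrite 2!Rabs_pos_eq.
- apply Rmult_le_compat_r; auto. nra.
- apply Rmult_le_pos; auto. nra.
- apply Rmult_le_pos; auto. nra.
Qed.

Lemma ex_series_geom_bound (q B : R) :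
  0 <= q < 1 -> ex_series (fun n => B * q ^ n).
Proof.
intros Hq. apply (@ex_series_scal R_AbsRing R_NormedModule).
apply ex_series_geom. rewrite Rabs_pos_eq; lra.
Qed.

(* The coefficient bound [Cmod (a n) * rho ^ n <= B] is the convenient form of
   "radius of convergence at least [rho]". *)
Lemma C_ex_pseries_bound (a : nat -> C) (rho B : R) (z : C) :
  (forall n, Cmod (a n) * rho ^ n <= B) -> Cmod z < rho ->
  C_ex_series (fun n => (a n * z ^ n)%C).
Proof.
intros H Hz. generalize (Cmod_ge_0 z); intros Hz0.
apply C_ex_series_le with (fun n => B * (Cmod z / rho) ^ n).
- intros n. rewrite Cmod_mult, Cmod_pow.
  unfold Rdiv. rewrite Rpow_mult_distr, pow_inv.
  assert (0 < rho ^ n) by (apply pow_lt; lra).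
  apply Rmult_le_reg_r with (rho ^ n); auto.
  replace (B * (Cmod z ^ n * / rho ^ n) * rho ^ n) with (B * Cmod z ^ n) by (field; lra).
  replace (Cmod (a n) * Cmod z ^ n * rho ^ n)
    with (Cmod (a n) * rho ^ n * Cmod z ^ n) by ring.
  apply Rmult_le_compat_r; auto. apply pow_le; auto.
- apply ex_series_geom_bound. split.
  + apply Rmult_le_pos; auto. left; apply Rinv_0_lt_compat; lra.
  + apply Rmult_lt_reg_r with rho; [lra|]. field_simplify; lra.
Qed.

Lemma pseries_coeff_bound (a : nat -> C) (f : C -> C) (rho s : R) :
  (forall z, Cmod z < rho -> C_is_series (fun n => (a n * z ^ n)%C) (f z)) ->
  0 <= s < rho -> exists B, 0 <= B /\ forall n, Cmod (a n) * s ^ n <= B.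
Proof.
intros H Hs.
assert (Hms : Cmod s = s) by (rewrite Cmod_R; apply Rabs_pos_eq; lra).
destruct (C_ex_series_bounded _ _ (H s ltac:(rewrite Hms; lra))) as [B [HB HB']].
exists B; split; auto. intros n. specialize (HB' n).
now rewrite Cmod_mult, Cmod_pow, Hms in HB'.
Qed.

(** The second-order remainders satisfy [D_(n+1) = w D_n + n z^(n-1) (w - z)^2], which carries the
    induction. The factor [r^2] on the left avoids the exponent [n - 2] on the right. *)
Lemma Cpow_taylor2 (r : R) (z w : C) (n : nat) :
  0 < r -> Cmod z <= r -> Cmod w <= r ->
  r ^ 2 * Cmod (w ^ n - z ^ n - INR n * z ^ pred n * (w - z))
    <= INR n * INR n * r ^ n * Cmod (w - z) ^ 2.
Proof.
intros Hr Hz Hw. generalize (Cmod_ge_0 (w - z)); intros Hh.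
induction n as [|n IH].
- simpl. replace (1 - 1 - 0 * 1 * (w - z))%C with (RtoC 0) by ring.
  rewrite Cmod_0. lra.
- set (D := (w ^ n - z ^ n - INR n * z ^ pred n * (w - z))%C) in *.
  replace (w ^ S n - z ^ S n - INR (S n) * z ^ pred (S n) * (w - z))%C
    with (w * D + INR n * z ^ pred n * ((w - z) * (w - z)))%C.
  2: { unfold D. rewrite S_INR, RtoC_plus. simpl pred. rewrite !Cpow_S.
       destruct n as [|n]; [simpl; ring|]. simpl pred. rewrite !Cpow_S. ring. }
  assert (Hn : r ^ 2 * (INR n * Cmod z ^ pred n) <= INR n * r ^ S n).
  { destruct n as [|n]; [simpl; lra|]. simpl pred.
    replace (INR (S n) * r ^ S (S n)) with (r ^ 2 * (INR (S n) * r ^ n)) by (simpl; ring).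
    apply Rmult_le_compat_l; [apply pow2_ge_0|].
    apply Rmult_le_compat_l; [apply pos_INR|].
    apply pow_incr. split; auto. apply Cmod_ge_0. }
  apply Rle_trans with
    (r ^ 2 * (r * Cmod D + INR n * Cmod z ^ pred n * (Cmod (w - z) * Cmod (w - z)))).
  { apply Rmult_le_compat_l; [apply pow2_ge_0|].
    apply Rle_trans with (1 := Cmod_triangle _ _).
    rewrite !Cmod_mult, Cmod_pow, Cmod_R, (Rabs_pos_eq (INR n)) by apply pos_INR.
    apply Rplus_le_compat_r. apply Rmult_le_compat_r; auto. apply Cmod_ge_0. }
  rewrite S_INR. replace (r ^ S n) with (r * r ^ n) in * by reflexivity.
  generalize (pos_INR n) (pow_lt r n Hr); intros Hn0 Hrn.
  apply Rle_trans with (r * (INR n * INR n * r ^ n * Cmod (w - z) ^ 2)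
      + INR n * (r * r ^ n) * Cmod (w - z) ^ 2).
  { replace (r ^ 2 * (r * Cmod D + INR n * Cmod z ^ pred n * (Cmod (w - z) * Cmod (w - z))))
     with (r * (r ^ 2 * Cmod D) + r ^ 2 * (INR n * Cmod z ^ pred n) * Cmod (w - z) ^ 2) by ring.
    apply Rplus_le_compat.
    - apply Rmult_le_compat_l; lra.
    - apply Rmult_le_compat_r; auto. apply pow2_ge_0. }
  assert (0 <= r * r ^ n * Cmod (w - z) ^ 2).
  { apply Rmult_le_pos; [|apply pow2_ge_0]. nra. }
  nra.
Qed.

(** For [|z| < r < s < rho] the coefficients are [O(s^(-n))], so the second-order remainders of the
    terms, controlled on [|w| <= r] by [Cpow_taylor2], add up to at most [S |w - z|^2]. This gives
    differentiability and the value of the derivative together. *)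
Lemma is_derive_pseries (a : nat -> C) (f : C -> C) (rho : R) (z : C) :
  (forall z, Cmod z < rho -> C_is_series (fun n => (a n * z ^ n)%C) (f z)) ->
  Cmod z < rho ->
  exists l, C_is_series (fun n => (INR (S n) * a (S n) * z ^ n)%C) l /\
    C_is_derive f z l.
Proof.
intros H Hz. generalize (Cmod_ge_0 z); intros Hz0.
set (r := (Cmod z + (Cmod z + rho) / 2) / 2).
set (s := (Cmod z + rho) / 2).
assert (Hr : 0 < r /\ Cmod z < r /\ r < s /\ s < rho) by (unfold r, s; lra).
destruct Hr as [Hr0 [Hzr [Hrs Hsr]]].
destruct (pseries_coeff_bound a f rho s H ltac:(lra)) as [B [HB HBs]].
assert (Hq : 0 <= r / s < 1) by (apply ratio_lt_1; lra).
(* [c n] bounds the remainder of the n-th term divided by [|w - z|^2]; [r * c n] also dominates the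
   n-th term of the derived series. *)
set (c := fun n => B * / r ^ 2 * (INR n * INR n * (r / s) ^ n)).
assert (Hc : ex_series c).
{ apply (@ex_series_scal R_AbsRing R_NormedModule). apply ex_series_sqr_geom; auto. }
assert (Har : forall n, Cmod (a n) * r ^ n <= B * (r / s) ^ n).
{ intros n. unfold Rdiv. rewrite Rpow_mult_distr, pow_inv.
  assert (0 < s ^ n) by (apply pow_lt; lra).
  apply Rmult_le_reg_r with (s ^ n); auto.
  replace (B * (r ^ n * / s ^ n) * s ^ n) with (B * r ^ n) by (field; lra).
  replace (Cmod (a n) * r ^ n * s ^ n) with (Cmod (a n) * s ^ n * r ^ n) by ring.
  apply Rmult_le_compat_r; auto. apply pow_le; lra. }
set (b := fun n => (INR n * a n * z ^ pred n)%C).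
assert (Hb : C_ex_series b).
{ apply C_ex_series_le with (fun n => r * c n).
  2: apply (@ex_series_scal R_AbsRing R_NormedModule), Hc.
  intros n. unfold b, c. rewrite !Cmod_mult, Cmod_pow, Cmod_R, (Rabs_pos_eq (INR n)) by apply pos_INR.
  destruct n as [|n]; [simpl; lra|]. simpl pred.
  assert (1 <= INR (S n)) by (rewrite S_INR; generalize (pos_INR n); lra).
  apply Rle_trans with (INR (S n) * INR (S n) * / r * (Cmod (a (S n)) * r ^ (S n))).
  - apply Rle_trans with (INR (S n) * Cmod (a (S n)) * r ^ n).
    + apply Rmult_le_compat_l.
      apply Rmult_le_pos; [lra|apply Cmod_ge_0]. apply pow_incr; lra.
    + replace (INR (S n) * INR (S n) * / r * (Cmod (a (S n)) * r ^ S n))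
        with (INR (S n) * (INR (S n) * Cmod (a (S n)) * r ^ n)) by (simpl; field; lra).
      assert (0 <= INR (S n) * Cmod (a (S n)) * r ^ n).
      { apply Rmult_le_pos; [|apply pow_le; lra]. apply Rmult_le_pos; [lra|apply Cmod_ge_0]. }
      nra.
  - apply Rle_trans with (INR (S n) * INR (S n) * / r * (B * (r / s) ^ S n)).
    + apply Rmult_le_compat_l; auto. apply Rmult_le_pos; [nra|].
      left; apply Rinv_0_lt_compat; lra.
    + right. field. lra. }
destruct Hb as [l Hl]. exists l. split.
{ apply C_is_series_ext with (fun n => b (S n)). reflexivity.
  apply C_is_series_incr; auto. unfold b. simpl. ring. }
destruct Hc as [S HS].
assert (HS0 : 0 <= S).
{ apply Rle_trans with (Cmod 0); [apply Cmod_ge_0|].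
  apply (C_series_le (fun _ => RtoC 0) c); auto.
  - intros n. rewrite Cmod_0. unfold c.
    apply Rmult_le_pos. apply Rmult_le_pos; auto. left; apply Rinv_0_lt_compat, pow_lt; lra.
    apply Rmult_le_pos. generalize (pos_INR n); nra. apply pow_le; lra.
  - apply C_is_series_zero. }
apply C_is_derive_eps. intros eps Heps.
exists (Rmin (r - Cmod z) (eps / (S + 1))). split.
{ apply Rmin_glb_lt; [lra|]. apply Rdiv_lt_0_compat; lra. }
intros w Hw.
assert (Hw1 : Cmod (w - z) < r - Cmod z) by (eapply Rlt_le_trans; [exact Hw|apply Rmin_l]).
assert (Hw2 : Cmod (w - z) < eps / (S + 1)) by (eapply Rlt_le_trans; [exact Hw|apply Rmin_r]).
assert (Hwr : Cmod w < r).
{ replace w with ((w - z) + z)%C by ring. eapply Rle_lt_trans; [apply Cmod_triangle|]. lra. }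
generalize (Cmod_ge_0 (w - z)); intros Hh.
apply Rle_trans with (S * Cmod (w - z) ^ 2).
- apply (C_series_le (fun n => a n * w ^ n - a n * z ^ n - (w - z) * b n)%C
           (fun n => c n * Cmod (w - z) ^ 2)).
  + intros n.
    replace (a n * w ^ n - a n * z ^ n - (w - z) * b n)%C
      with (a n * (w ^ n - z ^ n - INR n * z ^ pred n * (w - z)))%C by (unfold b; ring).
    rewrite Cmod_mult. unfold c.
    assert (Hr2 : 0 < r ^ 2) by (apply pow_lt; auto).
    apply Rmult_le_reg_l with (r ^ 2); auto.
    generalize (Cpow_taylor2 r z w n Hr0 ltac:(lra) ltac:(lra)); intros Ht.
    replace (r ^ 2 * (B * / r ^ 2 * (INR n * INR n * (r / s) ^ n) * Cmod (w - z) ^ 2))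
      with (INR n * INR n * Cmod (w - z) ^ 2 * (B * (r / s) ^ n)) by (field; lra).
    apply Rle_trans with (INR n * INR n * Cmod (w - z) ^ 2 * (Cmod (a n) * r ^ n)).
    * generalize (Rmult_le_compat_l (Cmod (a n)) _ _ (Cmod_ge_0 _) Ht). lra.
    * apply Rmult_le_compat_l; auto. apply Rmult_le_pos; [|apply pow2_ge_0].
      generalize (pos_INR n); nra.
  + replace (f w - f z - l * (w - z))%C with (f w - f z - (w - z) * l)%C by ring.
    apply C_is_series_minus.
    apply C_is_series_minus; apply H; lra.
    apply C_is_series_scal, Hl.
  + apply (is_series_scal_r (Cmod (w - z) ^ 2)) in HS. exact HS.
- replace (S * Cmod (w - z) ^ 2) with ((S * Cmod (w - z)) * Cmod (w - z)) by ring.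
  apply Rmult_le_compat_r; auto.
  apply Rle_trans with ((S + 1) * (eps / (S + 1))).
  + apply Rmult_le_compat; lra.
  + right. field. lra.
Qed.

(** * Complex derivatives and paths *)

Notation CR := C_R_CompleteNormedModule.
Notation path_derive := (@is_derive R_AbsRing C_R_NormedModule).
Notation C_is_RInt := (@is_RInt C_R_NormedModule).

Lemma C_is_series_at_0 (a : nat -> C) : C_is_series (fun n => (a n * 0 ^ n)%C) (a 0%nat).
Proof.
apply C_is_series_eps. intros eps Heps. exists 0%nat. intros n _.
assert (C_sum_n (fun n => (a n * 0 ^ n)%C) n = a 0%nat) as ->.
{ induction n as [|n IH]; [rewrite sum_O; simpl; ring|]. rewrite sum_Sn, IH.
  rewrite Cpow_S. change (a 0%nat + a (S n) * (0 * 0 ^ n) = a 0%nat)%C. ring. }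
replace (a 0%nat - a 0%nat)%C with (RtoC 0) by ring. now rewrite Cmod_0.
Qed.

(** Evaluation at 0 identifies the constant terms; the induction hypothesis is applied to the
    derivative, whose coefficients are [(n + 1) a_(n+1)]. *)
Lemma pseries_unique (a b : nat -> C) (f : C -> C) (rho : R) :
  0 < rho ->
  (forall z, Cmod z < rho -> C_is_series (fun n => (a n * z ^ n)%C) (f z)) ->
  (forall z, Cmod z < rho -> C_is_series (fun n => (b n * z ^ n)%C) (f z)) ->
  forall n, a n = b n.
Proof.
intros Hrho Ha Hb n. revert a b f Ha Hb.
induction n as [|n IH]; intros a b f Ha Hb.
- transitivity (f 0%C); [symmetry|]; (eapply C_is_series_unique; [|apply C_is_series_at_0]).
  apply Ha; now rewrite Cmod_0. apply Hb; now rewrite Cmod_0.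
- assert (H : (INR (S n) * a (S n) = INR (S n) * b (S n))%C).
  { apply (IH (fun n => INR (S n) * a (S n))%C (fun n => INR (S n) * b (S n))%C (C_derive f));
    intros z Hz.
    - destruct (is_derive_pseries a f rho z Ha Hz) as [l [Hl Hd]].
      now rewrite (is_C_derive_unique _ _ _ Hd).
    - destruct (is_derive_pseries b f rho z Hb Hz) as [l [Hl Hd]].
      now rewrite (is_C_derive_unique _ _ _ Hd). }
  assert (Hn := RtoC_INR_S_neq_0 n).
  replace (a (S n)) with (/ INR (S n) * (INR (S n) * a (S n)))%C by (field; auto).
  rewrite H. field; auto.
Qed.

Lemma C_is_derive_continuous (f : C -> C) (z l : C) :
  C_is_derive f z l -> C_continuous f z.
Proof.
intros H. apply C_continuous_eps. intros eps Heps.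
rewrite C_is_derive_eps in H. destruct (H 1 Rlt_0_1) as [d [Hd H1]].
generalize (Cmod_ge_0 l); intros Hl.
exists (Rmin d (eps / (Cmod l + 2))). split.
{ apply Rmin_glb_lt; auto. apply Rdiv_lt_0_compat; lra. }
intros w Hw. specialize (H1 w (Rlt_le_trans _ _ _ Hw (Rmin_l _ _))).
assert (Hw2 := Rlt_le_trans _ _ _ Hw (Rmin_r _ _)).
replace (f w - f z)%C with ((f w - f z - l * (w - z)) + l * (w - z))%C by ring.
apply Rle_lt_trans with (1 := Cmod_triangle _ _). rewrite Cmod_mult.
generalize (Cmod_ge_0 (w - z)); intros Hh.
assert ((Cmod l + 2) * Cmod (w - z) < eps).
{ apply Rmult_lt_reg_r with (/ (Cmod l + 2)). apply Rinv_0_lt_compat; lra.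
  replace ((Cmod l + 2) * Cmod (w - z) * / (Cmod l + 2)) with (Cmod (w - z)) by (field; lra).
  exact Hw2. }
lra.
Qed.

(* [is_derive_mult] and [is_derive_id] use the uniform structure which [C] has as an
   absolute ring; a derivative depends only on the norm. *)
Lemma C_is_derive_AbsRing (f : C -> C) (z l : C) :
  C_is_derive f z l <-> @is_derive C_AbsRing (AbsRing_NormedModule C_AbsRing) f z l.
Proof. split; intros [[H1 H2 H3] H4]; split; [constructor| |constructor|]; assumption. Qed.

Lemma C_is_derive_plus (f g : C -> C) (z df dg : C) :
  C_is_derive f z df -> C_is_derive g z dg ->
  C_is_derive (fun w => (f w + g w)%C) z (df + dg)%C.
Proof. apply (@is_derive_plus C_AbsRing C_NormedModule). Qed.

Lemma C_is_derive_minus (f g : C -> C) (z df dg : C) :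
  C_is_derive f z df -> C_is_derive g z dg ->
  C_is_derive (fun w => (f w - g w)%C) z (df - dg)%C.
Proof. apply (@is_derive_minus C_AbsRing C_NormedModule). Qed.

Lemma C_is_derive_mult (f g : C -> C) (z df dg : C) :
  C_is_derive f z df -> C_is_derive g z dg ->
  C_is_derive (fun w => (f w * g w)%C) z (df * g z + f z * dg)%C.
Proof.
rewrite !C_is_derive_AbsRing. intros Hf Hg.
apply (@is_derive_mult C_AbsRing f g z df dg Hf Hg Cmult_comm).
Qed.

Lemma C_is_derive_const (c z : C) : C_is_derive (fun _ => c) z (RtoC 0).
Proof. apply (@is_derive_const C_AbsRing C_NormedModule). Qed.

Lemma C_is_derive_id (z : C) : C_is_derive (fun w => w) z (RtoC 1).
Proof. apply C_is_derive_AbsRing, (@is_derive_id C_AbsRing). Qed.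

Lemma C_is_derive_comp (f g : C -> C) (z df dg : C) :
  C_is_derive f (g z) df -> C_is_derive g z dg ->
  C_is_derive (fun w => f (g w)) z (dg * df)%C.
Proof.
rewrite (C_is_derive_AbsRing g). apply (@is_derive_comp C_AbsRing C_NormedModule).
Qed.

Lemma C_is_derive_scal (c : C) (f : C -> C) (z df : C) :
  C_is_derive f z df -> C_is_derive (fun w => (c * f w)%C) z (c * df)%C.
Proof.
intros H. replace (c * df)%C with (0 * f z + c * df)%C by ring.
apply C_is_derive_mult; auto. apply C_is_derive_const.
Qed.

Lemma C_is_derive_pow (n : nat) (z : C) :
  C_is_derive (fun w => (w ^ n)%C) z (INR n * z ^ pred n)%C.
Proof.
induction n as [|n IH].
- simpl. replace (0 * 1)%C with (RtoC 0) by ring. apply C_is_derive_const.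
- replace (INR (S n) * z ^ pred (S n))%C with (1 * z ^ n + z * (INR n * z ^ pred n))%C.
  + apply (C_is_derive_mult (fun w => w) (fun w => (w ^ n)%C)); auto. apply C_is_derive_id.
  + rewrite S_INR, RtoC_plus. destruct n; simpl; ring.
Qed.

Lemma path_derive_eps (p : R -> C) (t : R) (l : C) :
  path_derive p t l <->
  forall eps, 0 < eps -> exists d, 0 < d /\ forall s, Rabs (s - t) < d ->
    Cmod (p s - p t - (s - t)%R * l) <= eps * Rabs (s - t).
Proof.
assert (E : forall s, norm (minus (minus (p s) (p t)) (scal (minus s t) l) : C_R_NormedModule)
    = Cmod (p s - p t - (s - t)%R * l)).
{ intros s. rewrite Cmod_norm. f_equal.
  unfold minus, plus, opp, scal; simpl. unfold prod_plus, prod_opp, prod_scal; simpl.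
  unfold Cminus, Cplus, Copp, Cmult; simpl.
  unfold plus, opp, scal, mult; simpl. unfold mult; simpl. f_equal; ring. }
split.
- intros [_ H] eps Heps.
  specialize (H t (fun P HP => HP) (mkposreal eps Heps)). simpl in H.
  destruct H as [d Hd]. exists d; split; [apply cond_pos|].
  intros s Hs. eapply Rle_trans; [right; symmetry; apply E|]. apply (Hd s). exact Hs.
- intros H. split. apply is_linear_scal_l.
  intros x Hx eps.
  apply (@is_filter_lim_locally_unique R_AbsRing (AbsRing_NormedModule R_AbsRing)) in Hx.
  subst x. destruct (H eps (cond_pos eps)) as [d [Hd H']].
  exists (mkposreal d Hd). intros s Hs. eapply Rle_trans; [right; apply E|]. apply (H' s Hs).
Qed.

(** The outer derivative is over the complex field and the inner one over the reals, so the chain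
    rule is derived directly from the two epsilon characterizations. *)
Lemma path_derive_comp (f : C -> C) (p : R -> C) (t : R) (l dp : C) :
  C_is_derive f (p t) l -> path_derive p t dp ->
  path_derive (fun s => f (p s)) t (l * dp)%C.
Proof.
rewrite C_is_derive_eps, !path_derive_eps. intros Hf Hp eps Heps.
generalize (Cmod_ge_0 l) (Cmod_ge_0 dp); intros Hl Hdp.
set (e1 := eps / 2 / (Cmod dp + 1)).
assert (He1 : 0 < e1) by (unfold e1; apply Rdiv_lt_0_compat; lra).
set (e2 := Rmin 1 (eps / 2 / (Cmod l + 1))).
assert (He2 : 0 < e2) by (unfold e2; apply Rmin_glb_lt; [lra|]; apply Rdiv_lt_0_compat; lra).
destruct (Hf e1 He1) as [d1 [Hd1 H1]]. destruct (Hp e2 He2) as [d2 [Hd2 H2]].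
exists (Rmin d2 (d1 / (Cmod dp + 1))). split.
{ apply Rmin_glb_lt; auto. apply Rdiv_lt_0_compat; lra. }
intros s Hs. specialize (H2 s (Rlt_le_trans _ _ _ Hs (Rmin_l _ _))).
assert (Hs2 := Rlt_le_trans _ _ _ Hs (Rmin_r _ _)).
generalize (Rabs_pos (s - t)); intros Hst.
assert (Hps : Cmod (p s - p t) <= (Cmod dp + 1) * Rabs (s - t)).
{ replace (p s - p t)%C with ((p s - p t - (s - t)%R * dp) + (s - t)%R * dp)%C by ring.
  apply Rle_trans with (1 := Cmod_triangle _ _). rewrite Cmod_mult, Cmod_R.
  assert (e2 <= 1) by apply Rmin_l. nra. }
assert (Hlt : (Cmod dp + 1) * Rabs (s - t) < d1).
{ apply Rmult_lt_reg_r with (/ (Cmod dp + 1)). apply Rinv_0_lt_compat; lra.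
  replace ((Cmod dp + 1) * Rabs (s - t) * / (Cmod dp + 1)) with (Rabs (s - t)) by (field; lra).
  exact Hs2. }
specialize (H1 (p s) ltac:(lra)).
replace (f (p s) - f (p t) - (s - t)%R * (l * dp))%C
  with ((f (p s) - f (p t) - l * (p s - p t)) + l * (p s - p t - (s - t)%R * dp))%C by ring.
apply Rle_trans with (1 := Cmod_triangle _ _). rewrite Cmod_mult.
apply Rle_trans with (e1 * ((Cmod dp + 1) * Rabs (s - t)) + (Cmod l + 1) * (e2 * Rabs (s - t))).
- apply Rplus_le_compat.
  + eapply Rle_trans; [exact H1|]. apply Rmult_le_compat_l; lra.
  + apply Rmult_le_compat; auto; try lra. apply Cmod_ge_0.
- replace (e1 * ((Cmod dp + 1) * Rabs (s - t))) with (eps / 2 * Rabs (s - t))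
    by (unfold e1; field; lra).
  assert ((Cmod l + 1) * e2 <= eps / 2).
  { apply Rle_trans with ((Cmod l + 1) * (eps / 2 / (Cmod l + 1))).
    apply Rmult_le_compat_l; [lra|]. apply Rmin_r. right; field; lra. }
  nra.
Qed.

Lemma path_derive_pair (x y : R -> R) (t dx dy : R) :
  is_derive x t dx -> is_derive y t dy ->
  path_derive (fun s => (x s, y s)) t (dx, dy).
Proof.
assert (E : forall (x : R -> R) dx, is_derive x t dx -> forall eps, 0 < eps -> exists d, 0 < d /\
  forall s, Rabs (s - t) < d -> Rabs (x s - x t - (s - t) * dx) <= eps * Rabs (s - t)).
{ clear. intros x dx [_ H] eps Heps.
  specialize (H t (fun P HP => HP) (mkposreal eps Heps)). simpl in H.
  destruct H as [d Hd]. exists d; split; [apply cond_pos|].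
  intros s Hs. apply (Hd s). exact Hs. }
intros Hx Hy. apply path_derive_eps. intros eps Heps.
destruct (E x dx Hx (eps / 2) ltac:(lra)) as [d1 [Hd1 H1]].
destruct (E y dy Hy (eps / 2) ltac:(lra)) as [d2 [Hd2 H2]].
exists (Rmin d1 d2). split; [now apply Rmin_glb_lt|]. intros s Hs.
specialize (H1 s (Rlt_le_trans _ _ _ Hs (Rmin_l _ _))).
specialize (H2 s (Rlt_le_trans _ _ _ Hs (Rmin_r _ _))).
replace ((x s, y s) - (x t, y t) - (s - t)%R * (dx, dy))%C
  with (RtoC (x s - x t - (s - t) * dx) + Ci * RtoC (y s - y t - (s - t) * dy))%C.
2: { unfold Cminus, Cplus, Copp, Cmult, Ci, RtoC; simpl; f_equal; ring. }
apply Rle_trans with (1 := Cmod_triangle _ _). rewrite Cmod_mult, Cmod_Ci, !Cmod_R. lra.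
Qed.

Lemma Re_path_derive (p : R -> C) (t : R) (l : C) :
  path_derive p t l -> is_derive (fun s => Re (p s)) t (Re l).
Proof.
rewrite path_derive_eps. intros H. split. apply is_linear_scal_l.
intros x Hx eps.
apply (@is_filter_lim_locally_unique R_AbsRing (AbsRing_NormedModule R_AbsRing)) in Hx.
subst x. destruct (H eps (cond_pos eps)) as [d [Hd H']].
exists (mkposreal d Hd). intros s Hs. specialize (H' s Hs).
eapply Rle_trans; [|exact H']. eapply Rle_trans; [|apply re_le_Cmod].
right. change (Rabs (Re (p s) - Re (p t) - (s - t) * Re l)
  = Rabs (Re (p s - p t - (s - t)%R * l))).
apply f_equal. unfold Re, Cminus, Cplus, Copp, Cmult, RtoC; simpl. ring.
Qed.

(** * Integrals along paths *)

Notation path_continuous := (@continuous R_UniformSpace C_UniformSpace).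

Lemma path_continuous_eps (p : R -> C) (t : R) :
  path_continuous p t <->
  forall eps, 0 < eps -> exists d, 0 < d /\
    forall s, Rabs (s - t) < d -> Cmod (p s - p t) < eps.
Proof.
unfold continuous. rewrite (C_filterlim_eps (locally t)).
split; intros H eps Heps.
- destruct (H eps Heps) as [d Hd]. exists d; split; [apply cond_pos|].
  intros s Hs. apply (Hd s Hs).
- destruct (H eps Heps) as [d [Hd Hd']]. exists (mkposreal d Hd). exact Hd'.
Qed.

Lemma path_derive_continuous (p : R -> C) (t : R) (l : C) :
  path_derive p t l -> path_continuous p t.
Proof.
intros H. apply (@ex_derive_continuous R_AbsRing C_R_NormedModule p t).
now exists l.
Qed.

Lemma C_is_RInt_plus (f g : R -> C) (a b : R) (lf lg : C) :
  C_is_RInt f a b lf -> C_is_RInt g a b lg ->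
  C_is_RInt (fun t => (f t + g t)%C) a b (lf + lg)%C.
Proof. apply (@is_RInt_plus C_R_NormedModule). Qed.

Lemma C_is_RInt_minus (f g : R -> C) (a b : R) (lf lg : C) :
  C_is_RInt f a b lf -> C_is_RInt g a b lg ->
  C_is_RInt (fun t => (f t - g t)%C) a b (lf - lg)%C.
Proof. apply (@is_RInt_minus C_R_NormedModule). Qed.

Lemma C_is_RInt_scal (c : C) (f : R -> C) (a b : R) (l : C) :
  C_is_RInt f a b l -> C_is_RInt (fun t => (c * f t)%C) a b (c * l)%C.
Proof.
intros H.
assert (H1 := is_RInt_fct_extend_fst _ _ _ _ H).
assert (H2 := is_RInt_fct_extend_snd _ _ _ _ H).
apply is_RInt_fct_extend_pair.
- apply (is_RInt_minus (V := R_NormedModule)); apply (is_RInt_scal (V := R_NormedModule)).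
  exact H1. exact H2.
- apply (is_RInt_plus (V := R_NormedModule)); apply (is_RInt_scal (V := R_NormedModule)).
  exact H2. exact H1.
Qed.

Lemma C_is_RInt_Re (f : R -> C) (a b : R) (l : C) :
  C_is_RInt f a b l -> is_RInt (fun t => Re (f t)) a b (Re l).
Proof. apply is_RInt_fct_extend_fst. Qed.

Lemma C_is_RInt_unique (f : R -> C) (a b : R) (l : C) :
  C_is_RInt f a b l -> @RInt CR f a b = l.
Proof. apply (@is_RInt_unique CR). Qed.

Lemma C_ex_RInt_continuous (f : R -> C) (a b : R) :
  a <= b -> (forall t, a <= t <= b -> path_continuous f t) ->
  exists l, C_is_RInt f a b l.
Proof.
intros Hab H. apply (@ex_RInt_continuous CR). intros t.
rewrite Rmin_left, Rmax_right; auto.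
Qed.

Lemma C_RInt_le (f : R -> C) (a b : R) (l : C) (M : R) :
  a <= b -> (forall t, a <= t <= b -> Cmod (f t) <= M) ->
  C_is_RInt f a b l -> Cmod l <= (b - a) * M.
Proof.
intros Hab HM H. rewrite Cmod_norm.
apply (@norm_RInt_le_const C_R_NormedModule f a b l M); auto.
intros t Ht. eapply Rle_trans; [|apply (HM t Ht)]. right. symmetry. apply Cmod_norm.
Qed.

Lemma path_FTC (p dp : R -> C) (a b : R) :
  a <= b -> (forall t, a <= t <= b -> path_derive p t (dp t)) ->
  (forall t, a <= t <= b -> path_continuous dp t) ->
  C_is_RInt dp a b (p b - p a)%C.
Proof.
intros Hab Hd Hc.
apply (@is_RInt_derive CR p dp a b); intros t; rewrite Rmin_left, Rmax_right; auto.
Qed.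

(** Weierstrass M-test: the tail of the series of [M] bounds the remainder of the integrand
    uniformly in [t], hence sum and integral may be exchanged. *)
Lemma C_is_series_RInt (u : nat -> R -> C) (F : R -> C) (M : nat -> R) (a b : R)
    (I : nat -> C) (J : C) :
  a <= b ->
  (forall n t, a <= t <= b -> Cmod (u n t) <= M n) -> ex_series M ->
  (forall t, a <= t <= b -> C_is_series (fun n => u n t) (F t)) ->
  (forall n, C_is_RInt (u n) a b (I n)) -> C_is_RInt F a b J ->
  C_is_series I J.
Proof.
intros Hab HuM [S HS] HuF HI HJ.
apply C_is_series_eps. intros eps Heps.
(* The [+ 1] keeps the denominator positive when [a = b]. *)
assert (He : 0 < eps / (b - a + 1)) by (apply Rdiv_lt_0_compat; lra).
destruct (HS (ball S (mkposreal _ He)) (locally_ball _ _)) as [N HN].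
exists N. intros n Hn. specialize (HN n Hn). simpl in HN.
assert (HIn : C_is_RInt (fun t => C_sum_n (fun k => u k t) n) a b (C_sum_n I n)).
{ clear -HI. induction n as [|n IH].
  - rewrite sum_O. eapply is_RInt_ext; [|apply (HI 0%nat)].
    intros t _. now rewrite sum_O.
  - rewrite sum_Sn. eapply is_RInt_ext; [|apply (C_is_RInt_plus _ _ _ _ _ _ IH (HI (S n)))].
    intros t _. now rewrite sum_Sn. }
rewrite <- Cmod_opp. replace (- (C_sum_n I n - J))%C with (J - C_sum_n I n)%C by ring.
apply Rle_lt_trans with ((b - a) * (eps / (b - a + 1))).
- apply (C_RInt_le _ _ _ _ _ Hab) with (2 := C_is_RInt_minus _ _ _ _ _ _ HJ HIn).
  intros t Ht.
  assert (H0 : forall k, 0 <= M k).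
  { intros k. eapply Rle_trans; [apply Cmod_ge_0|apply (HuM k t Ht)]. }
  eapply Rle_trans.
  + apply (C_series_tail (fun k => u k t) M (F t) S n); auto.
  + change (Rabs (sum_n M n - S) < eps / (b - a + 1)) in HN.
    apply Rabs_def2 in HN. destruct HN as [_ HN].
    change (S - sum_n M n <= eps / (b - a + 1)).
    apply Rlt_le, Ropp_lt_cancel. replace (- (S - sum_n M n)) with (sum_n M n - S) by ring. exact HN.
- apply Rmult_lt_reg_r with (b - a + 1); [lra|].
  replace ((b - a) * (eps / (b - a + 1)) * (b - a + 1)) with ((b - a) * eps) by (field; lra). nra.
Qed.

(** * Algebra of complex limits along a filter *)

Lemma C_filterlim_mult {T : Type} (F : (T -> Prop) -> Prop) {FF : Filter F}
    (f g : T -> C) (a b : C) :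
  filterlim f F (C_locally a) -> filterlim g F (C_locally b) ->
  filterlim (fun x => (f x * g x)%C) F (C_locally (a * b)%C).
Proof.
rewrite !C_filterlim_eps by auto. intros Hf Hg eps Heps.
generalize (Cmod_ge_0 a) (Cmod_ge_0 b); intros Ha Hb.
set (e := Rmin 1 (eps / (Cmod a + Cmod b + 2))).
assert (He : 0 < e) by (unfold e; apply Rmin_glb_lt; [lra|]; apply Rdiv_lt_0_compat; lra).
generalize (filter_and _ _ (Hf e He) (Hg e He)). apply filter_imp.
intros x [H1 H2].
replace (f x * g x - a * b)%C
  with ((f x - a) * (g x - b) + (a * (g x - b) + b * (f x - a)))%C by ring.
eapply Rle_lt_trans; [apply Cmod_triangle|].
eapply Rle_lt_trans; [apply Rplus_le_compat_l, Cmod_triangle|]. rewrite !Cmod_mult.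
generalize (Cmod_ge_0 (f x - a)) (Cmod_ge_0 (g x - b)); intros H3 H4.
assert (He1 : e <= 1) by apply Rmin_l.
assert (He2 : (Cmod a + Cmod b + 2) * e <= eps).
{ apply Rle_trans with ((Cmod a + Cmod b + 2) * (eps / (Cmod a + Cmod b + 2))).
  apply Rmult_le_compat_l; [lra|apply Rmin_r]. right; field; lra. }
nra.
Qed.

Lemma C_filterlim_plus {T : Type} (F : (T -> Prop) -> Prop) {FF : Filter F}
    (f g : T -> C) (a b : C) :
  filterlim f F (C_locally a) -> filterlim g F (C_locally b) ->
  filterlim (fun x => (f x + g x)%C) F (C_locally (a + b)%C).
Proof.
rewrite !C_filterlim_eps by auto. intros Hf Hg eps Heps.
assert (He : 0 < eps / 2) by (apply Rdiv_lt_0_compat; lra).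
generalize (filter_and _ _ (Hf _ He) (Hg _ He)).
apply filter_imp. intros x [H1 H2].
replace (f x + g x - (a + b))%C with ((f x - a) + (g x - b))%C by ring.
eapply Rle_lt_trans; [apply Cmod_triangle|]. lra.
Qed.

Lemma C_filterlim_opp {T : Type} (F : (T -> Prop) -> Prop) {FF : Filter F}
    (f : T -> C) (a : C) :
  filterlim f F (C_locally a) -> filterlim (fun x => (- f x)%C) F (C_locally (- a)%C).
Proof.
rewrite !C_filterlim_eps by auto. intros Hf eps Heps.
generalize (Hf eps Heps). apply filter_imp. intros x H.
replace (- f x - - a)%C with (- (f x - a))%C by ring. now rewrite Cmod_opp.
Qed.

Lemma C_filterlim_inv {T : Type} (F : (T -> Prop) -> Prop) {FF : Filter F}
    (f : T -> C) (a : C) :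
  a <> 0%C -> filterlim f F (C_locally a) ->
  filterlim (fun x => (/ f x)%C) F (C_locally (/ a)%C).
Proof.
intros Ha. rewrite !C_filterlim_eps by auto. intros Hf eps Heps.
apply Cmod_gt_0 in Ha as Ha'.
set (e := Rmin (Cmod a / 2) (eps * Cmod a * Cmod a / 2)).
assert (Haa : 0 < Cmod a * Cmod a) by nra.
assert (He : 0 < e) by (unfold e; apply Rmin_glb_lt; [lra|]; nra).
generalize (Hf e He). apply filter_imp. intros x H.
assert (He1 : e <= Cmod a / 2) by apply Rmin_l.
assert (He2 : e <= eps * Cmod a * Cmod a / 2) by apply Rmin_r.
assert (Hfa : Cmod a / 2 < Cmod (f x)).
{ assert (Cmod a <= Cmod (f x) + Cmod (f x - a)); [|lra].
  replace a with (f x + - (f x - a))%C at 1 by ring.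
  rewrite <- (Cmod_opp (f x - a)). apply Cmod_triangle. }
assert (Hfx : f x <> 0%C) by (apply Cmod_gt_0; lra).
replace (/ f x - / a)%C with (- (f x - a) / (f x * a))%C by (field; auto).
rewrite Cmod_div, Cmod_opp, Cmod_mult by (apply Cmult_neq_0; auto).
apply Rmult_lt_reg_r with (Cmod (f x) * Cmod a); [nra|].
unfold Rdiv. rewrite Rmult_assoc, Rinv_l, Rmult_1_r by nra.
nra.
Qed.

(** * Cauchy's integral formula *)

Definition circle (r t : R) : C := (r * cos t, r * sin t).

Lemma Cmod_circle (r t : R) : 0 <= r -> Cmod (circle r t) = r.
Proof.
intros Hr. unfold Cmod, circle; simpl.
replace (r * cos t * (r * cos t * 1) + r * sin t * (r * sin t * 1)) with (r * r).
- now apply sqrt_square.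
- generalize (sin2_cos2 t). unfold Rsqr. intros H.
  replace (r * r) with (r * r * (sin t * sin t + cos t * cos t)) by (rewrite H; ring). ring.
Qed.

Lemma circle_neq_0 (r t : R) : 0 < r -> circle r t <> 0%C.
Proof. intros Hr. apply Cmod_gt_0. rewrite Cmod_circle; lra. Qed.

Lemma path_derive_circle (r t : R) : path_derive (circle r) t (Ci * circle r t)%C.
Proof.
replace (Ci * circle r t)%C with (r * - sin t, r * cos t) by
  (unfold Ci, circle, Cmult; simpl; f_equal; ring).
apply path_derive_pair; auto_derive; auto; ring.
Qed.

Lemma path_derive_inv_circle (r t : R) : 0 < r ->
  path_derive (fun s => / circle r s)%C t (- (Ci * / circle r t))%C.
Proof.
intros Hr.
assert (E : forall s, (/ circle r s)%C = (/ r * cos s, - (/ r * sin s))).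
{ intros s. generalize (sin2_cos2 s). unfold Rsqr. intros H.
  replace (/ r * cos s, - (/ r * sin s)) with
    (/ circle r s * (circle r s * (/ r * cos s, - (/ r * sin s))%R))%C.
  - replace (circle r s * (/ r * cos s, - (/ r * sin s))%R)%C with (RtoC 1); [ring|].
    unfold circle, Cmult, RtoC; simpl. f_equal.
    + rewrite <- H. field. lra.
    + field. lra.
  - rewrite Cmult_assoc, Cinv_l by now apply circle_neq_0. ring. }
apply (is_derive_ext (fun s => (/ r * cos s, - (/ r * sin s)))).
{ intros s. now rewrite E. }
replace (- (Ci * / circle r t))%C with (/ r * - sin t, - (/ r * cos t)).
- apply path_derive_pair; auto_derive; auto; ring.
- rewrite E. unfold Ci, Cmult, Copp; simpl; f_equal; ring.
Qed.

Lemma circle_2PI (r : R) : circle r (2 * PI) = circle r 0.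
Proof. unfold circle. now rewrite cos_2PI, sin_2PI, cos_0, sin_0. Qed.

(** For [n > 0] the integrand has the primitive [(i / n) (/ circle r t)^n], which is periodic of
    period [2 PI]. *)
Lemma RInt_inv_circle_pow (r : R) (n : nat) : 0 < r -> (0 < n)%nat ->
  C_is_RInt (fun t => (/ circle r t) ^ n)%C 0 (2 * PI) (RtoC 0).
Proof.
intros Hr Hn.
assert (Hn0 : RtoC (INR n) <> 0%C).
{ intros H. apply RtoC_inj in H. revert H. apply not_0_INR. lia. }
assert (Hd : forall t, path_derive (fun s => Ci / INR n * (/ circle r s) ^ n)%C t
   ((/ circle r t) ^ n)%C).
{ intros t.
  replace ((/ circle r t) ^ n)%C with
    ((Ci / INR n * (INR n * (/ circle r t) ^ pred n)) * (- (Ci * / circle r t)))%C.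
  - apply (path_derive_comp (fun w => Ci / INR n * w ^ n)%C (fun s => / circle r s)%C).
    + apply C_is_derive_scal, C_is_derive_pow.
    + now apply path_derive_inv_circle.
  - destruct n as [|n]; [lia|]. simpl pred. rewrite Cpow_S.
    transitivity (- (Ci * Ci) * (/ circle r t * (/ circle r t) ^ n))%C.
    + field. split; auto. now apply circle_neq_0.
    + replace (Ci * Ci)%C with (- (1))%C; [ring|].
      unfold Ci, Cmult, Copp, RtoC; simpl; f_equal; ring. }
replace (RtoC 0) with (Ci / INR n * (/ circle r (2 * PI)) ^ n
    - Ci / INR n * (/ circle r 0) ^ n)%C.
- apply (path_FTC (fun s => Ci / INR n * (/ circle r s) ^ n)%C).
  + generalize PI_RGT_0; lra.
  + intros t _. apply Hd.
  + intros t _. apply path_derive_continuous with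
     ((INR n * (/ circle r t) ^ pred n) * (- (Ci * / circle r t)))%C.
    apply (path_derive_comp (fun w => w ^ n)%C (fun s => / circle r s)%C).
    * apply C_is_derive_pow.
    * now apply path_derive_inv_circle.
- rewrite circle_2PI. ring.
Qed.

Lemma C_is_RInt_const (c : C) (a b : R) : C_is_RInt (fun _ => c) a b ((b - a)%R * c)%C.
Proof.
replace ((b - a)%R * c)%C with (scal (b - a) c : C_R_NormedModule).
- apply (@is_RInt_const C_R_NormedModule).
- change (((b - a) * fst c, (b - a) * snd c) = ((b - a)%R * c)%C).
  unfold Cmult, RtoC; simpl. f_equal; ring.
Qed.

Lemma C_is_series_geom (q : C) : Cmod q < 1 -> C_is_series (fun n => q ^ n)%C (/ (1 - q))%C.
Proof.
intros Hq.
assert (Hex : exists l : C, C_is_series (fun n => q ^ n)%C l).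
{ apply (C_ex_series_le (fun n => q ^ n)%C (fun n => Cmod q ^ n)).
- intros n. rewrite Cmod_pow. apply Rle_refl.
- apply ex_series_geom. rewrite Rabs_pos_eq; auto. apply Cmod_ge_0. }
destruct Hex as [l Hl].
- assert (H0 : (1 - q)%C <> 0%C).
  { intros H. assert (Cmod q = 1); [|lra]. replace q with (1 - (1 - q))%C by ring.
    rewrite H. replace (1 - 0)%C with (RtoC 1) by ring. apply Cmod_1. }
  assert (H1 : C_is_series (fun n => q ^ n)%C (1 + q * l)%C).
  { apply (@is_series_decr_1 C_AbsRing C_NormedModule).
    match goal with |- is_series _ ?x => replace x with (q * l)%C end.
    - apply C_is_series_ext with (2 := C_is_series_scal q _ _ Hl). reflexivity.
    - change (q * l = 1 + q * l + - q ^ 0)%C. simpl. ring. }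
  assert (E : l = (1 + q * l)%C) by exact (C_is_series_unique _ _ _ Hl H1).
  replace (/ (1 - q))%C with l; auto.
  assert (E2 : (l * (1 - q) = 1)%C) by
    (replace (l * (1 - q))%C with (l - q * l)%C by ring;
     rewrite E at 1; change (1 + q * l - q * l = 1)%C; ring).
  replace l with (l * (1 - q) * / (1 - q))%C by (field; auto). rewrite E2. ring.
Qed.

Lemma path_derive_line (w c : C) (t : R) : path_derive (fun s => w + s * c)%C t c.
Proof.
apply path_derive_eps. intros eps Heps. exists 1. split; [lra|]. intros s _.
replace (w + s * c - (w + t * c) - (s - t)%R * c)%C with (RtoC 0)
  by (rewrite RtoC_minus; ring).
rewrite Cmod_0. apply Rmult_le_pos; [lra|apply Rabs_pos].
Qed.

Lemma path_continuous_RtoC (t : R) : path_continuous RtoC t.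
Proof.
apply path_continuous_eps. intros eps Heps. exists eps; split; auto.
intros s Hs. now rewrite <- RtoC_minus, Cmod_R.
Qed.

Lemma C_filterlim_Re {T : Type} (F : (T -> Prop) -> Prop) {FF : Filter F}
    (f : T -> C) (a : C) :
  filterlim f F (C_locally a) -> filterlim (fun x => Re (f x)) F (locally (Re a)).
Proof.
intros H. rewrite (C_filterlim_eps F) in H. intros P [d Hd]. unfold filtermap.
generalize (H d (cond_pos d)). apply filter_imp. intros x Hx. apply Hd.
change (Rabs (Re (f x) - Re a) < d).
eapply Rle_lt_trans; [|exact Hx]. eapply Rle_trans; [|apply re_le_Cmod].
right. apply f_equal. unfold Re, Cminus, Cplus, Copp; simpl. ring.
Qed.

Lemma path_continuous_circle (r t : R) : path_continuous (circle r) t.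
Proof. eapply path_derive_continuous, path_derive_circle. Qed.

Lemma circle_minus_neq_0 (r t : R) (w : C) : Cmod w < r -> (circle r t - w)%C <> 0%C.
Proof.
intros Hw H. assert (circle r t = w) as E.
{ replace (circle r t) with (circle r t - w + w)%C by ring. rewrite H; ring. }
assert (Hr : 0 < r) by (generalize (Cmod_ge_0 w); lra).
rewrite <- E, Cmod_circle in Hw; lra.
Qed.

Lemma path_continuous_kernel (r t : R) (w : C) : Cmod w < r ->
  path_continuous (fun s => circle r s / (circle r s - w))%C t.
Proof.
intros Hw.
apply C_filterlim_mult; [apply locally_filter|apply path_continuous_circle|].
apply C_filterlim_inv; [apply locally_filter|now apply circle_minus_neq_0|].
apply C_filterlim_plus; [apply locally_filter|apply path_continuous_circle|].
apply filterlim_const.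
Qed.

(** Both sides are values, at [s = 1] and [s = 0], of the integral of [f] against the Cauchy kernel
    over the circle contracted towards [w] by the factor [s]. Its derivative in [s] is the integral
    of [f'(G s t) circle(t)], where the denominator of the kernel has cancelled; up to a constant
    factor this integrand is the derivative in [t] of the periodic function [f(G s t)], so the
    integral vanishes. Real parts are taken because differentiation under the integral sign is
    applied to real integrands. *)
Lemma cauchy_radial_homotopy (f f' : C -> C) (rho r : R) (w : C) :
  0 < r < rho -> Cmod w < r ->
  (forall z, Cmod z < rho -> C_is_derive f z (f' z)) ->
  (forall z, Cmod z < rho -> C_continuous f' z) ->
  RInt (fun t => Re (f (circle r t) * (circle r t / (circle r t - w)))%C) 0 (2 * PI) =
  RInt (fun t => Re (f w * (circle r t / (circle r t - w)))%C) 0 (2 * PI).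
Proof.
intros Hr Hw Hf Hf'.
set (k := fun t => (circle r t / (circle r t - w))%C).
set (G := fun (s t : R) => (w + s * (circle r t - w))%C).
set (F := fun (s t : R) => Re (f (G s t) * k t)%C).
set (F' := fun (s t : R) => Re (f' (G s t) * circle r t)%C).
(* For [-d < s < 1 + d] the modulus of [G s t] is at most [(1 + 2d) r = (r + rho) / 2 < rho]. The
   margin around [[0, 1]] yields continuity at the endpoints from differentiability. *)
set (d := (rho - r) / (4 * r)).
assert (Hd : 0 < d) by (unfold d; apply Rdiv_lt_0_compat; lra).
assert (Hdr : (1 + 2 * d) * r < rho) by (unfold d; field_simplify; lra).
generalize (Cmod_ge_0 w); intros Hw0.
assert (Hcw := fun t => circle_minus_neq_0 r t w Hw).
assert (HG : forall s t, - d < s < 1 + d -> Cmod (G s t) < rho).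
{ intros s t Hs. unfold G.
  replace (w + s * (circle r t - w))%C with ((1 - s)%R * w + s * circle r t)%C
    by (rewrite RtoC_minus; ring).
  eapply Rle_lt_trans; [apply Cmod_triangle|].
  rewrite !Cmod_mult, !Cmod_R, Cmod_circle by lra.
  apply Rle_lt_trans with (Rabs (1 - s) * r + Rabs s * r).
  - apply Rplus_le_compat_r, Rmult_le_compat_l; [apply Rabs_pos|lra].
  - assert (Rabs (1 - s) + Rabs s <= 1 + 2 * d).
    { unfold Rabs; destruct (Rcase_abs (1 - s)), (Rcase_abs s); lra. }
    nra. }
assert (HdF : forall s t, - d < s < 1 + d -> is_derive (fun u => F u t) s (F' s t)).
{ intros s t Hs. unfold F, F'. apply Re_path_derive.
  replace (f' (G s t) * circle r t)%C with
    ((k t * f' (G s t)) * (circle r t - w))%C by (unfold k; field; apply Hcw).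
  apply (is_derive_ext (fun u => k t * f (G u t))%C). { intros u. apply Cmult_comm. }
  apply (path_derive_comp (fun z => k t * f z)%C (fun u => G u t)).
  - apply C_is_derive_scal, Hf, HG, Hs.
  - apply path_derive_line. }
assert (Hcirc := path_continuous_circle r).
assert (HcF' : forall s t, - d < s < 1 + d ->
   filterlim (fun p : R * R => (f' (G (fst p) (snd p)) * circle r (snd p))%C)
     (locally (s, t)) (C_locally (f' (G s t) * circle r t)%C)).
{ intros s t Hs.
  assert (Hsnd : filterlim (fun p : R * R => circle r (snd p)) (locally (s, t))
                   (C_locally (circle r t))).
  { eapply filterlim_comp; [|apply Hcirc]. apply (continuous_snd s t). }
  assert (Hfst : filterlim (fun p : R * R => RtoC (fst p)) (locally (s, t)) (C_locally (RtoC s))).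
  { eapply filterlim_comp; [|apply path_continuous_RtoC]. apply (continuous_fst s t). }
  apply C_filterlim_mult; auto; [apply locally_filter|].
  eapply filterlim_comp; [|apply (Hf' (G s t)), HG, Hs].
  unfold G. apply C_filterlim_plus; [apply locally_filter|apply filterlim_const|].
  apply C_filterlim_mult; auto; [apply locally_filter|].
  apply C_filterlim_plus; auto; [apply locally_filter|apply filterlim_const]. }
assert (Hck := fun t => path_continuous_kernel r t w Hw).
assert (HcG : forall s t, path_continuous (G s) t).
{ intros s t. apply C_filterlim_plus; [apply locally_filter|apply filterlim_const|].
  apply C_filterlim_mult; [apply locally_filter|apply filterlim_const|].
  apply C_filterlim_plus; [apply locally_filter|apply Hcirc|apply filterlim_const]. }
assert (Hex : forall s, - d < s < 1 + d -> ex_RInt (F s) 0 (2 * PI)).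
{ intros s Hs. apply (ex_RInt_continuous (V := R_CompleteNormedModule)). intros t _.
  apply C_filterlim_Re; [apply locally_filter|].
  apply C_filterlim_mult; [apply locally_filter| |apply Hck].
  eapply filterlim_comp; [apply HcG|].
  eapply C_is_derive_continuous, Hf, HG, Hs. }
assert (Hloc : forall s, - d < s < 1 + d -> locally s (fun u => - d < u < 1 + d)).
{ intros s Hs. apply (open_and (fun u => - d < u) (fun u => u < 1 + d)); auto.
  apply open_gt. apply open_lt. }
assert (HD : forall s, - d < s < 1 + d ->
   is_derive (fun s => RInt (F s) 0 (2 * PI)) s (RInt (F' s) 0 (2 * PI))).
{ intros s Hs.
  replace (RInt (F' s) 0 (2 * PI)) with
    (RInt (fun t => Derive (fun u => F u t) s) 0 (2 * PI)).
  2: { apply RInt_ext. intros t _. apply is_derive_unique, HdF, Hs. }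
  apply is_derive_RInt_param.
  - generalize (Hloc s Hs). apply filter_imp. intros u Hu t _. eexists. apply HdF, Hu.
  - intros t _. apply (continuity_2d_pt_ext_loc F').
    + destruct (Hloc s Hs) as [e He]. exists e. intros u v Hu _.
      symmetry. apply is_derive_unique, HdF. apply He. exact Hu.
    + apply continuity_2d_pt_filterlim.
      apply (C_filterlim_Re (locally (s, t))). apply HcF', Hs.
  - generalize (Hloc s Hs). apply filter_imp. exact Hex. }
(* The primitive in [t] is [(- i / s) f(G s t)], hence the exclusion of [s = 0]; the mean value
   theorem asks for the derivative only on the open interval. *)
assert (H0 : forall s, - d < s < 1 + d -> s <> 0 -> RInt (F' s) 0 (2 * PI) = 0).
{ intros s Hs Hs0. apply is_RInt_unique.
  assert (Hs0' : RtoC s <> 0%C) by (intros H; apply Hs0, RtoC_inj, H).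
  assert (E : RtoC 0 = (- Ci / s * f (G s (2 * PI)%R) - - Ci / s * f (G s 0))%C).
  { unfold G. rewrite circle_2PI. ring. }
  change (is_RInt (F' s) 0 (2 * PI) (Re (RtoC 0))). rewrite E.
  apply C_is_RInt_Re.
  apply (path_FTC (fun t => - Ci / s * f (G s t))%C).
  - generalize PI_RGT_0; lra.
  - intros t _.
    replace (f' (G s t) * circle r t)%C with
      ((- Ci / s * f' (G s t)) * (s * (Ci * circle r t)))%C.
    + apply (path_derive_comp (fun z => - Ci / s * f z)%C (fun t => G s t)).
      * apply C_is_derive_scal, Hf, HG, Hs.
      * replace (s * (Ci * circle r t))%C with ((0 + s * (1 - 0)) * (Ci * circle r t))%C by ring.
        apply (path_derive_comp (fun z => w + s * (z - w))%C (circle r)).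
        -- apply C_is_derive_plus; [apply C_is_derive_const|].
           apply C_is_derive_scal. apply C_is_derive_minus; [apply C_is_derive_id|].
           apply C_is_derive_const.
        -- apply path_derive_circle.
    + transitivity (- (Ci * Ci) * (f' (G s t) * circle r t))%C; [field; auto|].
      replace (Ci * Ci)%C with (- (1))%C; [ring|].
      unfold Ci, Cmult, Copp, RtoC; simpl; f_equal; ring.
  - intros t _. apply C_filterlim_mult; [apply locally_filter| |apply Hcirc].
    eapply filterlim_comp; [apply HcG|]. apply Hf', HG, Hs. }
assert (E : RInt (F 1) 0 (2 * PI) - RInt (F 0) 0 (2 * PI) = 0 * (1 - 0)).
{ destruct (MVT_gen (fun s => RInt (F s) 0 (2 * PI)) 0 1 (fun _ => 0)) as [c [_ Hc]].
  - intros s. rewrite Rmin_left, Rmax_right by lra. intros Hs.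
    assert (Hs1 := HD s ltac:(lra)). rewrite (H0 s) in Hs1 by lra. exact Hs1.
  - intros s. rewrite Rmin_left, Rmax_right by lra. intros Hs.
    apply continuity_pt_filterlim. apply (ex_derive_continuous (V := R_NormedModule) (fun s => RInt (F s) 0 (2 * PI)) s).
    eexists. apply HD. lra.
  - exact Hc. }
transitivity (RInt (F 1) 0 (2 * PI)); [|transitivity (RInt (F 0) 0 (2 * PI))].
- apply RInt_ext. intros t _. unfold F, G. do 3 f_equal. ring.
- lra.
- apply RInt_ext. intros t _. unfold F, G. do 3 f_equal. ring.
Qed.

Lemma path_bounded (p : R -> C) (a b : R) :
  (forall t, a <= t <= b -> path_continuous p t) ->
  exists B, 0 <= B /\ forall t, a <= t <= b -> Cmod (p t) <= B.
Proof.
intros H.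
destruct (@bounded_continuity R_AbsRing C_R_NormedModule p a b H) as [B HB].
exists (Rmax B 0). split; [apply Rmax_r|]. intros t Ht.
eapply Rle_trans; [|apply Rmax_l]. apply Rlt_le.
eapply Rle_lt_trans; [|apply (HB t Ht)]. right. apply Cmod_norm.
Qed.

Lemma path_continuous_inv_circle_pow (r t : R) (n : nat) : 0 < r ->
  path_continuous (fun s => (/ circle r s) ^ n)%C t.
Proof.
intros Hr. eapply path_derive_continuous.
apply (path_derive_comp (fun w => w ^ n)%C (fun s => / circle r s)%C).
apply C_is_derive_pow. now apply path_derive_inv_circle.
Qed.

(** The kernel [circle / (circle - w)] is a geometric series in [w / circle], of constant ratio
    modulus [|w| / r < 1], and [h] is bounded on the period; the series can be integrated term by
    term. *)
Lemma cauchy_kernel_series (h : R -> C) (r : R) (w : C) (I : nat -> C) (J : C) :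
  Cmod w < r ->
  (forall t, path_continuous h t) ->
  (forall n, C_is_RInt (fun t => h t * (/ circle r t) ^ n)%C 0 (2 * PI) (I n)) ->
  C_is_RInt (fun t => h t * (circle r t / (circle r t - w)))%C 0 (2 * PI) J ->
  C_is_series (fun n => (I n * w ^ n)%C) J.
Proof.
intros Hw Hh HI HJ. generalize (Cmod_ge_0 w); intros Hw0.
destruct (path_bounded h 0 (2 * PI)) as [B [HB HhB]]; [intros; apply Hh|].
assert (Hq : 0 <= Cmod w / r < 1) by (apply ratio_lt_1; lra).
assert (Hqm : forall t, Cmod (w * / circle r t) = Cmod w / r).
{ intros t. rewrite Cmod_mult, Cmod_inv, Cmod_circle; auto; try lra.
  apply circle_neq_0; lra. }
apply (C_is_series_RInt (fun n t => h t * (w * / circle r t) ^ n)%C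
  (fun t => h t * (circle r t / (circle r t - w)))%C
  (fun n => B * (Cmod w / r) ^ n) 0 (2 * PI)).
- generalize PI_RGT_0; lra.
- intros n t Ht. rewrite Cmod_mult, Cmod_pow, Hqm.
  apply Rmult_le_compat_r; auto. apply pow_le, Hq.
- now apply ex_series_geom_bound.
- intros t Ht. apply C_is_series_scal.
  replace (circle r t / (circle r t - w))%C with (/ (1 - w * / circle r t))%C.
  + apply C_is_series_geom. rewrite Hqm. apply Hq.
  + assert (circle r t <> 0%C) by (apply circle_neq_0; lra).
    assert ((circle r t - w)%C <> 0%C) by now apply circle_minus_neq_0.
    replace (1 - w * / circle r t)%C with ((circle r t - w) * / circle r t)%C by (field; auto).
    field. auto.
- intros n. rewrite Cmult_comm.
  eapply is_RInt_ext; [|apply (C_is_RInt_scal (w ^ n)%C _ _ _ _ (HI n))].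
  intros t _. simpl. rewrite Cpow_mult_l. ring.
- exact HJ.
Qed.

(** The coefficients are the Cauchy integrals divided by [2 PI]. The homotopy replaces
    [f(circle r t)] by [f w], and the remaining integral of the kernel is [2 PI]: it is the case
    [h = 1] of the kernel series, where only the term [n = 0] survives. *)
Lemma cauchy_series (f f' : C -> C) (rho r : R) :
  0 < r < rho ->
  (forall z, Cmod z < rho -> C_is_derive f z (f' z)) ->
  (forall z, Cmod z < rho -> C_continuous f' z) ->
  exists a, forall w, Cmod w < r -> C_is_series (fun n => (a n * w ^ n)%C) (f w).
Proof.
intros Hr Hf Hf'.
assert (HPI : 0 < 2 * PI) by (generalize PI_RGT_0; lra).
assert (Hfc : forall t, path_continuous (fun t => f (circle r t)) t).
{ intros t. eapply filterlim_comp; [apply path_continuous_circle|].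
  eapply C_is_derive_continuous, Hf. rewrite Cmod_circle; lra. }
assert (HI : forall n, exists l,
   C_is_RInt (fun t => f (circle r t) * (/ circle r t) ^ n)%C 0 (2 * PI) l).
{ intros n. apply C_ex_RInt_continuous; [lra|]. intros t _.
  apply C_filterlim_mult; [apply locally_filter|apply Hfc|].
  apply path_continuous_inv_circle_pow; lra. }
destruct (ClassicalEpsilon.constructive_indefinite_description
  (fun I : nat -> C => forall n,
     C_is_RInt (fun t => f (circle r t) * (/ circle r t) ^ n)%C 0 (2 * PI) (I n))) as [I HII].
{ exists (fun n => @RInt CR (fun t => f (circle r t) * (/ circle r t) ^ n)%C 0 (2 * PI)).
  intros n. apply (@RInt_correct CR), (HI n). }
exists (fun n => / (2 * PI)%R * I n)%C. intros w Hw.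
destruct (C_ex_RInt_continuous
  (fun t => f (circle r t) * (circle r t / (circle r t - w)))%C 0 (2 * PI)) as [J HJ].
{ lra. }
{ intros t _. apply C_filterlim_mult; [apply locally_filter|apply Hfc|].
  now apply path_continuous_kernel. }
assert (HJ1 : C_is_RInt (fun t => circle r t / (circle r t - w))%C 0 (2 * PI) (RtoC (2 * PI))).
{ destruct (C_ex_RInt_continuous
    (fun t => (circle r t / (circle r t - w)))%C 0 (2 * PI)) as [J1 HJ1].
  { lra. }
  { intros t _. now apply path_continuous_kernel. }
  assert (H0 : C_is_series (fun n => (match n with O => RtoC (2 * PI) | _ => 0%C end * w ^ n)%C) J1).
  { apply (cauchy_kernel_series (fun _ => 1%C) r); auto.
    - intros t; apply filterlim_const.
    - intros [|n].
      + replace (RtoC (2 * PI)) with ((2 * PI - 0)%R * 1)%C by (rewrite Rminus_0_r; ring).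
        eapply is_RInt_ext; [|apply C_is_RInt_const].
        intros t _. simpl. ring.
      + eapply is_RInt_ext; [|apply (RInt_inv_circle_pow r (S n)); [lra|lia]].
        intros t _. simpl. ring.
    - eapply is_RInt_ext; [|apply HJ1]. intros t _. simpl. ring. }
  replace (RtoC (2 * PI)) with J1; auto.
  eapply C_is_series_unique; [apply H0|].
  apply C_is_series_ext with
    (fun n => (match n with O => RtoC (2 * PI) | _ => 0%C end * 0 ^ n)%C).
  - intros [|n]; simpl; ring.
  - apply (C_is_series_at_0 (fun n => match n with O => RtoC (2 * PI) | _ => 0%C end)). }
assert (HfJ : J = (f w * RtoC (2 * PI))%C).
(* The homotopy compares real parts only; the multipliers [c = 1] and [c = Ci] recover both parts of
   [J]. *)
{ assert (Hre : forall c : C, Re (c * J)%C = Re (c * (f w * RtoC (2 * PI)))%C).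
  { intros c.
    assert (E := cauchy_radial_homotopy (fun z => c * f z)%C (fun z => c * f' z)%C rho r w Hr Hw).
    assert (E1 := C_is_RInt_Re _ _ _ _ (C_is_RInt_scal c _ _ _ _ HJ)).
    assert (E2 := C_is_RInt_Re _ _ _ _ (C_is_RInt_scal (c * f w)%C _ _ _ _ HJ1)).
    apply (is_RInt_unique (V := R_CompleteNormedModule)) in E1.
    apply (is_RInt_unique (V := R_CompleteNormedModule)) in E2.
    rewrite <- E1, Cmult_assoc, <- E2.
    etransitivity; [|etransitivity]; [|apply E|].
    - apply RInt_ext; intros t _. f_equal. ring.
    - intros z Hz. apply C_is_derive_scal, Hf, Hz.
    - intros z Hz. apply C_filterlim_mult; [apply locally_filter|apply filterlim_const|].
      apply Hf', Hz.
    - apply RInt_ext; intros t _. f_equal. }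
  generalize (Hre 1%C) (Hre Ci). rewrite !Cmult_1_l. intros H1 H2.
  apply injective_projections; [exact H1|].
  revert H2. generalize (f w * RtoC (2 * PI))%C. intros v.
  unfold Re, Ci, Cmult; simpl. lra. }
assert (HPI0 : RtoC (2 * PI) <> 0%C) by (intros H; apply RtoC_inj in H; lra).
replace (f w) with (/ (2 * PI)%R * J)%C by (rewrite HfJ; field; auto).
eapply C_is_series_ext; [|apply C_is_series_scal].
2: apply (cauchy_kernel_series (fun t => f (circle r t)) r w I J Hw Hfc HII HJ).
intros n; simpl. ring.
Qed.

(** Every smaller radius comes with its own coefficients. By uniqueness on the disc of radius
    [rho / 2] they all coincide, so one sequence serves the whole open disc. *)
Lemma cauchy_taylor (f f' : C -> C) (c : C) (rho : R) :
  0 < rho ->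
  (forall z, Cmod (z - c) < rho -> C_is_derive f z (f' z)) ->
  (forall z, Cmod (z - c) < rho -> C_continuous f' z) ->
  exists a, forall z, Cmod (z - c) < rho ->
    @is_pseries C_AbsRing C_NormedModule a (z - c)%C (f z).
Proof.
intros Hrho Hf Hf'.
assert (H : forall r, 0 < r < rho -> exists a, forall w, Cmod w < r ->
   C_is_series (fun n => (a n * w ^ n)%C) (f (w + c)%C)).
{ intros r Hr. apply (cauchy_series (fun w => f (w + c)%C) (fun w => f' (w + c)%C) rho); auto.
  - intros z Hz. replace (f' (z + c)%C) with ((1 + 0) * f' (z + c))%C by ring.
    apply (C_is_derive_comp f (fun w => w + c)%C).
    + apply Hf. now replace (z + c - c)%C with z by ring.
    + apply C_is_derive_plus; [apply C_is_derive_id|apply C_is_derive_const].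
  - intros z Hz. eapply filterlim_comp.
    + apply C_filterlim_plus; [apply locally_filter|apply filterlim_id|apply filterlim_const].
    + apply Hf'. now replace (z + c - c)%C with z by ring. }
destruct (H (rho / 2) ltac:(lra)) as [a Ha]. exists a. intros z Hz.
generalize (Cmod_ge_0 (z - c)); intros Hz0.
assert (Hr : exists r, 0 < r < rho /\ Cmod (z - c) < r /\ rho / 2 <= r).
{ exists (Rmax (rho / 2) ((Cmod (z - c) + rho) / 2)).
  unfold Rmax; destruct (Rle_dec (rho / 2) ((Cmod (z - c) + rho) / 2)); lra. }
destruct Hr as [r [Hr [Hzr Hrr]]].
destruct (H r Hr) as [b Hb].
apply (proj2 (C_is_pseries _ _ _)). apply C_is_series_ext with (fun n => (b n * (z - c) ^ n)%C).
- intros n. f_equal. symmetry. revert n.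
  apply (pseries_unique a b (fun w => f (w + c)%C) (rho / 2)); auto; [lra|].
  intros w Hw. apply Hb. lra.
- replace (f z) with (f (z - c + c)%C) by (f_equal; ring). now apply Hb.
Qed.

(** * Analytic functions on the unit disc *)

Lemma C_is_derive_ext_loc (f h : C -> C) (z l : C) (d : R) :
  0 < d -> (forall w, Cmod (w - z) < d -> f w = h w) ->
  C_is_derive f z l -> C_is_derive h z l.
Proof.
intros Hd H. apply (@is_derive_ext_loc C_AbsRing C_NormedModule).
apply locally_C, C_locally_eps. exists d; auto.
Qed.

Lemma disc_nbhd (z w : C) : unit_disc z -> Cmod (w - z) < 1 - Cmod z -> unit_disc w.
Proof.
unfold unit_disc. intros Hz Hw. replace w with ((w - z) + z)%C by ring.
eapply Rle_lt_trans; [apply Cmod_triangle|]. lra.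
Qed.

Lemma disc_0 : unit_disc 0%C.
Proof. unfold unit_disc. rewrite Cmod_0. lra. Qed.

Lemma disc_segment (z : C) (t : R) : unit_disc z -> 0 <= t <= 1 -> unit_disc (t * z)%C.
Proof.
unfold unit_disc. intros Hz Ht. rewrite Cmod_mult, Cmod_R, Rabs_pos_eq by lra.
generalize (Cmod_ge_0 z). nra.
Qed.

Lemma pseries_shift_derive (f : C -> C) (a : nat -> C) (z0 : C) (rho : R) :
  (forall z, Cmod (z - z0) < rho -> @is_pseries C_AbsRing C_NormedModule a (z - z0)%C (f z)) ->
  forall z, Cmod (z - z0) < rho ->
    C_is_derive f z (C_derive f z) /\
    @is_pseries C_AbsRing C_NormedModule (fun n => INR (S n) * a (S n))%C (z - z0)%C (C_derive f z).
Proof.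
intros H z Hz.
destruct (is_derive_pseries a (fun w => f (w + z0)%C) rho (z - z0)%C) as [l [Hl Hd]]; auto.
{ intros w Hw. apply (proj1 (C_is_pseries _ _ _)). specialize (H (w + z0)%C).
  replace (w + z0 - z0)%C with w in H by ring. auto. }
assert (Hd' : C_is_derive f z l).
{ replace f with (fun w => f (w - z0 + z0)%C).
  2: { apply functional_extensionality. intros w. f_equal. ring. }
  replace l with ((1 - 0) * l)%C by ring.
  apply (C_is_derive_comp (fun w => f (w + z0)%C) (fun w => w - z0)%C); auto.
  apply C_is_derive_minus; [apply C_is_derive_id|apply C_is_derive_const]. }
rewrite (is_C_derive_unique _ _ _ Hd'). split; auto.
now apply (proj2 (C_is_pseries _ _ _)).
Qed.

Lemma analytic_is_derive (f : C -> C) (z : C) :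
  analytic f -> unit_disc z -> C_is_derive f z (C_derive f z).
Proof.
intros Hf Hz. destruct (Hf z Hz) as [rho [a [Hrho Ha]]].
apply (pseries_shift_derive f a z rho Ha).
replace (z - z)%C with (RtoC 0) by ring. now rewrite Cmod_0.
Qed.

Lemma analytic_derive (f : C -> C) : analytic f -> analytic (C_derive f).
Proof.
intros Hf z Hz. destruct (Hf z Hz) as [rho [a [Hrho Ha]]].
exists rho, (fun n => INR (S n) * a (S n))%C. split; auto.
intros w Hw. now apply (pseries_shift_derive f a z rho Ha).
Qed.

Lemma analytic_continuous (f : C -> C) (z : C) :
  analytic f -> unit_disc z -> C_continuous f z.
Proof. intros Hf Hz. eapply C_is_derive_continuous, analytic_is_derive; auto. Qed.

(** The working criterion for [analytic]: sums, products, primitives and dilations are handled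
    through derivatives instead of manipulations of power series. *)
Lemma holomorphic_analytic (f f' : C -> C) :
  (forall z, unit_disc z -> C_is_derive f z (f' z)) ->
  (forall z, unit_disc z -> C_continuous f' z) -> analytic f.
Proof.
intros Hf Hf' z0 Hz0. unfold unit_disc in Hz0. exists (1 - Cmod z0).
destruct (cauchy_taylor f f' z0 (1 - Cmod z0)) as [a Ha]; [lra| | |].
- intros z Hz. now apply Hf, (disc_nbhd z0).
- intros z Hz. now apply Hf', (disc_nbhd z0).
- exists a. split; [lra|auto].
Qed.

Lemma analytic_taylor (f : C -> C) : analytic f -> exists a, taylor f a.
Proof.
intros Hf. destruct (cauchy_taylor f (C_derive f) 0%C 1) as [a Ha]; [lra| | |].
- intros z Hz. apply analytic_is_derive; auto. now replace z with (z - 0)%C by ring.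
- intros z Hz. apply analytic_continuous; [now apply analytic_derive|].
  now replace z with (z - 0)%C by ring.
- exists a. intros z Hz. specialize (Ha z). replace (z - 0)%C with z in Ha by ring. auto.
Qed.

Lemma taylor_unique (f : C -> C) (a b : nat -> C) :
  taylor f a -> taylor f b -> forall n, a n = b n.
Proof.
intros Ha Hb. apply (pseries_unique a b f 1); [lra| |]; intros z Hz;
  apply (proj1 (C_is_pseries _ _ _)); auto.
Qed.

Lemma taylor_derive (f : C -> C) (a : nat -> C) :
  taylor f a -> taylor (C_derive f) (fun n => INR (S n) * a (S n))%C.
Proof.
intros Ha z Hz.
destruct (pseries_shift_derive f a 0%C 1) with (z := z) as [_ H].
- intros w Hw. replace (w - 0)%C with w in * by ring. now apply Ha.
- now replace (z - 0)%C with z by ring.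
- replace (z - 0)%C with z in H by ring. exact H.
Qed.

(** The series at 0 is expanded around the other centres by way of its derivatives and Cauchy's
    formula, which avoids rearranging a double series. *)
Lemma taylor_analytic (f : C -> C) (a : nat -> C) : taylor f a -> analytic f.
Proof.
intros Ha.
assert (Hd : forall f a, taylor f a -> forall z, unit_disc z -> C_is_derive f z (C_derive f z)).
{ clear. intros f a Ha z Hz.
  apply (pseries_shift_derive f a 0%C 1).
  - intros w Hw. replace (w - 0)%C with w in * by ring. now apply Ha.
  - now replace (z - 0)%C with z by ring. }
apply (holomorphic_analytic f (C_derive f)).
- eapply Hd, Ha.
- intros z Hz. eapply C_is_derive_continuous, Hd; auto. apply (taylor_derive f a Ha).
Qed.

Lemma taylor_bound (f : C -> C) (a : nat -> C) (s : R) :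
  taylor f a -> 0 <= s < 1 -> exists B, 0 <= B /\ forall n, Cmod (a n) * s ^ n <= B.
Proof.
intros Ha. apply (pseries_coeff_bound a f). intros z Hz.
apply (proj1 (C_is_pseries _ _ _)); auto.
Qed.

Lemma C_continuous_mult (f h : C -> C) (z : C) :
  C_continuous f z -> C_continuous h z -> C_continuous (fun w => f w * h w)%C z.
Proof. apply C_filterlim_mult. apply locally_filter. Qed.

Lemma C_continuous_plus (f h : C -> C) (z : C) :
  C_continuous f z -> C_continuous h z -> C_continuous (fun w => f w + h w)%C z.
Proof. apply C_filterlim_plus. apply locally_filter. Qed.

Lemma analytic_mult (f h : C -> C) :
  analytic f -> analytic h -> analytic (fun z => f z * h z)%C.
Proof.
intros Hf Hh.
apply (holomorphic_analytic _ (fun z => C_derive f z * h z + f z * C_derive h z)%C).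
- intros z Hz. apply C_is_derive_mult; now apply analytic_is_derive.
- intros z Hz. apply C_continuous_plus; apply C_continuous_mult;
    apply analytic_continuous; auto; now apply analytic_derive.
Qed.

Lemma analytic_const (c : C) : analytic (fun _ => c).
Proof.
apply (holomorphic_analytic _ (fun _ => 0%C)).
- intros z Hz. apply C_is_derive_const.
- intros z Hz. apply filterlim_const.
Qed.

Lemma analytic_plus (f h : C -> C) :
  analytic f -> analytic h -> analytic (fun z => f z + h z)%C.
Proof.
intros Hf Hh. apply (holomorphic_analytic _ (fun z => C_derive f z + C_derive h z)%C).
- intros z Hz. apply C_is_derive_plus; now apply analytic_is_derive.
- intros z Hz. apply C_continuous_plus; apply analytic_continuous; auto; now apply analytic_derive.
Qed.

(** * Integration along segments, primitives, and the operator [int0] *)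

Lemma C_mean_value (Q q : C -> C) (B : R) (w z : C) :
  (forall x, unit_disc x -> C_is_derive Q x (q x)) ->
  (forall x, unit_disc x -> C_continuous q x) ->
  (forall x, unit_disc x -> Cmod (q x) <= B) ->
  unit_disc w -> unit_disc z -> Cmod (Q z - Q w) <= B * Cmod (z - w).
Proof.
intros HQ Hq HB Hw Hz.
assert (Hp : forall t, 0 <= t <= 1 -> unit_disc (w + t * (z - w))%C).
{ unfold unit_disc in *. intros t Ht.
  replace (w + t * (z - w))%C with ((1 - t)%R * w + t * z)%C by (rewrite RtoC_minus; ring).
  eapply Rle_lt_trans; [apply Cmod_triangle|].
  rewrite !Cmod_mult, !Cmod_R, !Rabs_pos_eq by lra.
  apply Rle_lt_trans with (Rmax (Cmod w) (Cmod z)); [|now apply Rmax_lub_lt].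
  replace (Rmax (Cmod w) (Cmod z)) with
    ((1 - t) * Rmax (Cmod w) (Cmod z) + t * Rmax (Cmod w) (Cmod z)) by ring.
  apply Rplus_le_compat; apply Rmult_le_compat_l; try lra; [apply Rmax_l|apply Rmax_r]. }
assert (H : C_is_RInt (fun t => q (w + t * (z - w)) * (z - w))%C 0 1
  (Q (w + 1%R * (z - w)) - Q (w + 0%R * (z - w)))%C).
{ apply (path_FTC (fun t => Q (w + t * (z - w)))%C); [lra| |].
  - intros t Ht. apply (path_derive_comp Q (fun t => w + t * (z - w))%C); auto.
    apply path_derive_line.
  - intros t Ht. apply C_filterlim_mult; [apply locally_filter| |apply filterlim_const].
    eapply filterlim_comp; [|apply Hq, Hp, Ht].
    eapply path_derive_continuous, path_derive_line. }
replace (w + 1%R * (z - w))%C with z in H by ring.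
replace (w + 0%R * (z - w))%C with w in H by ring.
eapply Rle_trans; [apply (C_RInt_le _ 0 1 _ (B * Cmod (z - w)) ltac:(lra)) with (2 := H)|].
- intros t Ht. rewrite Cmod_mult. apply Rmult_le_compat_r; [apply Cmod_ge_0|]. auto.
- lra.
Qed.

(** The Taylor series is integrated term by term; division by [n + 1] does not enlarge the
    coefficients, so convergence on the whole disc is preserved. *)
Lemma analytic_primitive (h : C -> C) : analytic h ->
  exists P : C -> C, P 0%C = 0%C /\ forall z, unit_disc z -> C_is_derive P z (h z).
Proof.
intros Hh. destruct (analytic_taylor h Hh) as [c Hc].
set (p := fun n => match n with O => RtoC 0 | S n => (c n / INR (S n))%C end).
set (P := fun z => C_Series (fun n => p n * z ^ n)%C).
assert (HP : forall z, Cmod z < 1 -> C_is_series (fun n => p n * z ^ n)%C (P z)).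
{ intros z Hz. apply C_Series_correct.
  set (s := (Cmod z + 1) / 2).
  assert (Hs : Cmod z < s < 1 /\ 0 <= s) by (unfold s; generalize (Cmod_ge_0 z); lra).
  destruct (taylor_bound h c s Hc ltac:(lra)) as [B [HB Hcs]].
  apply (C_ex_pseries_bound p s B); [|lra].
  intros [|n]; unfold p.
  - rewrite Cmod_0. lra.
  - assert (Hn : 1 <= INR (S n)) by (rewrite S_INR; generalize (pos_INR n); lra).
    assert (Hn0 := RtoC_INR_S_neq_0 n).
    rewrite Cmod_div, Cmod_R, Rabs_pos_eq by (auto; lra).
    apply Rle_trans with (Cmod (c n) * s ^ n); auto.
    replace (Cmod (c n) / INR (S n) * s ^ S n)
      with (Cmod (c n) * s ^ n * (s * / INR (S n))) by (simpl; field; simpl in Hn; lra).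
    rewrite <- (Rmult_1_r (Cmod (c n) * s ^ n)) at 2.
    apply Rmult_le_compat_l.
    + apply Rmult_le_pos; [apply Cmod_ge_0|apply pow_le; lra].
    + apply Rmult_le_reg_r with (INR (S n)); [lra|].
      rewrite Rmult_assoc, Rinv_l by lra. lra. }
exists P. split.
- apply C_Series_unique. apply (C_is_series_at_0 p).
- intros z Hz. destruct (is_derive_pseries p P 1 z HP Hz) as [l [Hl Hd]].
  replace (h z) with l; auto.
  eapply C_is_series_unique; [apply Hl|].
  eapply C_is_series_ext; [|exact (proj1 (C_is_pseries _ _ _) (Hc z Hz))].
  intros n. unfold p.
  assert (Hn0 := RtoC_INR_S_neq_0 n).
  simpl. field. exact Hn0.
Qed.

Lemma radial_RInt (h : C -> C) (z : C) : analytic h -> unit_disc z ->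
  C_is_RInt (fun t => h (t * z)%C) 0 1 (@RInt CR (fun t => h (t * z)%C) 0 1).
Proof.
intros Hh Hz. apply (@RInt_correct CR).
apply C_ex_RInt_continuous; [lra|]. intros t Ht.
eapply filterlim_comp; [|apply analytic_continuous; [exact Hh|now apply disc_segment]].
apply C_filterlim_mult; [apply locally_filter|apply path_continuous_RtoC|apply filterlim_const].
Qed.

Lemma int0_ext (f h : C -> C) (z : C) : eq_on_disc f h -> unit_disc z -> int0 f z = int0 h z.
Proof.
intros E Hz. unfold int0. f_equal. apply (@RInt_ext CR).
intros t. rewrite Rmin_left, Rmax_right by lra. intros Ht.
apply E, disc_segment; auto; lra.
Qed.

(** The fundamental theorem of calculus along the radius. It allows [int0] to be computed from any
    primitive, so that linearity and integration by parts become statements about derivatives. *)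
Lemma int0_primitive (h P : C -> C) (z : C) : analytic h ->
  (forall x, unit_disc x -> C_is_derive P x (h x)) -> unit_disc z ->
  int0 h z = (P z - P 0)%C.
Proof.
intros Hh HP Hz.
assert (HR := radial_RInt h z Hh Hz).
assert (HF : C_is_RInt (fun t => h (0 + t * z) * z)%C 0 1
   (P (0 + 1%R * z) - P (0 + 0%R * z))%C).
{ apply (path_FTC (fun t => P (0 + t * z))%C); [lra| |].
  - intros t Ht. apply (path_derive_comp P (fun t => 0 + t * z)%C).
    + apply HP. replace (0 + t * z)%C with (t * z)%C by ring. now apply disc_segment.
    + apply path_derive_line.
  - intros t Ht. apply C_filterlim_mult; [apply locally_filter| |apply filterlim_const].
    eapply filterlim_comp; [eapply path_derive_continuous, path_derive_line|].
    apply analytic_continuous; auto.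
    replace (0 + t * z)%C with (t * z)%C by ring. now apply disc_segment. }
replace (0 + 1%R * z)%C with z in HF by ring.
replace (0 + 0%R * z)%C with (RtoC 0) in HF by ring.
rewrite <- (C_is_RInt_unique _ _ _ _ HF). unfold int0. symmetry. apply C_is_RInt_unique.
eapply is_RInt_ext; [|apply (C_is_RInt_scal z _ _ _ _ HR)].
intros t _. simpl. replace (0 + t * z)%C with (t * z)%C by ring. ring.
Qed.

Lemma int0_0 (h : C -> C) : int0 h 0%C = 0%C.
Proof. unfold int0. ring. Qed.

Lemma int0_is_derive (h : C -> C) (z : C) : analytic h -> unit_disc z ->
  C_is_derive (int0 h) z (h z).
Proof.
intros Hh Hz. destruct (analytic_primitive h Hh) as [P [HP0 HP]].
apply (C_is_derive_ext_loc P _ z _ (1 - Cmod z)); auto.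
- unfold unit_disc in Hz; lra.
- intros w Hw. rewrite (int0_primitive h P w Hh HP) by now apply (disc_nbhd z).
  rewrite HP0. ring.
Qed.

Lemma int0_analytic (h : C -> C) : analytic h -> analytic (int0 h).
Proof.
intros Hh. apply (holomorphic_analytic _ h).
- intros z Hz. now apply int0_is_derive.
- intros z Hz. now apply analytic_continuous.
Qed.

Lemma int0_plus (f h : C -> C) (z : C) : analytic f -> analytic h -> unit_disc z ->
  int0 (fun w => f w + h w)%C z = (int0 f z + int0 h z)%C.
Proof.
intros Hf Hh Hz.
rewrite (int0_primitive _ (fun w => int0 f w + int0 h w)%C); auto using analytic_plus.
- rewrite !int0_0. ring.
- intros x Hx. apply C_is_derive_plus; now apply int0_is_derive.
Qed.

Lemma int0_scal (c : C) (h : C -> C) (z : C) : analytic h -> unit_disc z ->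
  int0 (fun w => c * h w)%C z = (c * int0 h z)%C.
Proof.
intros Hh Hz.
rewrite (int0_primitive _ (fun w => c * int0 h w)%C); auto.
- rewrite !int0_0. ring.
- apply analytic_mult; auto using analytic_const.
- intros x Hx. apply C_is_derive_scal; now apply int0_is_derive.
Qed.

(** * The pairing and the symbol of the Volterra operator *)

Lemma analytic_pow (n : nat) : analytic (fun z => z ^ n)%C.
Proof.
apply (holomorphic_analytic _ (fun z => INR n * z ^ pred n)%C).
- intros z _. apply C_is_derive_pow.
- intros z _. apply C_continuous_mult; [apply filterlim_const|].
  eapply C_is_derive_continuous, C_is_derive_pow.
Qed.

Lemma radial_bound (p : C -> C) (z : C) : analytic p -> unit_disc z ->
  exists B, 0 <= B /\ forall t, 0 <= t <= 1 -> Cmod (p (t * z)%C) <= B.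
Proof.
intros Hp Hz. apply (path_bounded (fun t => p (t * z)%C)). intros t Ht.
eapply filterlim_comp; [|apply analytic_continuous; [exact Hp|now apply disc_segment]].
apply C_filterlim_mult; [apply locally_filter|apply path_continuous_RtoC|apply filterlim_const].
Qed.

(** With [p = g'] this is the geometric decay of the numbers [m_n], at the rate [|z| < 1], that lets
    the pairing series converge beyond [r = 1]. *)
Lemma int0_pow_bound (p : C -> C) (z : C) : analytic p -> unit_disc z ->
  exists B, 0 <= B /\
    forall n, Cmod (int0 (fun x => p x * x ^ n)%C z) <= B * Cmod z ^ n.
Proof.
intros Hp Hz. destruct (radial_bound p z Hp Hz) as [B [HB HpB]].
exists B; split; auto. intros n. unfold int0. rewrite Cmod_mult.
assert (Han : analytic (fun x => p x * x ^ n)%C) by (apply analytic_mult; auto using analytic_pow).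
generalize (Cmod_ge_0 z); intros Hz0. unfold unit_disc in Hz.
assert (H : Cmod (@RInt CR (fun t => p (t * z) * (t * z) ^ n)%C 0 1) <= (1 - 0) * (B * Cmod z ^ n)).
{ apply (C_RInt_le (fun t => p (t * z) * (t * z) ^ n)%C 0 1); [lra| |].
  - intros t Ht. rewrite Cmod_mult, Cmod_pow, Cmod_mult, Cmod_R, Rabs_pos_eq by lra.
    apply Rmult_le_compat; auto using Cmod_ge_0.
    + apply pow_le. nra.
    + apply pow_incr. nra.
  - exact (radial_RInt (fun x => p x * x ^ n)%C z Han Hz). }
generalize (Cmod_ge_0 (@RInt CR (fun t => p (t * z) * (t * z) ^ n)%C 0 1)). nra.
Qed.

(** On the segment from 0 to [z] the Taylor series of [k] is dominated by a geometric series of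
    ratio [|z| / s] with [|z| < s < 1], hence can be integrated against [p]. It serves twice: with
    [k] the conjugate kernel for the coefficients of the symbol, and with [k = f] for the value of
    [T_g f]. *)
Lemma int0_taylor (p k : C -> C) (c : nat -> C) (z : C) :
  analytic p -> taylor k c -> unit_disc z ->
  C_is_series (fun n => c n * int0 (fun x => p x * x ^ n) z)%C
    (int0 (fun x => p x * k x)%C z).
Proof.
intros Hp Hc Hz. destruct (radial_bound p z Hp Hz) as [B [HB HpB]].
set (s := (Cmod z + 1) / 2).
assert (Hz' := Hz). unfold unit_disc in Hz'.
assert (Hs : Cmod z < s < 1 /\ 0 <= s) by (unfold s; generalize (Cmod_ge_0 z); lra).
destruct (taylor_bound k c s Hc ltac:(lra)) as [A [HA HcA]].
generalize (Cmod_ge_0 z); intros Hz0.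
assert (Han : forall n, analytic (fun x => p x * x ^ n)%C)
  by (intros n; apply analytic_mult; auto using analytic_pow).
assert (Hq : 0 <= Cmod z / s < 1) by (apply ratio_lt_1; lra).
unfold int0.
apply C_is_series_ext with (fun n => z * (c n * @RInt CR (fun t => p (t * z) * (t * z) ^ n)%C 0 1))%C.
{ intros n. ring. }
apply C_is_series_scal.
apply (C_is_series_RInt (fun n t => c n * (p (t * z) * (t * z) ^ n))%C
  (fun t => p (t * z) * k (t * z))%C (fun n => A * B * (Cmod z / s) ^ n) 0 1); [lra| | | | |].
- intros n t Ht. rewrite !Cmod_mult, Cmod_pow, Cmod_mult, Cmod_R, Rabs_pos_eq by lra.
  assert (Hsn : 0 < s ^ n) by (apply pow_lt; lra).
  apply Rle_trans with (Cmod (c n) * (B * Cmod z ^ n)).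
  + apply Rmult_le_compat_l; [apply Cmod_ge_0|].
    apply Rmult_le_compat; auto using Cmod_ge_0.
    * apply pow_le. nra.
    * apply pow_incr. nra.
  + unfold Rdiv. rewrite Rpow_mult_distr, pow_inv.
    replace (Cmod (c n) * (B * Cmod z ^ n))
      with (Cmod (c n) * s ^ n * (B * (Cmod z ^ n * / s ^ n))) by (field; lra).
    rewrite (Rmult_assoc A B). apply Rmult_le_compat_r; auto.
    apply Rmult_le_pos; auto. apply Rmult_le_pos; [now apply pow_le|].
    left; now apply Rinv_0_lt_compat.
- now apply ex_series_geom_bound.
- intros t Ht.
  eapply C_is_series_ext; [|apply C_is_series_scal].
  2: exact (proj1 (C_is_pseries _ _ _) (Hc (t * z)%C (disc_segment z t Hz Ht))).
  intros n; simpl. ring.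
- intros n. apply C_is_RInt_scal. exact (radial_RInt (fun x => p x * x ^ n)%C z (Han n) Hz).
- apply (radial_RInt (fun x => p x * k x)%C z); auto.
  apply analytic_mult; auto. eapply taylor_analytic, Hc.
Qed.

Lemma C_is_series_conj (a : nat -> C) (l : C) :
  C_is_series a l -> C_is_series (fun n => Cconj (a n)) (Cconj l).
Proof.
intros H. apply C_is_series_eps. intros eps Heps.
rewrite C_is_series_eps in H. destruct (H eps Heps) as [N HN]. exists N. intros n Hn.
assert (C_sum_n (fun n => Cconj (a n)) n = Cconj (C_sum_n a n)) as ->.
{ clear. induction n as [|n IH]; [now rewrite !sum_O|].
  rewrite !sum_Sn, IH. symmetry. apply Cplus_conj. }
rewrite <- Cminus_conj, Cmod_conj. now apply HN.
Qed.

(** * The weights, the reproducing kernel and the symbol *)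

Lemma eventually_bounded (u : nat -> R) (B : R) (N : nat) :
  (forall n, (N <= n)%nat -> u n <= B) -> exists B', forall n, u n <= B'.
Proof.
intros H.
assert (H1 : forall m, exists B', forall n, (n <= m)%nat -> u n <= B').
{ induction m as [|m [B' HB']].
  - exists (u 0%nat). intros n Hn. replace n with 0%nat by lia. apply Rle_refl.
  - exists (Rmax B' (u (S m))). intros n Hn. destruct (Nat.eq_dec n (S m)) as [->|Hne].
    + apply Rmax_r.
    + eapply Rle_trans; [apply HB'; lia|apply Rmax_l]. }
destruct (H1 N) as [B' HB']. exists (Rmax B B'). intros n.
destruct (Compare_dec.le_lt_dec N n) as [Hn|Hn].
- eapply Rle_trans; [now apply H|apply Rmax_l].
- eapply Rle_trans; [apply HB'; lia|apply Rmax_r].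
Qed.

(** Eventually [beta_n^(1/n) > q], that is [q^n < beta_n]; the finitely many remaining indices are
    absorbed by the constant. *)
Lemma weight_bound (beta : nat -> R) (q : R) :
  (forall n, 0 < beta n) ->
  is_lim_seq (fun n => Rpower (beta n) (/ INR n)) 1 ->
  0 < q < 1 -> exists B, forall n, q ^ n / beta n <= B.
Proof.
intros Hb Hl Hq.
apply is_lim_seq_spec in Hl. destruct (Hl (mkposreal (1 - q) ltac:(lra))) as [N HN].
(* Starting at [S N] forces [n >= 1], so that [/ INR n] is a true inverse. *)
apply (eventually_bounded _ 1 (S N)). intros n Hn.
specialize (HN n ltac:(lia)). simpl in HN. apply Rabs_def2 in HN.
assert (Hqr : q < Rpower (beta n) (/ INR n)) by lra.
assert (Hn0 : INR n <> 0) by (apply not_0_INR; lia).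
assert (E : Rpower (beta n) (/ INR n) ^ n = beta n).
{ rewrite <- Rpower_pow by apply exp_pos. rewrite Rpower_mult, Rinv_l by auto.
  now apply Rpower_1. }
apply Rmult_le_reg_r with (beta n); auto.
unfold Rdiv. rewrite Rmult_assoc, Rinv_l, Rmult_1_r, Rmult_1_l by (generalize (Hb n); lra).
rewrite <- E. apply pow_incr. lra.
Qed.

(** [K_z(w)] is antianalytic in [z], and conjugation makes it a power series in [z]: this is the
    reason why the symbol integrates the conjugate of the kernel. Convergence holds because
    [|w conj z| < 1] while the n-th roots of the weights tend to 1. *)
Lemma taylor_conj_kernel (beta : nat -> R) (w : C) :
  (forall n, 0 < beta n) ->
  is_lim_seq (fun n => Rpower (beta n) (/ INR n)) 1 -> unit_disc w ->
  taylor (fun z => Cconj (repr_kernel beta z w)) (fun n => Cconj w ^ n / beta n)%C.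
Proof.
intros Hb Hl Hw z Hz. apply (proj2 (C_is_pseries _ _ _)).
assert (Hbn : forall n, RtoC (beta n) <> 0%C).
{ intros n H. apply RtoC_inj in H. generalize (Hb n); lra. }
assert (Hex : C_ex_series (fun n => (w * Cconj z) ^ n / beta n)%C).
{ set (m := Cmod (w * Cconj z)).
  assert (Hm : 0 <= m < 1).
  { unfold m. split; [apply Cmod_ge_0|]. unfold unit_disc in *.
    rewrite Cmod_mult, Cmod_conj. generalize (Cmod_ge_0 w) (Cmod_ge_0 z). nra. }
  destruct (weight_bound beta ((m + 1) / 2) Hb Hl ltac:(lra)) as [B HB].
  destruct (C_ex_pseries_bound (fun n => / beta n)%C ((m + 1) / 2) B (w * Cconj z)%C) as [l H].
  - intros n. rewrite Cmod_inv, Cmod_R, Rabs_pos_eq by (auto; left; auto).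
    rewrite Rmult_comm. apply HB.
  - change (m < (m + 1) / 2). lra.
  - exists l. eapply C_is_series_ext; [|apply H]. intros n. simpl. unfold Cdiv. ring. }
apply C_Series_correct in Hex. apply C_is_series_conj in Hex.
eapply C_is_series_ext; [|apply Hex].
intros n. simpl. rewrite Cdiv_conj by auto. rewrite Cpow_conj, Cmult_conj, Cconj_conj, Cpow_mult_l.
rewrite Cconj_RtoC.
field. auto.
Qed.

Lemma taylor_sym_G (beta : nat -> R) (g : C -> C) (z : C) :
  analytic g -> (forall n, 0 < beta n) ->
  is_lim_seq (fun n => Rpower (beta n) (/ INR n)) 1 -> unit_disc z ->
  taylor (sym_G beta g z)
    (fun n => Cconj (int0 (fun x => C_derive g x * x ^ n) z) / beta n)%C.
Proof.
intros Hg Hb Hl Hz w Hw. apply (proj2 (C_is_pseries _ _ _)).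
assert (H := int0_taylor _ _ _ z (analytic_derive g Hg) (taylor_conj_kernel beta w Hb Hl Hw) Hz).
apply C_is_series_conj in H.
eapply C_is_series_ext; [|apply H].
intros n. simpl.
assert (Hbn : RtoC (beta n) <> 0%C).
{ intros H0. apply RtoC_inj in H0. generalize (Hb n); lra. }
rewrite Cmult_conj, Cdiv_conj by auto. rewrite Cpow_conj, Cconj_conj.
rewrite Cconj_RtoC.
field. auto.
Qed.

(** The weight [beta_n] of the pairing cancels the one in the coefficient of the symbol, leaving the
    power series of [a_n m_n] in the variable [s = r]. Its radius of convergence exceeds 1, so the
    limit as [r -> 1] is mere continuity at [s = 1]. *)
Lemma volterra_pairing (beta : nat -> R) (g f : C -> C) (z : C) :
  analytic g -> analytic f -> (forall n, 0 < beta n) ->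
  is_lim_seq (fun n => Rpower (beta n) (/ INR n)) 1 -> unit_disc z ->
  is_pairing beta f (sym_G beta g z) (volterra g f z).
Proof.
intros Hg Hf Hb Hl Hz. destruct (analytic_taylor f Hf) as [a Ha].
exists a, (fun n => Cconj (int0 (fun x => C_derive g x * x ^ n) z) / beta n)%C.
split; auto. split; [now apply taylor_sym_G|].
set (m := fun n => int0 (fun x => C_derive g x * x ^ n)%C z).
set (c := fun n => (a n * m n)%C).
destruct (int0_pow_bound (C_derive g) z (analytic_derive g Hg) Hz) as [B [HB HmB]].
unfold unit_disc in Hz. generalize (Cmod_ge_0 z); intros Hz0.
(* Chosen so that [rho > 1] and [rho |z| < 1]: then [a_n (rho |z|)^n] is bounded, and with it
   [a_n m_n rho^n]. *)
set (rho := 2 / (1 + Cmod z)).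
assert (Hrho : 1 < rho).
{ unfold rho. apply Rmult_lt_reg_r with (1 + Cmod z); [lra|]. field_simplify; lra. }
assert (Hs : 0 <= rho * Cmod z < 1).
{ split; [nra|]. unfold rho. apply Rmult_lt_reg_r with (1 + Cmod z); [lra|]. field_simplify; lra. }
destruct (taylor_bound f a _ Ha Hs) as [A [HA HaA]].
assert (Hq : forall s, Cmod s < rho ->
   C_is_series (fun n => c n * s ^ n)%C (C_Series (fun n => c n * s ^ n)%C)).
{ intros s Hsr. apply C_Series_correct, (C_ex_pseries_bound c rho (A * B)); auto.
  intros n. unfold c. rewrite Cmod_mult.
  specialize (HaA n). rewrite Rpow_mult_distr in HaA.
  assert (Hrn : 0 < rho ^ n) by (apply pow_lt; lra).
  apply Rle_trans with (Cmod (a n) * (B * Cmod z ^ n) * rho ^ n).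
  - apply Rmult_le_compat_r; [lra|]. apply Rmult_le_compat_l; [apply Cmod_ge_0|]. apply HmB.
  - replace (Cmod (a n) * (B * Cmod z ^ n) * rho ^ n)
      with (Cmod (a n) * (rho ^ n * Cmod z ^ n) * B) by ring.
    apply Rmult_le_compat_r; auto. }
exists (fun r => C_Series (fun n => c n * (RtoC r) ^ n)%C). split.
- intros r Hr. eapply C_is_series_ext; [|apply Hq].
  2: { rewrite Cmod_R, Rabs_pos_eq; lra. }
  intros n. simpl. unfold c, m.
  assert (Hbn : RtoC (beta n) <> 0%C).
  { intros H0. apply RtoC_inj in H0. generalize (Hb n); lra. }
  rewrite Cdiv_conj, Cconj_conj, RtoC_pow by auto.
  rewrite Cconj_RtoC.
  field. auto.
- assert (E : volterra g f z = C_Series (fun n => c n * (RtoC 1) ^ n)%C).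
  { symmetry. apply C_Series_unique. unfold volterra.
    rewrite (int0_ext _ (fun x => C_derive g x * f x)%C) by (auto; intros x _; ring).
    eapply C_is_series_ext; [|apply (int0_taylor _ f a z (analytic_derive g Hg) Ha Hz)].
    intros n. simpl. unfold c, m. rewrite Cpow_1_l. ring. }
  rewrite E.
  assert (H1 : Cmod 1 < rho) by (rewrite Cmod_1; exact Hrho).
  destruct (is_derive_pseries c (fun s => C_Series (fun n => c n * s ^ n)%C) rho 1 Hq H1)
    as [l [_ Hd]].
  apply (filterlim_comp _ _ _ RtoC (fun s => C_Series (fun n => c n * s ^ n)%C) _ (C_locally (RtoC 1))).
  + eapply filterlim_filter_le_1; [|apply path_continuous_RtoC].
    apply filter_le_within.
  + exact (C_is_derive_continuous _ _ _ Hd).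
Qed.

Lemma is_pairing_unique (beta : nat -> R) (f h : C -> C) (l1 l2 : C) :
  is_pairing beta f h l1 -> is_pairing beta f h l2 -> l1 = l2.
Proof.
intros [a1 [b1 [Ha1 [Hb1 [S1 [HS1 Hl1]]]]]] [a2 [b2 [Ha2 [Hb2 [S2 [HS2 Hl2]]]]]].
apply (filterlim_locally_unique (V := C_NormedModule) (F := at_left 1) S1); auto.
eapply filterlim_ext_loc; [|apply Hl2].
exists (mkposreal 1 Rlt_0_1). intros r Hr Hr1.
change (Rabs (r - 1) < 1) in Hr. apply Rabs_def2 in Hr.
assert (Hr0 : 0 < r < 1) by lra.
eapply C_is_series_unique; [apply (HS2 r Hr0)|].
eapply C_is_series_ext; [|apply (HS1 r Hr0)].
intros n. simpl.
now rewrite (taylor_unique f a1 a2 Ha1 Ha2 n), (taylor_unique h b1 b2 Hb1 Hb2 n).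
Qed.

Lemma pairing_eq (beta : nat -> R) (f h : C -> C) (l : C) :
  is_pairing beta f h l -> pairing beta f h = l.
Proof.
intros H. apply (@iota_unique C_AbsRing C_CompleteNormedModule); auto.
intros y Hy. eapply is_pairing_unique; eauto.
Qed.

(** * The duality criterion *)

Lemma sup_norm_ge (f : C -> C) (z : C) : unit_disc z -> Rbar_le (Cmod (f z)) (sup_norm f).
Proof. intros Hz. apply Lub_Rbar_correct. now exists z. Qed.

Lemma sup_norm_le (f : C -> C) (M : R) :
  (forall z, unit_disc z -> Cmod (f z) <= M) -> Rbar_le (sup_norm f) M.
Proof. intros H. apply Lub_Rbar_correct. intros t [z [Hz ->]]. apply H, Hz. Qed.

Lemma sup_norm_finite (f : C -> C) (M : R) : Rbar_le (sup_norm f) M -> is_finite (sup_norm f).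
Proof.
intros H. generalize (sup_norm_ge f 0%C disc_0). unfold is_finite.
destruct (sup_norm f); simpl in *; tauto.
Qed.

Lemma ext_norm_eq (X : banach_of_analytic) (x : X) (f : C -> C) :
  eq_on_disc (fn x) f -> ext_norm X f = Finite (norm x).
Proof.
intros Hx. apply is_glb_Rbar_unique. split.
- intros t [y [Hy ->]]. replace y with x; [apply Rle_refl|].
  apply fn_inj. intros z Hz. now rewrite Hx, Hy.
- intros b Hb. apply Hb. now exists x.
Qed.

Lemma ext_norm_ge_0 (X : banach_of_analytic) (f : C -> C) : Rbar_le 0 (ext_norm X f).
Proof. apply Glb_Rbar_correct. intros t [x [_ ->]]. apply norm_ge_0. Qed.

(** Normalizing by [norm x + d] instead of [norm x] treats the zero vector together with the others;
    [d] is then made arbitrarily small. *)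
Lemma homogeneous_bound (X : NormedModule C_AbsRing) (L : X -> C) (K : R) :
  (forall c x, L (scal c x) = (c * L x)%C) ->
  (forall x, norm x <= 1 -> Cmod (L x) <= K) ->
  forall x, Cmod (L x) <= K * norm x.
Proof.
intros HL HK x. generalize (norm_ge_0 x); intros Hx.
assert (HK0 : 0 <= K).
{ eapply Rle_trans; [apply Cmod_ge_0|apply (HK zero)]. rewrite norm_zero. lra. }
apply le_epsilon. intros e He.
set (d := e / (K + 1)). assert (Hd : 0 < d) by (unfold d; apply Rdiv_lt_0_compat; lra).
assert (H : Cmod (L x) <= K * (norm x + d)).
{ assert (Hc : 0 < / (norm x + d)) by (apply Rinv_0_lt_compat; lra).
  assert (H1 : norm (scal (RtoC (/ (norm x + d))) x) <= 1).
  { eapply Rle_trans; [apply (@norm_scal C_AbsRing X)|].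
    change (Cmod (RtoC (/ (norm x + d))) * norm x <= 1).
    rewrite Cmod_R, Rabs_pos_eq by lra.
    apply Rmult_le_reg_l with (norm x + d); [lra|].
    rewrite <- Rmult_assoc, Rinv_r by lra. lra. }
  apply HK in H1. rewrite HL, Cmod_mult, Cmod_R, Rabs_pos_eq in H1 by lra.
  apply Rmult_le_reg_l with (/ (norm x + d)); auto.
  replace (/ (norm x + d) * (K * (norm x + d))) with K by (field; lra). exact H1. }
apply Rle_trans with (1 := H). rewrite Rmult_plus_distr_l. apply Rplus_le_compat_l.
apply Rle_trans with ((K + 1) * d); [apply Rmult_le_compat_r; lra|].
right. unfold d. field. lra.
Qed.

Lemma volterra_analytic (g f : C -> C) : analytic g -> analytic f -> analytic (volterra g f).
Proof.
intros Hg Hf. apply int0_analytic, analytic_mult; auto. now apply analytic_derive.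
Qed.

Lemma volterra_scal (X : banach_of_analytic) (g : C -> C) (c : C) (x : X) (z : C) :
  analytic g -> unit_disc z ->
  volterra g (fn (scal c x)) z = (c * volterra g (fn x) z)%C.
Proof.
intros Hg Hz. unfold volterra.
rewrite <- int0_scal; auto.
- apply int0_ext; auto. intros w Hw. rewrite fn_scal by auto. ring.
- apply analytic_mult; [apply fn_analytic|now apply analytic_derive].
Qed.

Lemma volterra_plus (X : banach_of_analytic) (g : C -> C) (x y : X) (z : C) :
  analytic g -> unit_disc z ->
  volterra g (fn (plus x y)) z = (volterra g (fn x) z + volterra g (fn y) z)%C.
Proof.
intros Hg Hz. unfold volterra.
rewrite <- int0_plus; auto.
- apply int0_ext; auto. intros w Hw. rewrite fn_plus by auto. ring.
- apply analytic_mult; [apply fn_analytic|now apply analytic_derive].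
- apply analytic_mult; [apply fn_analytic|now apply analytic_derive].
Qed.

(** Replaces extended-real sup norms by pointwise inequalities with a nonnegative constant, the form
    used in both parts. *)
Lemma volterra_bounded_to_Hinf (X : banach_of_analytic) (g : C -> C) :
  analytic g ->
  volterra_bounded_to in_Hinf X g <->
  exists M, 0 <= M /\ forall (x : X) z, unit_disc z -> Cmod (volterra g (fn x) z) <= M * norm x.
Proof.
intros Hg. split.
- intros [_ [M HM]]. exists (Rmax M 0). split; [apply Rmax_r|]. intros x z Hz.
  assert (H := Rbar_le_trans _ _ _ (sup_norm_ge _ z Hz) (HM x)). simpl in H.
  eapply Rle_trans; [exact H|]. apply Rmult_le_compat_r; [apply norm_ge_0|apply Rmax_l].
- intros [M [HM0 HM]].
  assert (H : forall x : X, Rbar_le (sup_norm (volterra g (fn x))) (M * norm x)).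
  { intros x. apply sup_norm_le. intros z Hz. now apply HM. }
  split; [|exists M; exact H].
  intros x. split.
  + apply volterra_analytic; auto. apply fn_analytic.
  + eapply sup_norm_finite, H.
Qed.

(** The case [e = p_infty] carries the content: a finite bound on [e / K] excludes it. Applied to
    [ext_norm], this is how the symbol is seen to belong to [Y]. *)
Lemma Rbar_mult_le_finite (K M : R) (e : Rbar) :
  0 < K -> Rbar_le (Rbar_mult (/ K)%R e) M -> Rbar_le e (K * M).
Proof.
intros HK. assert (HK' : 0 < / K) by now apply Rinv_0_lt_compat.
destruct e as [e| |]; simpl.
- intros H. apply Rmult_le_reg_l with (/ K); auto.
  rewrite <- Rmult_assoc, Rinv_l by lra. lra.
- destruct (Rle_dec 0 (/ K)) as [H|H]; [|lra].
  destruct (Rle_lt_or_eq_dec 0 (/ K) H); [auto|lra].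
- auto.
Qed.

(** The norm equivalence in [dual_via] ranges over all analytic [h] whose pairings with [X] exist,
    so it can be applied to the symbol before the symbol is known to lie in [Y]. The functional
    [L_h] is then the evaluation of [T_g] at [z], because the pairing is unique. *)
Lemma dual_pairing_criterion (beta : nat -> R) (X Y : banach_of_analytic) (g : C -> C) :
  analytic g -> (forall n, 0 < beta n) ->
  is_lim_seq (fun n => Rpower (beta n) (/ INR n)) 1 ->
  dual_via beta X Y ->
  (volterra_bounded_to in_Hinf X g <->
   exists M : R, forall z, unit_disc z -> Rbar_le (ext_norm Y (sym_G beta g z)) M).
Proof.
intros Hg Hb Hl [_ [[K [HK HKe]] _]].
assert (Hp : forall (x : X) z, unit_disc z ->
   is_pairing beta (fn x) (sym_G beta g z) (volterra g (fn x) z)).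
{ intros x z Hz. apply volterra_pairing; auto. apply fn_analytic. }
assert (HG : forall z, unit_disc z ->
   Rbar_le (Rbar_mult (/ K)%R (ext_norm Y (sym_G beta g z)))
      (op_norm (fun x : X => volterra g (fn x) z)) /\
   Rbar_le (op_norm (fun x : X => volterra g (fn x) z))
      (Rbar_mult K (ext_norm Y (sym_G beta g z)))).
{ intros z Hz.
  replace (fun x : X => volterra g (fn x) z)
    with (fun x : X => pairing beta (fn x) (sym_G beta g z)).
  - apply HKe.
    + eapply taylor_analytic, taylor_sym_G; auto.
    + intros x. eexists. now apply Hp.
  - apply functional_extensionality. intros x. now apply pairing_eq, Hp. }
rewrite volterra_bounded_to_Hinf by auto. split.
- intros [M [HM0 HM]]. exists (K * M). intros z Hz.
  apply Rbar_mult_le_finite; auto.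
  eapply Rbar_le_trans; [apply HG, Hz|].
  apply Lub_Rbar_correct. intros t [x [Hx ->]]. simpl.
  eapply Rle_trans; [now apply HM|]. nra.
- intros [M HM]. exists (K * Rmax M 0). split.
  { apply Rmult_le_pos; [lra|apply Rmax_r]. }
  intros x z Hz. revert x.
  apply (homogeneous_bound X (fun x : X => volterra g (fn x) z)).
  + intros c x. now apply volterra_scal.
  + intros x Hx.
    assert (H1 : Rbar_le (Cmod (volterra g (fn x) z)) (op_norm (fun x : X => volterra g (fn x) z))).
    { apply Lub_Rbar_correct. now exists x. }
    assert (H2 := Rbar_le_trans _ _ _ H1 (proj2 (HG z Hz))).
    assert (H3 := HM z Hz). assert (H4 := ext_norm_ge_0 Y (sym_G beta g z)).
    destruct (ext_norm Y (sym_G beta g z)) as [e| |]; simpl in *; try tauto.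
    eapply Rle_trans; [exact H2|]. apply Rmult_le_compat_l; [lra|].
    eapply Rle_trans; [exact H3|apply Rmax_l].
Qed.

(** * Ultralimits and reflexivity *)

(** Maximality is recorded in the form needed below: every set or its complement belongs to [U]. *)
Lemma ultrafilter_extension {T : Type} (F : (T -> Prop) -> Prop) :
  ProperFilter F ->
  exists U : (T -> Prop) -> Prop, ProperFilter U /\ filter_le U F /\
    forall P, U P \/ U (fun x => ~ P x).
Proof.
intros HF.
destruct (@filter.ultraFilterLemma T F) as [U [HU HFU]].
{ constructor.
  - intros H. apply filter_ex in H. now destruct H.
  - constructor.
    + apply filter_true.
    + intros P Q. apply filter_and.
    + intros P Q HPQ. apply filter_imp. exact HPQ. }
exists U. destruct HU as [[Hn [HT HI HS]] Hmax] eqn:E; clear E. split; [|split].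
- constructor.
  + intros P HP. apply NNPP. intros Hne. apply Hn.
    revert HP. apply HS. intros x Hx. apply Hne. now exists x.
  + constructor; auto.
- intros P HP. now apply HFU.
- intros P. exact (@filter.in_ultra_setVsetC T U P HU).
Qed.

(** The limit is the supremum of the [y] such that [y <= u] holds on a member of [U]; since [U]
    decides every set, [u] is within [eps] of it on both sides. *)
Lemma R_ultra_lim {T : Type} (U : (T -> Prop) -> Prop) (u : T -> R) (B : R) :
  ProperFilter U -> (forall P, U P \/ U (fun x => ~ P x)) ->
  U (fun x => Rabs (u x) <= B) ->
  exists l, forall eps, 0 < eps -> U (fun x => Rabs (u x - l) < eps).
Proof.
intros HU HUP HB.
destruct (completeness (fun y => U (fun x => y <= u x))) as [l [Hub Hlub]].
- exists B. intros y Hy. destruct (filter_ex _ (filter_and _ _ HB Hy)) as [x [H1 H2]].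
  generalize (Rle_abs (u x)). lra.
- exists (- B). revert HB. apply filter_imp. intros x Hx.
  generalize (Rle_abs (- u x)). rewrite Rabs_Ropp. lra.
- exists l. intros eps Heps.
  assert (H1 : U (fun x => l - eps < u x)).
  { destruct (HUP (fun x => l - eps / 2 <= u x)) as [H|H].
    - revert H. apply filter_imp. intros x Hx. lra.
    - exfalso. assert (l <= l - eps / 2); [|lra].
      apply Hlub. intros y Hy. destruct (filter_ex _ (filter_and _ _ H Hy)) as [x [Hx1 Hx2]]. lra. }
  assert (H2 : U (fun x => u x < l + eps)).
  { destruct (HUP (fun x => l + eps <= u x)) as [H|H].
    - apply Hub in H. lra.
    - revert H. apply filter_imp. intros x Hx. lra. }
  generalize (filter_and _ _ H1 H2). apply filter_imp. intros x [Hx1 Hx2].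
  apply Rabs_def1; lra.
Qed.

Lemma C_ultra_lim {T : Type} (U : (T -> Prop) -> Prop) (f : T -> C) (B : R) :
  ProperFilter U -> (forall P, U P \/ U (fun x => ~ P x)) ->
  U (fun x => Cmod (f x) <= B) -> exists l, filterlim f U (C_locally l).
Proof.
intros HU HUP HB.
assert (Him : forall c, Rabs (Im c) <= Cmod c).
{ intros c. eapply Rle_trans; [apply Rmax_r|apply (Rmax_Cmod c)]. }
destruct (R_ultra_lim U (fun x => Re (f x)) B HU HUP) as [a Ha].
{ revert HB. apply filter_imp. intros x Hx. eapply Rle_trans; [apply re_le_Cmod|exact Hx]. }
destruct (R_ultra_lim U (fun x => Im (f x)) B HU HUP) as [b Hb].
{ revert HB. apply filter_imp. intros x Hx. eapply Rle_trans; [apply Him|exact Hx]. }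
exists (a, b). apply C_filterlim_eps; [apply HU|]. intros eps Heps.
assert (He : 0 < eps / 2) by lra.
generalize (filter_and _ _ (Ha _ He) (Hb _ He)). apply filter_imp.
intros x [H1 H2].
replace (f x - (a, b))%C with (RtoC (Re (f x) - a) + Ci * RtoC (Im (f x) - b))%C.
- eapply Rle_lt_trans; [apply Cmod_triangle|].
  rewrite Cmod_mult, Cmod_Ci, !Cmod_R. lra.
- unfold Cminus, Cplus, Copp, Cmult, Ci, RtoC, Re, Im; simpl; f_equal; ring.
Qed.

Lemma C_filterlim_unique {T : Type} (F : (T -> Prop) -> Prop) {FF : ProperFilter F}
    (f : T -> C) (l1 l2 : C) :
  filterlim f F (C_locally l1) -> filterlim f F (C_locally l2) -> l1 = l2.
Proof. apply (filterlim_locally_unique (V := C_NormedModule)). Qed.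

Lemma C_filterlim_Cmod_le {T : Type} (F : (T -> Prop) -> Prop) {FF : ProperFilter F}
    (f : T -> C) (l : C) (K : R) :
  filterlim f F (C_locally l) -> F (fun x => Cmod (f x) <= K) -> Cmod l <= K.
Proof.
intros Hl HK. apply le_epsilon. intros e He.
destruct (filter_ex _ (filter_and _ _ HK (proj1 (C_filterlim_eps F f l) Hl e He))) as [x [H1 H2]].
replace l with (f x + - (f x - l))%C by ring.
eapply Rle_trans; [apply Cmod_triangle|]. rewrite Cmod_opp. lra.
Qed.

(** Let [l] be the limit along one ultrafilter finer than [F]. If [f] did not tend to [l] along [F],
    for some [eps] the set [|f - l| >= eps] would meet every member of [F], and an ultrafilter
    containing that set would give a different limit. Existence of a limit is thereby reduced to the
    vanishing of a difference of ultralimits, which is linear in the function. *)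
Lemma C_filterlim_of_ultra {T : Type} (F : (T -> Prop) -> Prop) {FF : ProperFilter F}
    (f : T -> C) (B : R) :
  F (fun x => Cmod (f x) <= B) ->
  (forall (U1 U2 : (T -> Prop) -> Prop) (l1 l2 : C),
     ProperFilter U1 -> ProperFilter U2 -> filter_le U1 F -> filter_le U2 F ->
     (forall P, U1 P \/ U1 (fun x => ~ P x)) -> (forall P, U2 P \/ U2 (fun x => ~ P x)) ->
     filterlim f U1 (C_locally l1) -> filterlim f U2 (C_locally l2) -> l1 = l2) ->
  exists l, filterlim f F (C_locally l).
Proof.
intros HB Heq.
destruct (ultrafilter_extension F FF) as [U [HU [HUF HUP]]].
destruct (C_ultra_lim U f B HU HUP (HUF _ HB)) as [l Hl].
exists l. apply C_filterlim_eps; [apply FF|]. intros eps Heps. apply NNPP. intros Hn.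
set (D := fun x => eps <= Cmod (f x - l)).
assert (HF' : ProperFilter (within D F)).
{ constructor; [|apply within_filter, FF].
  intros P HP. apply NNPP. intros Hne. apply Hn. unfold within in HP.
  revert HP. apply filter_imp.
  intros x Hx. apply Rnot_le_lt. intros Hle. apply Hne. exists x. now apply Hx. }
destruct (ultrafilter_extension _ HF') as [V [HV [HVF HVP]]].
assert (HVF' : filter_le V F).
{ intros P HP. apply HVF. unfold within. revert HP. apply filter_imp. auto. }
destruct (C_ultra_lim V f B HV HVP (HVF' _ HB)) as [l' Hl'].
assert (El : l = l') by (apply (Heq U V); auto). subst l'.
assert (HVD : V D) by (apply HVF; unfold within; apply filter_forall; auto).
destruct (filter_ex _ (filter_and _ _ HVD (proj1 (C_filterlim_eps V f l) Hl' eps Heps)))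
  as [x [H1 H2]].
unfold D in H1. lra.
Qed.

Lemma op_norm_bound (X : banach_of_analytic) (L : X -> C) :
  in_dual X L -> exists m : R, op_norm L = Finite m /\ forall x : X, Cmod (L x) <= m * norm x.
Proof.
intros [Hp Hs [M [HM HLM]]].
assert (H1 : Rbar_le 0 (op_norm L)).
{ apply Rbar_le_trans with (Cmod (L zero)); [apply Cmod_ge_0|].
  apply Lub_Rbar_correct. exists zero. split; auto. eapply Rle_trans; [right; apply (@norm_zero C_AbsRing X)|lra]. }
assert (H2 : Rbar_le (op_norm L) M).
{ apply Lub_Rbar_correct. intros t [x [Hx ->]]. simpl.
  eapply Rle_trans; [apply (HLM x)|]. nra. }
destruct (op_norm L) as [m| |] eqn:E; simpl in *; try tauto.
exists m. split; auto.
apply (homogeneous_bound X L m); [exact Hs|].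
intros x Hx. assert (H : Rbar_le (Cmod (L x)) (op_norm L)).
{ apply Lub_Rbar_correct. now exists x. }
now rewrite E in H.
Qed.

(* Any ultralimit of a bounded sequence of X defines an element of the bidual, which
   by reflexivity is an element of X; point evaluations identify it with [x]. *)
Lemma reflexive_pointwise_limit (X : banach_of_analytic) (u : nat -> X) (x : X) (B : R)
    (L : X -> C) (c : C) :
  reflexive X ->
  (forall z, unit_disc z -> in_dual X (fun y => fn y z)) ->
  (forall n, norm (u n) <= B) ->
  (forall z, unit_disc z ->
     filterlim (fun n => fn (u n) z) eventually (C_locally (fn x z))) ->
  in_dual X L -> (forall n, L (u n) = c) -> L x = c.
Proof.
intros Hrefl Hev HB Hlim HL Hc.
destruct (ultrafilter_extension eventually eventually_filter) as [U [HU [HUe HUP]]].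
(* [iota] makes [Phi] total; on the dual, where the sequence [L (u n)] is bounded, its value is a
   true ultralimit. *)
set (Phi := fun L : X -> C =>
  @iota C_CompleteNormedModule (fun l => filterlim (fun n => L (u n)) U (C_locally l))).
assert (HB0 : 0 <= B) by
  exact (Rle_trans _ _ _ (@norm_ge_0 C_AbsRing X (u 0%nat)) (HB 0%nat)).
assert (HPhi : forall L l, filterlim (fun n => L (u n)) U (C_locally l) -> Phi L = l).
{ intros L' l Hl. apply (@iota_unique C_AbsRing C_CompleteNormedModule); auto.
  intros y Hy. exact (C_filterlim_unique U _ y l Hy Hl). }
assert (HPhiL : forall L, in_dual X L -> filterlim (fun n => L (u n)) U (C_locally (Phi L))).
{ intros L' HL'. destruct (op_norm_bound X L' HL') as [m [Em Hm]].
  destruct (C_ultra_lim U (fun n => L' (u n)) (Rabs m * B) HU HUP) as [l Hl].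
  - apply filter_forall. intros n. eapply Rle_trans; [apply Hm|].
    apply Rle_trans with (Rabs m * norm (u n)).
    + apply Rmult_le_compat_r; [apply (@norm_ge_0 C_AbsRing X)|apply Rle_abs].
    + apply Rmult_le_compat_l; [apply Rabs_pos|apply HB].
  - now rewrite (HPhi _ _ Hl). }
destruct (Hrefl Phi) as [y Hy].
- intros L1 L2 H1 H2. apply HPhi. apply C_filterlim_plus; auto. apply HU.
- intros k L1 H1. apply HPhi. apply C_filterlim_mult; auto; [apply HU|apply filterlim_const].
- exists B. split; auto. intros L1 H1. destruct (op_norm_bound X L1 H1) as [m [Em Hm]].
  rewrite Em. simpl.
  apply (C_filterlim_Cmod_le U _ _ _ (HPhiL L1 H1)). apply filter_forall. intros n.
  eapply Rle_trans; [apply Hm|]. rewrite Rmult_comm.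
  assert (0 <= m).
  { assert (H : Rbar_le (Cmod (L1 zero)) (op_norm L1)).
    { apply Lub_Rbar_correct. exists zero. split; auto. eapply Rle_trans; [right; apply (@norm_zero C_AbsRing X)|lra]. }
    rewrite Em in H. simpl in H. eapply Rle_trans; [apply Cmod_ge_0|exact H]. }
  apply Rmult_le_compat_r; auto.
- assert (Exy : y = x).
  { apply fn_inj. intros z Hz. rewrite <- (Hy (fun y => fn y z) (Hev z Hz)).
    apply HPhi. eapply filterlim_filter_le_1; [apply HUe|]. now apply Hlim. }
  rewrite <- Exy, <- (Hy L HL). apply HPhi.
  eapply filterlim_ext; [|apply filterlim_const]. intros n; simpl. now rewrite Hc.
Qed.

(** * Boundary limits *)

Lemma analytic_bounded_smaller (f : C -> C) (r : R) : analytic f -> 0 <= r < 1 ->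
  exists B, 0 <= B /\ forall z, Cmod z <= r -> Cmod (f z) <= B.
Proof.
intros Hf Hr. destruct (analytic_taylor f Hf) as [a Ha].
set (s := (r + 1) / 2). assert (Hs : r < s < 1) by (unfold s; lra).
destruct (taylor_bound f a s Ha ltac:(lra)) as [A [HA HaA]].
assert (Hq : 0 <= r / s < 1) by (apply ratio_lt_1; lra).
destruct (ex_series_geom_bound (r / s) A Hq) as [S HS].
assert (HB : forall z, Cmod z <= r -> Cmod (f z) <= S).
{ intros z Hz.
  apply (C_series_le (fun n => a n * z ^ n)%C (fun n => A * (r / s) ^ n)); auto.
  - intros n. rewrite Cmod_mult, Cmod_pow.
    assert (Hsn : 0 < s ^ n) by (apply pow_lt; lra).
    apply Rle_trans with (Cmod (a n) * r ^ n).
    + apply Rmult_le_compat_l; [apply Cmod_ge_0|]. apply pow_incr. split; auto. apply Cmod_ge_0.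
    + unfold Rdiv. rewrite Rpow_mult_distr, pow_inv.
      apply Rmult_le_reg_r with (s ^ n); auto.
      replace (A * (r ^ n * / s ^ n) * s ^ n) with (A * r ^ n) by (field; lra).
      replace (Cmod (a n) * r ^ n * s ^ n) with (Cmod (a n) * s ^ n * r ^ n) by ring.
      apply Rmult_le_compat_r; auto. apply pow_le; lra.
  - apply (proj1 (C_is_pseries _ _ _)). apply Ha. unfold unit_disc. lra. }
exists S. split; auto. eapply Rle_trans; [apply Cmod_ge_0|apply (HB 0%C)]. rewrite Cmod_0. lra.
Qed.

Lemma disc_scaled (c z : C) : Cmod c <= 1 -> unit_disc z -> unit_disc (c * z)%C.
Proof.
unfold unit_disc. intros Hc Hz. rewrite Cmod_mult. generalize (Cmod_ge_0 c) (Cmod_ge_0 z). nra.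
Qed.

Lemma is_derive_scaled (f : C -> C) (c z : C) : analytic f -> Cmod c <= 1 -> unit_disc z ->
  C_is_derive (fun w => f (c * w)%C) z (c * C_derive f (c * z))%C.
Proof.
intros Hf Hc Hz.
apply (C_is_derive_comp f (fun w => c * w)%C).
- apply analytic_is_derive; auto. now apply disc_scaled.
- rewrite <- (Cmult_1_r c) at 1. apply (C_is_derive_scal c (fun w => w)), C_is_derive_id.
Qed.

Lemma continuous_scaled (f : C -> C) (c z : C) : analytic f -> unit_disc (c * z)%C ->
  C_continuous (fun w => f (c * w)%C) z.
Proof.
intros Hf Hz. eapply filterlim_comp.
- apply C_filterlim_mult; [apply locally_filter|apply filterlim_const|apply filterlim_id].
- now apply analytic_continuous.
Qed.

Lemma analytic_scaled (f : C -> C) (c : C) : analytic f -> Cmod c <= 1 ->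
  analytic (fun z => f (c * z)%C).
Proof.
intros Hf Hc. apply (holomorphic_analytic _ (fun z => c * C_derive f (c * z))%C).
- intros z Hz. now apply is_derive_scaled.
- intros z Hz. apply C_continuous_mult; [apply filterlim_const|].
  apply continuous_scaled; [now apply analytic_derive|now apply disc_scaled].
Qed.

(** The approach to [zeta] is unrestricted inside the disc, neither radial nor nontangential, as
    continuity on the closed disc requires. *)
Definition boundary_filter (zeta : C) : (C -> Prop) -> Prop :=
  within unit_disc (C_locally zeta).

Lemma boundary_filter_eps (zeta : C) (P : C -> Prop) :
  boundary_filter zeta P <->
  exists d, 0 < d /\ forall z, Cmod (z - zeta) < d -> unit_disc z -> P z.
Proof. apply (C_locally_eps zeta (fun z => unit_disc z -> P z)). Qed.

Global Instance boundary_filter_filter (zeta : C) : Filter (boundary_filter zeta).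
Proof. apply within_filter, locally_filter. Qed.

Lemma boundary_filter_proper (zeta : C) : Cmod zeta = 1 -> ProperFilter (boundary_filter zeta).
Proof.
intros Hz. constructor; [|apply boundary_filter_filter].
intros P HP. apply boundary_filter_eps in HP. destruct HP as [d [Hd HP]].
set (e := Rmin 1 d / 2).
assert (He : 0 < e < 1 /\ e < d).
{ unfold e. assert (0 < Rmin 1 d) by (apply Rmin_glb_lt; lra).
  generalize (Rmin_l 1 d) (Rmin_r 1 d). lra. }
exists ((1 - e)%R * zeta)%C. apply HP.
- replace ((1 - e)%R * zeta - zeta)%C with (- (e * zeta))%C by (rewrite RtoC_minus; ring).
  rewrite Cmod_opp, Cmod_mult, Hz, Cmod_R, Rabs_pos_eq; lra.
- unfold unit_disc. rewrite Cmod_mult, Hz, Cmod_R, Rabs_pos_eq; lra.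
Qed.

Lemma lipschitz_boundary_limit (Q : C -> C) (B : R) (zeta : C) :
  Cmod zeta = 1 -> 0 <= B ->
  (forall z w, unit_disc z -> unit_disc w -> Cmod (Q z - Q w) <= B * Cmod (z - w)) ->
  exists l, filterlim Q (boundary_filter zeta) (C_locally l).
Proof.
intros Hzeta HB HQ. assert (HP := boundary_filter_proper zeta Hzeta).
apply (filterlim_locally_cauchy (U := C_CompleteNormedModule) (F := boundary_filter zeta) Q).
intros eps. set (d := eps / (2 * (B + 1))).
assert (Hd : 0 < d) by (unfold d; apply Rdiv_lt_0_compat; [apply cond_pos|lra]).
exists (fun z => unit_disc z /\ Cmod (z - zeta) < d). split.
- apply boundary_filter_eps. exists d. split; auto.
- intros u v [Hu Hud] [Hv Hvd].
  apply C_NormedModule_mixin_compat1. change (Cmod (Q v - Q u) < eps).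
  eapply Rle_lt_trans; [now apply HQ|].
  assert (Huv : Cmod (v - u) < 2 * d).
  { replace (v - u)%C with ((v - zeta) + - (u - zeta))%C by ring.
    eapply Rle_lt_trans; [apply Cmod_triangle|]. rewrite Cmod_opp. lra. }
  apply Rle_lt_trans with (B * (2 * d)); [apply Rmult_le_compat_l; lra|].
  replace (pos eps) with ((B + 1) * (2 * d)) by (unfold d; field; lra). nra.
Qed.

(* Integration by parts: T_g u = u g - u(0) g(0) - \int u' g for u = f_r, and the last
   integral is Lipschitz on the disc because u' g is bounded. *)
Lemma volterra_dilate_limit (f g : C -> C) (r G : R) (zeta : C) :
  analytic f -> analytic g -> (forall z, unit_disc z -> Cmod (g z) <= G) ->
  0 < r < 1 -> Cmod zeta = 1 ->
  exists l, filterlim (fun z => volterra g (dilate r f) z - f (r * zeta)%C * g z)%C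
    (boundary_filter zeta) (C_locally l).
Proof.
intros Hf Hg HG Hr Hzeta.
assert (HG0 : 0 <= G) by (eapply Rle_trans; [apply Cmod_ge_0|apply (HG 0%C disc_0)]).
assert (Hrm : Cmod r = r) by (rewrite Cmod_R; apply Rabs_pos_eq; lra).
assert (Hr1 : Cmod r <= 1) by lra.
assert (Hu : analytic (dilate r f)) by (apply analytic_scaled; auto).
set (q := fun z => (r * C_derive f (r * z) * g z)%C).
assert (Hq : analytic q).
{ apply analytic_mult; auto. apply analytic_mult; [apply analytic_const|].
  apply analytic_scaled; auto. now apply analytic_derive. }
assert (HQd := fun z => int0_is_derive q z Hq).
destruct (analytic_bounded_smaller (C_derive f) r (analytic_derive f Hf) ltac:(lra))
  as [B [HB HfB]].
destruct (lipschitz_boundary_limit (int0 q) (B * G) zeta Hzeta) as [l Hl].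
{ now apply Rmult_le_pos. }
{ intros z w Hz Hw. apply (C_mean_value (int0 q) q); auto.
  - intros x Hx. now apply analytic_continuous.
  - intros x Hx. unfold q. rewrite !Cmod_mult, Hrm.
    apply Rmult_le_compat; auto using Cmod_ge_0.
    + apply Rmult_le_pos; [lra|apply Cmod_ge_0].
    + assert (Hrx : Cmod (r * x) <= r).
      { unfold unit_disc in Hx. rewrite Cmod_mult, Hrm. nra. }
      specialize (HfB _ Hrx). generalize (Cmod_ge_0 (C_derive f (r * x))). nra. }
(* The summand 0 is the limit of [(f_r(z) - f(r zeta)) g(z)]: [r zeta] is interior, so [f_r] is
   continuous at [zeta], and [g] is bounded. *)
exists (0 + (- (dilate r f 0 * g 0) + - l))%C.
assert (E : forall z, unit_disc z ->
  volterra g (dilate r f) z =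
  (dilate r f z * g z + (- (dilate r f 0 * g 0) + - int0 q z))%C).
{ intros z Hz. unfold volterra.
  rewrite (int0_primitive _ (fun z => dilate r f z * g z - int0 q z)%C); auto.
  - rewrite int0_0. ring.
  - apply analytic_mult; auto. now apply analytic_derive.
  - intros x Hx.
    replace (dilate r f x * C_derive g x)%C with
      ((r * C_derive f (r * x)) * g x + dilate r f x * C_derive g x - q x)%C
      by (unfold q; ring).
    apply C_is_derive_minus; auto.
    apply C_is_derive_mult; [now apply is_derive_scaled|now apply analytic_is_derive]. }
apply (filterlim_ext_loc (fun z => (dilate r f z - f (r * zeta)) * g z +
   (- (dilate r f 0 * g 0) + - int0 q z))%C).
{ apply boundary_filter_eps. exists 1. split; [lra|]. intros z _ Hz. rewrite E by auto. ring. }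
apply C_filterlim_plus; [apply boundary_filter_filter| |].
- apply C_filterlim_eps; [apply boundary_filter_filter|]. intros eps Heps.
  assert (Hc : C_continuous (dilate r f) zeta).
  { apply continuous_scaled; auto. unfold unit_disc. rewrite Cmod_mult, Hzeta. lra. }
  rewrite C_continuous_eps in Hc.
  destruct (Hc (eps / (G + 1)) ltac:(apply Rdiv_lt_0_compat; lra)) as [d [Hd Hc']].
  apply boundary_filter_eps. exists d. split; auto. intros z Hz Hzd.
  specialize (Hc' z Hz). unfold dilate at 2 in Hc'.
  replace ((dilate r f z - f (r * zeta)) * g z - 0)%C
    with ((dilate r f z - f (r * zeta)) * g z)%C by ring.
  rewrite Cmod_mult. specialize (HG z Hzd).
  apply Rle_lt_trans with (eps / (G + 1) * G).
  + apply Rmult_le_compat; auto using Cmod_ge_0. lra.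
  + apply Rmult_lt_reg_r with (G + 1); [lra|].
    replace (eps / (G + 1) * G * (G + 1)) with (eps * G) by (field; lra). nra.
- apply C_filterlim_plus; [apply boundary_filter_filter|apply filterlim_const|].
  apply C_filterlim_opp; auto. apply boundary_filter_filter.
Qed.

(** * A bounded analytic function without radial limit at 1 *)

(* Taylor coefficients of [(1 - z)^i]. *)
Fixpoint osc_coeff (n : nat) : C :=
  match n with
  | O => 1%C
  | S m => ((INR m - Ci) / INR (S m) * osc_coeff m)%C
  end.

Definition osc (z : C) : C := C_Series (fun n => osc_coeff n * z ^ n)%C.

Lemma osc_coeff_succ (n : nat) :
  (INR (S n) * osc_coeff (S n) = (INR n - Ci) * osc_coeff n)%C.
Proof.
assert (Hn := RtoC_INR_S_neq_0 n).
change (osc_coeff (S n)) with ((INR n - Ci) / INR (S n) * osc_coeff n)%C. field. exact Hn.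
Qed.

(** Since [|n - i| <= n + 1], the modulus does not increase from one coefficient to the next. *)
Lemma osc_coeff_le (n : nat) : Cmod (osc_coeff n) <= 1.
Proof.
induction n as [|n IH]; [simpl; rewrite Cmod_1; lra|].
assert (Hn : 0 < INR (S n)) by (apply lt_0_INR; lia).
assert (H : Cmod (INR (S n) * osc_coeff (S n)) = INR (S n) * Cmod (osc_coeff (S n))).
{ rewrite Cmod_mult, Cmod_R, Rabs_pos_eq; lra. }
rewrite osc_coeff_succ, Cmod_mult in H.
apply Rmult_le_reg_l with (INR (S n)); auto. rewrite <- H.
apply Rmult_le_compat; auto using Cmod_ge_0.
replace (INR n - Ci)%C with (RtoC (INR n) + - Ci)%C by ring.
eapply Rle_trans; [apply Cmod_triangle|].
rewrite Cmod_opp, Cmod_Ci, Cmod_R, Rabs_pos_eq, S_INR by apply pos_INR. lra.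
Qed.

Lemma osc_taylor : taylor osc osc_coeff.
Proof.
intros z Hz. apply (proj2 (C_is_pseries _ _ _)).
apply C_Series_correct, (C_ex_pseries_bound osc_coeff 1 1); auto.
intros n. rewrite pow1, Rmult_1_r. apply osc_coeff_le.
Qed.

Lemma osc_analytic : analytic osc.
Proof. eapply taylor_analytic, osc_taylor. Qed.

Lemma osc_0 : osc 0%C = 1%C.
Proof. apply C_Series_unique. apply (C_is_series_at_0 osc_coeff). Qed.

(** The recurrence of the coefficients, read as the differential equation of [(1 - z)^i]. With
    [osc 0 = 1] it yields the bound and the values on the radius without a complex logarithm. *)
Lemma osc_ode (z : C) : unit_disc z -> ((1 - z) * C_derive osc z = - Ci * osc z)%C.
Proof.
intros Hz.
assert (H1 := proj1 (C_is_pseries _ _ _) (taylor_derive osc _ osc_taylor z Hz)).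
assert (H0 := proj1 (C_is_pseries _ _ _) (osc_taylor z Hz)).
assert (H2 : C_is_series (fun n => INR n * osc_coeff n * z ^ n)%C (z * C_derive osc z)%C).
{ apply C_is_series_decr; [simpl; ring|].
  eapply C_is_series_ext; [|apply (C_is_series_scal z _ _ H1)].
  intros n. cbv beta. rewrite Cpow_S. ring. }
replace ((1 - z) * C_derive osc z)%C with (C_derive osc z - z * C_derive osc z)%C by ring.
eapply C_is_series_unique.
- apply (C_is_series_minus _ _ _ _ H1 H2).
- eapply C_is_series_ext; [|apply (C_is_series_scal (- Ci)%C _ _ H0)].
  intros n. cbv beta. rewrite osc_coeff_succ. ring.
Qed.

Lemma ray_denominator (x y t : R) : unit_disc (x, y) -> 0 <= t <= 1 ->
  0 < 1 - t * x.
Proof.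
intros Hz Ht. assert (Hx : Rabs x < 1).
{ eapply Rle_lt_trans; [apply (re_le_Cmod (x, y))|exact Hz]. }
apply Rabs_def2 in Hx. nra.
Qed.

(** With [z = x + i y], the number [al + i be] is [- i z / (1 - t z)] and [d = |1 - t z|^2]: this is
    the differential equation along the ray to [z], split into real and imaginary parts. *)
Lemma osc_ray_derive (x y t : R) : unit_disc (x, y) -> 0 <= t <= 1 ->
  let d := (1 - t * x) ^ 2 + (t * y) ^ 2 in
  let al := y / d in
  let be := - (x - t * (x ^ 2 + y ^ 2)) / d in
  let p := fun s : R => Re (osc (s * (x, y))%C) in
  let q := fun s : R => Im (osc (s * (x, y))%C) in
  is_derive p t (al * p t - be * q t) /\ is_derive q t (al * q t + be * p t).
Proof.
intros Hz Ht d al be p q.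
assert (Hx := ray_denominator x y t Hz Ht).
assert (Hd : 0 < d) by (unfold d; generalize (pow2_ge_0 (t * y)) (pow_lt _ 2 Hx); lra).
assert (Htz := disc_segment _ t Hz Ht).
assert (Hp : path_derive (fun s => osc (0 + s * (x, y))%C) t
   ((al, be) * osc (t * (x, y)))%C).
{ replace ((al, be) * osc (t * (x, y)))%C with (C_derive osc (t * (x, y)) * (x, y))%C.
  - apply (path_derive_comp osc (fun s => 0 + s * (x, y))%C).
    + replace (0 + t * (x, y))%C with (t * (x, y))%C by ring.
      apply analytic_is_derive; auto. apply osc_analytic.
    + apply path_derive_line.
  - assert (H0 : (1 - t * (x, y))%C <> 0%C).
    { intros H. apply (f_equal Re) in H. unfold Re, Cminus, Cplus, Copp, Cmult, RtoC in H.
      simpl in H. lra. }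
    assert (Hode := osc_ode _ Htz).
    assert (E : ((al, be) * (1 - t * (x, y)) = - Ci * (x, y))%C).
    { unfold al, be, d in *.
      unfold Cminus, Cplus, Copp, Cmult, RtoC, Ci; simpl. f_equal; field; simpl in Hd; lra. }
    replace (C_derive osc (t * (x, y)))%C
      with (/ (1 - t * (x, y)) * ((1 - t * (x, y)) * C_derive osc (t * (x, y))))%C
      by (field; auto).
    rewrite Hode.
    replace (/ (1 - t * (x, y)) * (- Ci * osc (t * (x, y))) * (x, y))%C
      with (/ (1 - t * (x, y)) * (- Ci * (x, y)) * osc (t * (x, y)))%C by ring.
    rewrite <- E. field. auto. }
assert (Hp' : path_derive (fun s => osc (s * (x, y))%C) t ((al, be) * osc (t * (x, y)))%C).
{ eapply is_derive_ext; [|apply Hp]. intros s. simpl. f_equal. ring. }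
split.
- apply Re_path_derive in Hp'. exact Hp'.
- assert (Hq : path_derive (fun s => - Ci * osc (s * (x, y)))%C t
    (- Ci * ((al, be) * osc (t * (x, y))))%C).
  { replace (- Ci * ((al, be) * osc (t * (x, y))))%C with
      ((- Ci * 1) * ((al, be) * osc (t * (x, y))))%C by ring.
    apply (path_derive_comp (fun w => - Ci * w)%C (fun s => osc (s * (x, y))%C)); auto.
    apply C_is_derive_scal, C_is_derive_id. }
  apply Re_path_derive in Hq.
  replace (al * q t + be * p t) with (Re (- Ci * ((al, be) * osc (t * (x, y)))))
    by (unfold p, q, Re, Im, Cmult, Copp, Ci; simpl; ring).
  eapply is_derive_ext; [|apply Hq].
  intros s. unfold q, Re, Im, Cmult, Copp, Ci; simpl. ring.
Qed.

(** [|(1 - z)^i| = exp(- arg(1 - z))], and the argument lies strictly between [- PI/2] and [PI/2]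
    because [1 - z] has positive real part. Along the ray [F] is [|osc|^2 exp(2 arg)], with the
    argument written as an arctangent; its derivative vanishes and its value at 0 is 1. This bounds
    [|osc|^2] by [exp PI], and the same constant, being larger than 1, bounds [|osc|]. *)
Lemma osc_bound (z : C) : unit_disc z -> Cmod (osc z) <= exp PI.
Proof.
destruct z as [x y]. intros Hz.
set (p := fun s : R => Re (osc (s * (x, y))%C)).
set (q := fun s : R => Im (osc (s * (x, y))%C)).
set (F := fun s => (p s ^ 2 + q s ^ 2) * exp (2 * atan (- (s * y) / (1 - s * x)))).
assert (HF : F 0 = F 1).
{ apply (eq_is_derive (V := R_NormedModule) F 0 1); [|lra]. intros t Ht.
  assert (Hx := ray_denominator x y t Hz Ht).
  destruct (osc_ray_derive x y t Hz Ht) as [Hp Hq].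
  set (d := (1 - t * x) ^ 2 + (t * y) ^ 2) in *.
  set (be := - (x - t * (x ^ 2 + y ^ 2)) / d) in *.
  change (is_derive p t (y / d * p t - be * q t)) in Hp.
  change (is_derive q t (y / d * q t + be * p t)) in Hq.
  assert (Hd : 0 < d) by (unfold d; generalize (pow2_ge_0 (t * y)) (pow_lt _ 2 Hx); lra).
  assert (Hat : is_derive (fun s => exp (2 * atan (- (s * y) / (1 - s * x)))) t
     (exp (2 * atan (- (t * y) / (1 - t * x))) * (2 * (- y / d)))).
  { rewrite Rmult_comm. apply (is_derive_comp exp); [apply is_derive_exp|].
    auto_derive; [lra|]. unfold d in *. field.
    split; lra. }
  unfold F.
  evar_last.
  - apply (is_derive_mult (fun s => p s ^ 2 + q s ^ 2)); [|exact Hat|apply Rmult_comm].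
    apply (is_derive_plus (V := R_NormedModule)).
    + apply (is_derive_pow p 2 t _ Hp).
    + apply (is_derive_pow q 2 t _ Hq).
  - unfold plus, mult, zero; simpl. field. lra. }
assert (E0 : F 0 = 1).
{ unfold F, p, q. rewrite Cmult_0_l. rewrite osc_0.
  replace (- (0 * y) / (1 - 0 * x)) with 0 by (field; lra). rewrite atan_0, Rmult_0_r, exp_0.
  unfold Re, Im; simpl. ring. }
assert (E1 : F 1 = Cmod (osc (x, y)) ^ 2 * exp (2 * atan (- (1 * y) / (1 - 1 * x)))).
{ unfold F, p, q. now rewrite Cmult_1_l, Cmod2_alt. }
assert (Hat : exp (- PI) < exp (2 * atan (- (1 * y) / (1 - 1 * x)))).
{ apply exp_increasing. destruct (atan_bound (- (1 * y) / (1 - 1 * x))) as [H _]. lra. }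
rewrite exp_Ropp in Hat.
assert (HPI : 1 < exp PI) by (rewrite <- exp_0; apply exp_increasing, PI_RGT_0).
apply Rnot_lt_le. intros Hlt.
assert (Hsq : exp PI < Cmod (osc (x, y)) ^ 2) by nra.
assert (Hi : 0 < / exp PI) by (apply Rinv_0_lt_compat; lra).
assert (exp PI * / exp PI = 1) by (field; lra).
nra.
Qed.

(** [F + i G] is the product of [osc(s r)] with [exp(- i ln(1 - s r))]; it is constant in [s] and
    equals 1 at [s = 0]. *)
Lemma osc_real (r : R) : 0 <= r < 1 ->
  osc r = (cos (ln (1 - r)), sin (ln (1 - r))).
Proof.
intros Hr.
assert (Hz : unit_disc (r, 0)).
{ unfold unit_disc. change (Cmod (RtoC r) < 1). rewrite Cmod_R, Rabs_pos_eq; lra. }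
set (p := fun s : R => Re (osc (s * (r, 0))%C)).
set (q := fun s : R => Im (osc (s * (r, 0))%C)).
set (F := fun s => p s * cos (ln (1 - s * r)) + q s * sin (ln (1 - s * r))).
set (G := fun s => q s * cos (ln (1 - s * r)) - p s * sin (ln (1 - s * r))).
assert (Hder : forall t, 0 <= t <= 1 ->
  let b := - r / (1 - t * r) in
  is_derive p t (- b * q t) /\ is_derive q t (b * p t) /\
  is_derive (fun s => cos (ln (1 - s * r))) t (- sin (ln (1 - t * r)) * b) /\
  is_derive (fun s => sin (ln (1 - s * r))) t (cos (ln (1 - t * r)) * b)).
{ intros t Ht b. assert (Hx := ray_denominator r 0 t Hz Ht).
  destruct (osc_ray_derive r 0 t Hz Ht) as [Hp Hq].
  set (d := (1 - t * r) ^ 2 + (t * 0) ^ 2) in *.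
  set (be := - (r - t * (r ^ 2 + 0 ^ 2)) / d) in *.
  change (is_derive p t (0 / d * p t - be * q t)) in Hp.
  change (is_derive q t (0 / d * q t + be * p t)) in Hq.
  assert (Eb : be = b).
  { unfold be, d, b. field. lra. }
  rewrite Eb in Hp, Hq.
  split; [|split; [|split]].
  - evar_last; [exact Hp|]. unfold Rdiv. ring.
  - evar_last; [exact Hq|]. unfold Rdiv. ring.
  - rewrite Rmult_comm. apply (is_derive_comp cos); [apply is_derive_cos|].
    auto_derive; [lra|]. unfold b. field. lra.
  - rewrite Rmult_comm. apply (is_derive_comp sin); [apply is_derive_sin|].
    auto_derive; [lra|]. unfold b. field. lra. }
assert (HF : F 0 = F 1).
{ apply (eq_is_derive (V := R_NormedModule) F 0 1); [|lra]. intros t Ht.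
  destruct (Hder t Ht) as [Hp [Hq [Hc Hs]]]. unfold F. evar_last.
  - apply (is_derive_plus (V := R_NormedModule)).
    + apply (is_derive_mult p _ t _ _ Hp Hc Rmult_comm).
    + apply (is_derive_mult q _ t _ _ Hq Hs Rmult_comm).
  - unfold plus, mult, zero; simpl. ring. }
assert (HG : G 0 = G 1).
{ apply (eq_is_derive (V := R_NormedModule) G 0 1); [|lra]. intros t Ht.
  destruct (Hder t Ht) as [Hp [Hq [Hc Hs]]]. unfold G. evar_last.
  - apply (is_derive_minus (V := R_NormedModule)).
    + apply (is_derive_mult q _ t _ _ Hq Hc Rmult_comm).
    + apply (is_derive_mult p _ t _ _ Hp Hs Rmult_comm).
  - unfold minus, opp, plus, mult, zero; simpl. ring. }
assert (E0 : p 0 = 1 /\ q 0 = 0).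
{ unfold p, q. rewrite Cmult_0_l. rewrite osc_0.
  unfold Re, Im; simpl. auto. }
assert (E1 : osc r = (p 1, q 1)).
{ unfold p, q. rewrite Cmult_1_l. unfold Re, Im. apply surjective_pairing. }
rewrite E1. unfold F, G in HF, HG. destruct E0 as [E0p E0q].
replace (1 - 0 * r) with 1 in HF, HG by ring.
replace (1 - 1 * r) with (1 - r) in HF, HG by ring.
rewrite E0p, E0q, ln_1, cos_0, sin_0 in HF, HG.
generalize (sin2_cos2 (ln (1 - r))). unfold Rsqr. intros Hsc.
set (c := cos (ln (1 - r))) in *. set (s := sin (ln (1 - r))) in *.
f_equal.
- replace (p 1) with (c * (p 1 * c + q 1 * s) - s * (q 1 * c - p 1 * s)
    + p 1 * (1 - (s * s + c * c))) by ring.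
  rewrite <- HF, <- HG, Hsc. ring.
- replace (q 1) with (s * (p 1 * c + q 1 * s) + c * (q 1 * c - p 1 * s)
    + q 1 * (1 - (s * s + c * c))) by ring.
  rewrite <- HF, <- HG, Hsc. ring.
Qed.

(** At [1 - e^(-t)] the value of [osc] is [e^(-it)]. The index [S k] keeps the radius positive, as
    dilations require. *)
Lemma osc_even (k : nat) : osc (1 - exp (- (2 * INR (S k) * PI)))%R = 1%C.
Proof.
assert (Hk : 1 <= INR (S k)) by (rewrite S_INR; generalize (pos_INR k); lra).
generalize PI_RGT_0; intros HPI.
assert (He : 0 < exp (- (2 * INR (S k) * PI)) <= 1).
{ split; [apply exp_pos|]. rewrite <- exp_0. left. apply exp_increasing. nra. }
rewrite osc_real by lra.
replace (1 - (1 - exp (- (2 * INR (S k) * PI)))) with (exp (- (2 * INR (S k) * PI))) by ring.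
rewrite ln_exp, cos_neg, sin_neg.
replace (2 * INR (S k) * PI) with (0 + 2 * INR (S k) * PI) by ring.
rewrite cos_period, sin_period, cos_0, sin_0. unfold RtoC. f_equal. ring.
Qed.

Lemma osc_odd (k : nat) : osc (1 - exp (- (PI + 2 * INR k * PI)))%R = (- (1))%C.
Proof.
generalize (pos_INR k); intros Hk. generalize PI_RGT_0; intros HPI.
assert (He : 0 < exp (- (PI + 2 * INR k * PI)) <= 1).
{ split; [apply exp_pos|]. rewrite <- exp_0. left. apply exp_increasing. nra. }
rewrite osc_real by lra.
replace (1 - (1 - exp (- (PI + 2 * INR k * PI)))) with (exp (- (PI + 2 * INR k * PI))) by ring.
rewrite ln_exp, cos_neg, sin_neg.
rewrite cos_period, sin_period, cos_PI, sin_PI. unfold RtoC, Copp; simpl. f_equal.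
Qed.

(** * The disc algebra *)

(** The extension by boundary limits is continuous along the circle because its value at a boundary
    point [w] close to [z] is approximated by [f v] for an interior [v] so close to [w] that it is
    still close to [z]. *)
Lemma boundary_limits_disc_algebra (f : C -> C) :
  analytic f ->
  (forall zeta, Cmod zeta = 1 -> exists l, filterlim f (boundary_filter zeta) (C_locally l)) ->
  in_disc_algebra f.
Proof.
intros Hf Hlim. split; auto.
set (lim := fun zeta : C =>
  @iota C_CompleteNormedModule (fun l => filterlim f (boundary_filter zeta) (C_locally l))).
assert (Hl : forall zeta, Cmod zeta = 1 -> forall eps, 0 < eps ->
  exists d, 0 < d /\ forall w, Cmod (w - zeta) < d -> unit_disc w -> Cmod (f w - lim zeta) < eps).
{ intros zeta Hz eps Heps. destruct (Hlim zeta Hz) as [l H].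
  assert (HP := boundary_filter_proper zeta Hz).
  replace (lim zeta) with l.
  - apply (boundary_filter_eps zeta (fun w => Cmod (f w - l) < eps)).
    now apply (proj1 (C_filterlim_eps _ f l) H).
  - symmetry. apply (@iota_unique C_AbsRing C_CompleteNormedModule); auto.
    intros y Hy. exact (C_filterlim_unique _ f y l Hy H). }
set (F := fun z => if Rlt_dec (Cmod z) 1 then f z else lim z).
assert (HF1 : eq_on_disc F f).
{ intros z Hz. unfold F. destruct (Rlt_dec (Cmod z) 1); [auto|now destruct n]. }
exists F. split; auto.
intros z Hz. apply C_filterlim_eps; [apply within_filter, locally_filter|].
intros eps Heps.
apply (C_locally_eps z (fun w => closed_disc w -> Cmod (F w - F z) < eps)).
destruct (Rlt_dec (Cmod z) 1) as [Hz1|Hz1].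
- assert (Hc := analytic_continuous f z Hf Hz1). rewrite C_continuous_eps in Hc.
  destruct (Hc eps Heps) as [d [Hd Hcd]].
  exists (Rmin d (1 - Cmod z)). split; [apply Rmin_glb_lt; lra|].
  intros w Hw _.
  assert (Hw1 : unit_disc w).
  { apply (disc_nbhd z); auto. eapply Rlt_le_trans; [exact Hw|apply Rmin_r]. }
  rewrite !HF1 by auto. apply Hcd. eapply Rlt_le_trans; [exact Hw|apply Rmin_l].
- assert (Hz2 : Cmod z = 1) by (unfold closed_disc in Hz; lra).
  assert (EF : F z = lim z) by (unfold F; destruct (Rlt_dec (Cmod z) 1); tauto).
  rewrite EF.
  destruct (Hl z Hz2 (eps / 2) ltac:(lra)) as [d [Hd Hd']].
  exists d. split; auto. intros w Hw Hwc.
  unfold F. destruct (Rlt_dec (Cmod w) 1) as [Hw1|Hw1].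
  + apply Rlt_trans with (eps / 2); [|lra]. now apply Hd'.
  + assert (Hw2 : Cmod w = 1) by (unfold closed_disc in Hwc; lra).
    destruct (Hl w Hw2 (eps / 2) ltac:(lra)) as [d1 [Hd1 Hd1']].
    assert (HPw := boundary_filter_proper w Hw2).
    destruct (filter_ex (F := boundary_filter w)
      (fun v => (unit_disc v /\ Cmod (v - w) < Rmin d1 (d - Cmod (w - z))))) as [v [Hv Hvw]].
    { apply boundary_filter_eps. exists (Rmin d1 (d - Cmod (w - z))).
      split; [apply Rmin_glb_lt; lra|auto]. }
    assert (Hv1 := Hd1' v (Rlt_le_trans _ _ _ Hvw (Rmin_l _ _)) Hv).
    assert (Hvz : Cmod (v - z) < d).
    { replace (v - z)%C with ((v - w) + (w - z))%C by ring.
      eapply Rle_lt_trans; [apply Cmod_triangle|].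
      assert (Hr := Rlt_le_trans _ _ _ Hvw (Rmin_r _ _)). lra. }
    assert (Hv2 := Hd' v Hvz Hv).
    replace (lim w - lim z)%C with ((f v - lim z) + - (f v - lim w))%C by ring.
    eapply Rle_lt_trans; [apply Cmod_triangle|]. rewrite Cmod_opp. lra.
Qed.

(** * Functionals on dilations, and the boundary limits of [T_g f] *)

Lemma dilate_functional (X : banach_of_analytic) (x : X) (r : nat -> R) (L : X -> C) (c : C) :
  reflexive X -> admissible X -> in_dual X L ->
  (forall k, 0 < r k < 1) -> is_lim_seq r 1 ->
  (forall k y, eq_on_disc (fn y) (dilate (r k) (fn x)) -> L y = c) ->
  L x = c.
Proof.
intros Hrefl [_ [[Hdil [K HK]] Hev]] HL Hr Hr1 Hc.
assert (Hu : exists u : nat -> X, forall k, eq_on_disc (fn (u k)) (dilate (r k) (fn x))).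
{ exists (fun k => proj1_sig (constructive_indefinite_description _ (Hdil x (r k) (Hr k)))).
  intros k. apply (proj2_sig (constructive_indefinite_description _ (Hdil x (r k) (Hr k)))). }
destruct Hu as [u Hu].
(* (P2) bounds the norms of the dilations, and they tend to [x] pointwise by continuity inside the
   disc. *)
apply (reflexive_pointwise_limit X u x (K * norm x) L c); auto.
- intros k. specialize (HK x (r k) (Hr k)). rewrite (ext_norm_eq X (u k)) in HK by auto.
  exact HK.
- intros z Hz.
  apply (filterlim_ext (fun k => fn x (r k * z)%C)).
  { intros k. symmetry. now apply Hu. }
  assert (Hcont := analytic_continuous (fn x) z (fn_analytic X x) Hz).
  apply (filterlim_comp _ _ _ (fun k => (r k * z)%C) (fn x) _ (C_locally z)); auto.
  replace (C_locally z) with (C_locally (1 * z)%C) by (f_equal; ring).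
  apply C_filterlim_mult; [apply eventually_filter| |apply filterlim_const].
  apply (filterlim_comp _ _ _ r RtoC _ (locally 1)); [exact Hr1|].
  apply path_continuous_RtoC.
- intros k. eapply Hc, Hu.
Qed.

Lemma is_lim_seq_osc (a b : R) :
  0 < a -> is_lim_seq (fun k => 1 - exp (- (b + a * INR k))) 1.
Proof.
intros Ha. replace (Finite 1) with (Finite (1 - 0)) by (f_equal; ring).
apply is_lim_seq_minus'; [apply is_lim_seq_const|].
apply (is_lim_comp_seq exp (fun k => - (b + a * INR k)) m_infty 0).
- apply is_lim_exp_m.
- exists 0%nat. discriminate.
- replace m_infty with (Rbar_opp p_infty) by reflexivity. apply -> is_lim_seq_opp.
  eapply is_lim_seq_plus; [apply is_lim_seq_const| |].
  + eapply is_lim_seq_mult; [apply is_lim_seq_const|apply is_lim_seq_INR|].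
    now apply is_Rbar_mult_sym, is_Rbar_mult_p_infty_pos.
  + reflexivity.
Qed.

Lemma volterra_boundary_limit (X : banach_of_analytic) (g : C -> C) (x : X) (zeta : C) :
  analytic g -> reflexive X -> admissible X ->
  (forall f, in_Hinf f -> in_space X f) ->
  volterra_bounded_to in_Hinf X g -> Cmod zeta = 1 ->
  exists l, filterlim (volterra g (fn x)) (boundary_filter zeta) (C_locally l).
Proof.
intros Hg Hrefl Hadm HHX HT Hzeta.
apply volterra_bounded_to_Hinf in HT; auto. destruct HT as [M [HM0 HM]].
assert (HPz := boundary_filter_proper zeta Hzeta).
destruct (HHX (fun _ => 1%C)) as [one Hone].
{ split; [apply analytic_const|]. apply (sup_norm_finite _ 1), sup_norm_le.
  intros z _. rewrite Cmod_1. apply Rle_refl. }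
(* The rotation by [Cconj zeta] moves the singularity of [osc] from 1 to [zeta]. *)
destruct (HHX (fun z => osc (Cconj zeta * z)%C)) as [h Hh].
{ split; [apply analytic_scaled; [apply osc_analytic|rewrite Cmod_conj; lra]|].
  apply (sup_norm_finite _ (exp PI)), sup_norm_le. intros z Hz. apply osc_bound.
  apply disc_scaled; auto. rewrite Cmod_conj. lra. }
(* [T_g 1 = g - g(0)], so the bound on [T_g] at the constant 1 bounds [g]. *)
assert (HgB : exists G, forall z, unit_disc z -> Cmod (g z) <= G).
{ exists (M * norm one + Cmod (g 0%C)). intros z Hz.
  replace (g z) with (volterra g (fn one) z + g 0%C)%C.
  - eapply Rle_trans; [apply Cmod_triangle|]. apply Rplus_le_compat_r. now apply HM.
  - unfold volterra. rewrite (int0_primitive _ g); auto; [ring| |].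
    + apply analytic_mult; [apply fn_analytic|now apply analytic_derive].
    + intros w Hw. rewrite Hone, Cmult_1_l by auto. now apply analytic_is_derive. }
destruct HgB as [G HG].
assert (Hbd : forall y : X, boundary_filter zeta (fun z => Cmod (volterra g (fn y) z) <= M * norm y)).
{ intros y. apply boundary_filter_eps. exists 1. split; [lra|]. intros z _ Hz. now apply HM. }
apply (C_filterlim_of_ultra (boundary_filter zeta) _ (M * norm x)); [apply Hbd|].
intros U1 U2 l1 l2 HU1 HU2 HF1 HF2 HP1 HP2 Hl1 Hl2.
(* Each [T_g y] is bounded near [zeta], so its limit along an ultrafilter exists; [iota] only
   selects it. *)
set (lim := fun (U : (C -> Prop) -> Prop) (y : X) =>
  @iota C_CompleteNormedModule (fun l => filterlim (volterra g (fn y)) U (C_locally l))).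
assert (Hiota : forall U, ProperFilter U -> forall y l,
   filterlim (volterra g (fn y)) U (C_locally l) -> lim U y = l).
{ intros U HU y l Hl. apply (@iota_unique C_AbsRing C_CompleteNormedModule); auto.
  intros v Hv. exact (C_filterlim_unique U _ v l Hv Hl). }
assert (Hlim : forall U, ProperFilter U -> filter_le U (boundary_filter zeta) ->
   (forall P, U P \/ U (fun x => ~ P x)) ->
   forall y, filterlim (volterra g (fn y)) U (C_locally (lim U y))).
{ intros U HU HF HP y. destruct (C_ultra_lim U (volterra g (fn y)) _ HU HP (HF _ (Hbd y))) as [l Hl].
  now rewrite (Hiota U HU y l Hl). }
assert (HUD : forall U, filter_le U (boundary_filter zeta) -> U unit_disc).
{ intros U HF. apply HF. apply boundary_filter_eps. exists 1. split; [lra|auto]. }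
assert (Hdual : forall U, ProperFilter U -> filter_le U (boundary_filter zeta) ->
   (forall P, U P \/ U (fun x => ~ P x)) ->
   (forall y1 y2, lim U (plus y1 y2) = (lim U y1 + lim U y2)%C) /\
   (forall c y, lim U (scal c y) = (c * lim U y)%C) /\
   (forall y, Cmod (lim U y) <= M * norm y)).
{ intros U HU HF HP. assert (HUl := Hlim U HU HF HP). split; [|split].
  - intros y1 y2. apply Hiota; auto.
    apply (filterlim_ext_loc (fun z => volterra g (fn y1) z + volterra g (fn y2) z)%C).
    + generalize (HUD U HF). apply filter_imp. intros z Hz. symmetry. now apply volterra_plus.
    + apply C_filterlim_plus; auto. apply HU.
  - intros c y. apply Hiota; auto.
    apply (filterlim_ext_loc (fun z => c * volterra g (fn y) z)%C).
    + generalize (HUD U HF). apply filter_imp. intros z Hz. symmetry. now apply volterra_scal.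
    + apply C_filterlim_mult; auto; [apply HU|apply filterlim_const].
  - intros y. apply (C_filterlim_Cmod_le U _ _ _ (HUl y)). apply HF, Hbd. }
set (L := fun y => (lim U1 y - lim U2 y)%C).
assert (HL : in_dual X L).
{ destruct (Hdual U1 HU1 HF1 HP1) as [Hp1 [Hs1 Hn1]].
  destruct (Hdual U2 HU2 HF2 HP2) as [Hp2 [Hs2 Hn2]]. split.
  - intros y1 y2. unfold L. rewrite Hp1, Hp2.
    change (lim U1 y1 + lim U1 y2 - (lim U2 y1 + lim U2 y2) =
      (lim U1 y1 - lim U2 y1) + (lim U1 y2 - lim U2 y2))%C. ring.
  - intros c y. unfold L. rewrite Hs1, Hs2.
    change (c * lim U1 y - c * lim U2 y = c * (lim U1 y - lim U2 y))%C. ring.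
  (* A bounded linear map must come with a positive constant, and [M] may be 0. *)
  - exists (2 * M + 1). split; [lra|]. intros y.
    change (Cmod (lim U1 y + - lim U2 y) <= (2 * M + 1) * norm y).
    eapply Rle_trans; [apply Cmod_triangle|]. rewrite Cmod_opp.
    generalize (Hn1 y) (Hn2 y) (@norm_ge_0 C_AbsRing X y). lra. }
assert (HgU : forall U, filter_le U (boundary_filter zeta) ->
   ProperFilter U -> U (fun z => Cmod (g z) <= G)).
{ intros U HF HU. generalize (HUD U HF). apply filter_imp. auto. }
(* The difference [g1 - g2] is the value of [L] at the constant 1, the constant [g(0)] having
   cancelled. *)
destruct (C_ultra_lim U1 g G HU1 HP1 (HgU U1 HF1 HU1)) as [g1 Hg1].
destruct (C_ultra_lim U2 g G HU2 HP2 (HgU U2 HF2 HU2)) as [g2 Hg2].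
(* [T_g f_r - f(r zeta) g] has the same limit along both ultrafilters, since it converges along the
   boundary filter itself; it cancels in [L] and only the oscillation of [g] is left. *)
assert (Hkey : forall (f : X) r y, 0 < r < 1 -> eq_on_disc (fn y) (dilate r (fn f)) ->
   L y = (fn f (r * zeta)%C * (g1 - g2))%C).
{ intros f r y Hr Hy.
  destruct (volterra_dilate_limit (fn f) g r G zeta (fn_analytic X f) Hg HG Hr Hzeta) as [l Hl].
  assert (HU : forall U gU, ProperFilter U -> filter_le U (boundary_filter zeta) ->
     filterlim g U (C_locally gU) -> lim U y = (l + fn f (r * zeta)%C * gU)%C).
  { intros U gU HU HF HgU'. apply Hiota; auto.
    apply (filterlim_ext_loc (fun z => (volterra g (dilate r (fn f)) z - fn f (r * zeta)%C * g z)
       + fn f (r * zeta)%C * g z)%C).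
    - generalize (HUD U HF). apply filter_imp. intros z Hz.
      replace (volterra g (fn y) z) with (volterra g (dilate r (fn f)) z); [ring|].
      apply int0_ext; auto. intros w Hw. now rewrite Hy.
    - apply C_filterlim_plus; [apply HU| |].
      + eapply filterlim_filter_le_1; [exact HF|exact Hl].
      + apply C_filterlim_mult; [apply HU|apply filterlim_const|exact HgU']. }
  unfold L. rewrite (HU U1 g1), (HU U2 g2) by auto. ring. }
assert (Hhz : forall r, 0 < r < 1 -> fn h (r * zeta)%C = osc r).
{ intros r Hr. rewrite Hh.
  - f_equal. replace (Cconj zeta * (r * zeta))%C with (r * (zeta * Cconj zeta))%C by ring.
    rewrite <- Cmod2_conj, Hzeta. simpl. rewrite !Rmult_1_r. ring.
  - unfold unit_disc. rewrite Cmod_mult, Hzeta, Cmod_R, Rabs_pos_eq; lra. }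
generalize PI_RGT_0; intros HPI.
assert (Hpos : forall t, 0 < t -> 0 < 1 - exp (- t) < 1).
{ intros t Ht. assert (exp (- t) < 1) by (rewrite <- exp_0; apply exp_increasing; lra).
  generalize (exp_pos (- t)). lra. }
(* On these radii [h(r zeta) = 1], so [L] takes the constant value [g1 - g2] on the corresponding
   dilations of [h], and reflexivity passes it on to [h] itself. *)
assert (Heven : L h = (g1 - g2)%C).
{ apply (dilate_functional X h (fun k => 1 - exp (- (2 * INR (S k) * PI)))); auto.
  - intros k. apply Hpos. assert (0 < INR (S k)) by (apply lt_0_INR; lia). nra.
  - eapply is_lim_seq_ext; [|apply (is_lim_seq_osc (2 * PI) (2 * PI)); lra].
    intros k. cbv beta. rewrite S_INR. do 3 f_equal. ring.
  - intros k y Hy. rewrite (Hkey h _ y) with (2 := Hy).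
    + rewrite Hhz, osc_even; [ring|].
      apply Hpos. assert (0 < INR (S k)) by (apply lt_0_INR; lia). nra.
    + apply Hpos. assert (0 < INR (S k)) by (apply lt_0_INR; lia). nra. }
assert (Hodd : L h = (- (1) * (g1 - g2))%C).
{ apply (dilate_functional X h (fun k => 1 - exp (- (PI + 2 * INR k * PI)))); auto.
  - intros k. apply Hpos. generalize (pos_INR k). nra.
  - eapply is_lim_seq_ext; [|apply (is_lim_seq_osc (2 * PI) PI); lra].
    intros k. cbv beta. do 3 f_equal. ring.
  - intros k y Hy. rewrite (Hkey h _ y) with (2 := Hy).
    + rewrite Hhz, osc_odd; [ring|]. apply Hpos. generalize (pos_INR k). nra.
    + apply Hpos. generalize (pos_INR k). nra. }
assert (Hgam : (g1 - g2 = 0)%C).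
{ rewrite Heven in Hodd.
  replace (g1 - g2)%C with (/ 2 * ((g1 - g2) - - (1) * (g1 - g2)))%C.
  - rewrite <- Hodd. ring.
  - field. }
(* With [g1 = g2] the functional [L] vanishes at every dilation of [x], so any sequence of radii in
   [(0, 1)] tending to 1 will do. *)
assert (HLx : L x = 0%C).
{ apply (dilate_functional X x (fun k => 1 - exp (- (1 + 1 * INR k)))); auto.
  - intros k. apply Hpos. generalize (pos_INR k). lra.
  - apply is_lim_seq_osc. lra.
  - intros k y Hy. rewrite (Hkey x _ y) with (2 := Hy); [rewrite Hgam; ring|].
    apply Hpos. generalize (pos_INR k). lra. }
unfold L in HLx. rewrite (Hiota U1 HU1 x l1 Hl1), (Hiota U2 HU2 x l2 Hl2) in HLx.
replace l1 with ((l1 - l2) + l2)%C by ring. rewrite HLx. ring.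
Qed.

Theorem theorem1p1 :
  forall (g : C -> C) (beta : nat -> R),
    analytic g ->
    (forall n, 0 < beta n) ->
    is_lim_seq (fun n => Rpower (beta n) (/ INR n)) 1 ->
    (forall X Y : banach_of_analytic,
       dual_via beta X Y ->
       (forall (x : X) (z : C), unit_disc z ->
          is_pairing beta (fn x) (sym_G beta g z) (volterra g (fn x) z)) /\
       (volterra_bounded_to in_Hinf X g <->
        exists M : R, forall z, unit_disc z -> Rbar_le (ext_norm Y (sym_G beta g z)) M)) /\
    (forall X : banach_of_analytic,
       reflexive X -> admissible X ->
       (forall f, in_Hinf f -> in_space X f) ->
       (volterra_bounded_to in_Hinf X g <-> volterra_bounded_to in_disc_algebra X g)).
Proof.
intros g beta Hg Hb Hl. split.
- intros X Y HXY. split.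
  + intros x z Hz. apply volterra_pairing; auto. apply fn_analytic.
  + now apply dual_pairing_criterion with (beta := beta).
- intros X Hrefl Hadm HHX. split.
  + intros HT. split; [|apply HT]. intros x. apply boundary_limits_disc_algebra.
    * apply volterra_analytic; auto. apply fn_analytic.
    * intros zeta Hz. now apply (volterra_boundary_limit X).
  + intros [HA [M HM]]. split; [|now exists M]. intros x. split; [apply HA|].
    eapply sup_norm_finite, HM.
Qed.
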